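(* Let $q$ be a prime power. The group $SL_2(q)$ admits a Beauville structure if and only if $q>5$. Moreover, for every prime power $q>5$ it admits a strongly real Beauville structure.
   Context: $SL_2(q)$ is the group of $2\times 2$ matrices of determinant $1$ over the finite field $F_q$ with $q$ elements. A (unmixed) Beauville structure for a finite group $G$ is a pair of triples $(x_i,y_i,z_i)$ ($i=1,2$) of elements of $G$, each of which generates $G$, of orders $(l_i,m_i,n_i)$ (i.e. $x_i,y_i,z_i$ have orders $l_i,m_i,n_i$ respectively), such that: (1) $x_iy_iz_i=1$ for each $i=1,2$; (2) $l_i^{-1}+m_i^{-1}+n_i^{-1}<1$ for each $i=1,2$; (3) no non-identity power of $x_1$, $y_1$ or $z_1$ is conjugate in $G$ to a power of $x_2$, $y_2$ or $z_2$. A Beauville structure $(x_i,y_i,z_i)$, $i=1,2$, on $G$ is strongly real if there are automorphisms $\alpha_1,\alpha_2$ of $G$, differing by an inner automorphism of $G$, such that for each $i=1,2$ the automorphism $\alpha_i$ inverts two elements of the triple $(x_i,y_i,z_i)$ (that is, sends each of two of the three entries to its inverse). *)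

(* Defs.v *)
From HB Require Import structures.
From mathcomp Require Import all_boot all_order all_algebra all_fingroup.

Set Implicit Arguments.
Unset Strict Implicit.
Unset Printing Implicit Defensive.

Import Order.TTheory GRing.Theory Num.Theory GroupScope.

Local Open Scope group_scope.

Definition prime_power (q : nat) : Prop :=
  exists p k : nat, [/\ prime p, 0 < k & q = (p ^ k)%N].

Definition SL2 (F : finFieldType) : {set {'GL_2[F]}} :=
  [set u : {'GL_2[F]} | (\det (GLval u) == 1)%R].

Lemma SL2_group_set (F : finFieldType) : group_set (SL2 F).
Proof.
apply/group_setP; split=> [|u v]; first by rewrite inE det1.
by rewrite !inE GL_MxE det_mulmx => /eqP-> /eqP->; rewrite mulr1.
Qed.

Canonical SL2_group (F : finFieldType) : {group {'GL_2[F]}} :=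
  Group (SL2_group_set F).

Section Beauville.

Variable gT : finGroupType.
Implicit Types (G : {group gT}) (t : gT * gT * gT).

(* That the entries lie in G follows from their generating it. *)
Definition generating_triple G t : Prop :=
  let: (x, y, z) := t in <<[set x; y; z]>> = G.

Definition product_one t : Prop :=
  let: (x, y, z) := t in x * y * z = 1.

Definition hyperbolic t : Prop :=
  let: (x, y, z) := t in
  (#[x]%:R^-1 + #[y]%:R^-1 + #[z]%:R^-1 < 1 :> rat)%R.

Definition entries t : seq gT :=
  let: (x, y, z) := t in [:: x; y; z].

Definition no_conjugate_powers G t1 t2 : Prop :=
  forall a b, a \in entries t1 -> b \in entries t2 ->
  forall u v, u \in <[a]> -> v \in <[b]> -> u != 1 -> v \notin u ^: G.

Definition Beauville_structure G t1 t2 : Prop :=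
  [/\ generating_triple G t1 /\ generating_triple G t2,
      product_one t1 /\ product_one t2,
      hyperbolic t1 /\ hyperbolic t2
    & no_conjugate_powers G t1 t2].

Definition inverts (alpha : {perm gT}) (x : gT) : Prop := alpha x = x^-1.

Definition inverts_two (alpha : {perm gT}) t : Prop :=
  let: (x, y, z) := t in
  [\/ inverts alpha x /\ inverts alpha y,
      inverts alpha x /\ inverts alpha z
    | inverts alpha y /\ inverts alpha z].

Definition differ_by_inner G (alpha1 alpha2 : {perm gT}) : Prop :=
  exists2 g, g \in G & alpha2 = alpha1 * conj_aut G g.

Definition strongly_real G t1 t2 : Prop :=
  exists alpha1 alpha2 : {perm gT},
    [/\ alpha1 \in Aut G, alpha2 \in Aut G,
        differ_by_inner G alpha1 alpha2,
        inverts_two alpha1 t1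
      & inverts_two alpha2 t2].

Definition admits_Beauville_structure G : Prop :=
  exists t1 t2, Beauville_structure G t1 t2.

Definition admits_strongly_real_Beauville_structure G : Prop :=
  exists t1 t2, Beauville_structure G t1 t2 /\ strongly_real G t1 t2.

End Beauville.

(* Main.v *)
Require Import Defs.
From mathcomp Require Import all_boot all_order all_algebra all_fingroup.
From mathcomp Require Import all_solvable all_field ring lra zify.

(** Small fields.  If #|F| is odd, then -1 is the only involution of SL_2(F),
    hence a power of every element of even order, and one of the two triples
    has only odd orders.  If a prime r divides the order of the group exactly
    once, the subgroups of order r are conjugate, and r cannot divide orders in
    both triples.  For #|F| <= 5, where the order of an element is read off
    from its trace, these two facts leave only triples that generate a
    quaternion group or an abelian group ([not_admits_small]).

    Strong reality.  If z = x y - y x is invertible, conjugation by z inverts x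
    and y.  The automorphisms obtained in this way from two pairs differ by an
    inner automorphism as soon as the product of the two determinants det z is
    a square ([strongly_real_pair]).  If x is unipotent, det z is minus a
    square; the second pair is chosen with the same property.

    The triples.  Let p be the characteristic.  For odd #|F| the first triple
    has orders p, p and n, where an element of order n generates, up to sign, a
    nonsplit torus; for even #|F| it consists of an involution and two elements
    without eigenvectors.  The elements of the second triple are diagonal in
    suitable bases over F, and one of them generates, up to sign, a split
    torus.  Their orders divide #|F| - 1, which is prime to p, and a power of
    an element without eigenvectors is scalar or has no eigenvector; so only
    -1 could be a common power, and it is excluded because in one of the two
    triples the relevant orders are odd ([no_conj_nonsplit]).

    Generation.  Let H be a subgroup, and for a vector v let A(v) be the
    additive group of all a such that the transvection
    w |-> w + a (w1 v2 - w2 v1) v belongs to H.  The multipliers of A(v) form a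
    subring K of F, so that K = F or #|K|^2 <= #|F|; an element of H that
    multiplies v by k puts k^2 into K.  Suppose that H contains, up to sign, a
    torus; it is transitive on the level sets of its quadratic form N.  Then
    for a transvection u in H all the square values of N(vu)/N(v) lie in K, for
    suitable v.  Each value is taken few times, so these are too many values
    for a proper subfield, unless #|F| is small; the field of order 9 is a
    genuine exception, because of the subgroup SL_2(5).  Hence K = F and
    H = SL_2(F) ([nonsplit_generation], [split_generation_odd]).  The first
    triple contains a transvection.  The group of the second one does too: the
    condition that det z is minus a square says exactly that some diagonal
    multiple of y has trace 2 ([split_pair_odd]).

    The fields of order 7 and 9 are out of reach of this construction; for them
    explicit matrices are checked by computation. *)

Set Implicit Arguments.
Unset Strict Implicit.
Unset Printing Implicit Defensive.

Import GRing.Theory GroupScope.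
Local Open Scope ring_scope.

(** * Matrices and transvections *)

Section Matrices2.

Variable F : finFieldType.
Implicit Types (a b c d e f g h : F).

Definition mx2 (a b c d : F) : 'M[F]_2 :=
  \matrix_(i, j) (if i == 0 then if j == 0 then a else b
                  else if j == 0 then c else d).

Lemma mx2_eta (M : 'M[F]_2) : M = mx2 (M 0 0) (M 0 1) (M 1 0) (M 1 1).
Proof.
apply/matrixP=> i j; rewrite mxE.
by case: (unliftP 0 i) => [i'|] ->; case: (unliftP 0 j) => [j'|] ->;
   rewrite ?ord1 ?lift0 //=; congr (M _ _); apply: val_inj.
Qed.

Lemma mx2_mul a b c d e f g h :
  mx2 a b c d *m mx2 e f g h =
  mx2 (a * e + b * g) (a * f + b * h) (c * e + d * g) (c * f + d * h).
Proof.
rewrite [LHS]mx2_eta; congr mx2;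
by rewrite !mxE !big_ord_recl big_ord0 !mxE /= addr0.
Qed.

Lemma mx2_det a b c d : \det (mx2 a b c d) = a * d - b * c.
Proof. rewrite (expand_det_row _ 0) !big_ord_recl big_ord0 /cofactor !det_mx11 !mxE /=; ring. Qed.

Lemma mx2_inj a b c d e f g h : mx2 a b c d = mx2 e f g h ->
  [/\ a = e, b = f, c = g & d = h].
Proof.
by move=> /matrixP eqM; move: (eqM 0 0) (eqM 0 1) (eqM 1 0) (eqM 1 1);
   rewrite !mxE.
Qed.

Lemma mx2_1 : 1%:M = mx2 1 0 0 1.
Proof. by rewrite [LHS]mx2_eta !mxE. Qed.

End Matrices2.

Arguments mx2 {F} (a b c d)%_R.

(** The general linear group is used through this interface, so that no proof
    depends on how invertible matrices are encoded as a finite group. *)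
Record gl2 (F : finFieldType) := Gl2 {
  gl2_group :> finGroupType;
  gmx : gl2_group -> 'M[F]_2;
  gmxM : forall x y, gmx (x * y)%g = gmx x *m gmx y;
  gmx_inj : injective gmx;
  gmx_onto : forall M, \det M != 0 -> {x | gmx x = M}
}.

Section Coordinates.

Variables (F : finFieldType) (gl : gl2 F).
Implicit Types (a b c d e f g h k : F) (x y : gl) (v w : F * F).

Lemma gmx1 : gmx (1%g : gl) = 1%:M.
Proof.
have [x x1] : {x : gl | gmx x = 1%:M} by apply: gmx_onto; rewrite det1 oner_neq0.
by rewrite -[LHS]mul1mx -x1 -gmxM mulg1.
Qed.

Definition SL : {set gl} := [set x | \det (gmx x) == 1].

Lemma SL_group_set : group_set SL.
Proof.
apply/group_setP; split=> [|x y]; first by rewrite inE gmx1 det1.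
by rewrite !inE gmxM det_mulmx => /eqP-> /eqP->; rewrite mulr1.
Qed.

Canonical SL_group : {group gl} := Group SL_group_set.

Lemma sl_exists a b c d :
  {x : gl | a * d - b * c = 1 -> gmx x = mx2 a b c d}.
Proof.
have [det1|ndet1] := eqVneq (a * d - b * c) 1; last by exists 1%g => det1; rewrite det1 eqxx in ndet1.
by have [|x <-] := @gmx_onto _ gl (mx2 a b c d); [rewrite mx2_det det1 oner_neq0 | exists x].
Qed.

(** An arbitrary element unless a d - b c = 1. *)
Definition sl a b c d : gl := sval (sl_exists a b c d).

Lemma sl_val a b c d : a * d - b * c = 1 -> gmx (sl a b c d) = mx2 a b c d.
Proof. exact: svalP (sl_exists a b c d). Qed.

Lemma sl_in a b c d : a * d - b * c = 1 -> sl a b c d \in SL.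
Proof. by move=> det1; rewrite inE sl_val // mx2_det det1. Qed.

Lemma SLE x : x \in SL ->
  exists a b c d, a * d - b * c = 1 /\ x = sl a b c d.
Proof.
rewrite inE => /eqP; rewrite [X in \det X]mx2_eta mx2_det => det1.
do 4 eexists; split; first exact: det1.
by apply: gmx_inj; rewrite sl_val // -mx2_eta.
Qed.

Lemma sl_mul a b c d e f g h : a * d - b * c = 1 -> e * h - f * g = 1 ->
  (sl a b c d * sl e f g h)%g =
  sl (a * e + b * g) (a * f + b * h) (c * e + d * g) (c * f + d * h).
Proof.
move=> det1 det2; apply: gmx_inj; rewrite gmxM !sl_val ?mx2_mul //.
by transitivity ((a * d - b * c) * (e * h - f * g)); [ring | rewrite det1 det2 mulr1].
Qed.

Lemma sl1 : sl 1 0 0 1 = 1%g.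
Proof.
by apply: gmx_inj; rewrite gmx1 sl_val -?mx2_1 //; ring.
Qed.

Lemma sl_inv a b c d : a * d - b * c = 1 -> (sl a b c d)^-1%g = sl d (- b) (- c) a.
Proof.
move=> det1; apply: (mulgI (sl a b c d)); rewrite mulgV sl_mul //; last by rewrite -det1; ring.
by rewrite -sl1; congr sl; rewrite -?det1; ring.
Qed.

Lemma sl_inj a b c d e f g h : a * d - b * c = 1 -> e * h - f * g = 1 ->
  sl a b c d = sl e f g h -> [/\ a = e, b = f, c = g & d = h].
Proof. by move=> d1 d2 /(congr1 (@gmx _ _)); rewrite !sl_val // => /mx2_inj. Qed.

(** The natural action on row vectors. *)
Definition vact v x : F * F :=
  (v.1 * gmx x 0 0 + v.2 * gmx x 1 0, v.1 * gmx x 0 1 + v.2 * gmx x 1 1).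

Definition vscale k v := (k * v.1, k * v.2).

Lemma vact_sl v a b c d : a * d - b * c = 1 ->
  vact v (sl a b c d) = (v.1 * a + v.2 * c, v.1 * b + v.2 * d).
Proof. by move=> det1; rewrite /vact sl_val // !mxE. Qed.

Lemma vactM v x y : vact v (x * y)%g = vact (vact v x) y.
Proof.
rewrite /vact gmxM !mxE !big_ord_recl !big_ord0 /=.
have -> : lift ord0 ord0 = 1 :> 'I_2 by apply: val_inj.
by congr pair; ring.
Qed.

Lemma vact1 v : vact v 1%g = v.
Proof. by rewrite /vact gmx1 !mxE /= !mulr1 !mulr0 addr0 add0r; case: v. Qed.

Lemma vact_scale k v x : vact (vscale k v) x = vscale k (vact v x).
Proof. by rewrite /vact /vscale /=; congr pair; ring. Qed.

(** The transvection w |-> w + a (w1 v2 - w2 v1) v. *)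
Definition transv v a :=
  sl (1 + a * v.1 * v.2) (a * v.2 ^+ 2) (- a * v.1 ^+ 2) (1 - a * v.1 * v.2).

Lemma tv_det v a :
  (1 + a * v.1 * v.2) * (1 - a * v.1 * v.2) - (a * v.2 ^+ 2) * (- a * v.1 ^+ 2) = 1.
Proof. by ring. Qed.

Lemma tvD v a b : (transv v a * transv v b)%g = transv v (a + b).
Proof. by rewrite /transv sl_mul ?tv_det //; congr sl; ring. Qed.

Lemma tv0 v : transv v 0 = 1%g.
Proof. by rewrite -sl1; congr sl; ring. Qed.

Lemma tvV v a : (transv v a)^-1%g = transv v (- a).
Proof. by apply: (mulgI (transv v a)); rewrite mulgV tvD subrr tv0. Qed.

Lemma tvZ k v a : transv (vscale k v) a = transv v (k ^+ 2 * a).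
Proof. by rewrite /transv /=; congr sl; ring. Qed.

Lemma tvJ v a x : x \in SL -> (transv v a ^ x)%g = transv (vact v x) a.
Proof.
case/SLE=> [p [q [r [s [det1 ->]]]]].
apply: (@mulgI _ (sl p q r s)); rewrite -conjgC vact_sl // /transv.
rewrite !sl_mul ?tv_det //.
have ps: p * s = 1 + q * r by rewrite -det1; ring.
by congr sl; rewrite /=; ring: ps.
Qed.

Lemma vact_tv w v a :
  vact w (transv v a) =
  (w.1 + a * (w.1 * v.2 - w.2 * v.1) * v.1, w.2 + a * (w.1 * v.2 - w.2 * v.1) * v.2).
Proof. by rewrite vact_sl ?tv_det //=; congr pair; ring. Qed.

End Coordinates.

Arguments SL {F} gl.
Arguments SL_group {F} gl.
Arguments sl {F gl} (a b c d)%_R.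
Arguments transv {F gl} v (a)%_R.
Arguments vscale {F} (k)%_R v.

(** * Subgroups containing transvections *)

Section Counting.

Lemma leq_card_fibres (T S : finType) (f : T -> S) (A : {set T}) (B : {set S}) n :
    {in A, forall x, f x \in B} ->
    {in B, forall y, #|[set x in A | f x == y]| <= n}%N ->
  (#|A| <= #|B| * n)%N.
Proof.
move=> fAB fib; rewrite -sum1_card (partition_big f (mem B)) //=.
rewrite -sum_nat_const; apply: leq_sum => y yB.
by apply: leq_trans (fib y yB); rewrite sum1dep_card cardsE.
Qed.

Variable F : finFieldType.

Lemma card_roots_leq (p : {poly F}) (A : {set F}) n :
  p != 0 -> (size p <= n.+1)%N -> {in A, forall x, root p x} -> (#|A| <= n)%N.
Proof.
move=> p0 szp Ar; rewrite cardE -ltnS; apply: leq_trans szp.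
apply: max_poly_roots (enum_uniq _) => //.
by apply/allP=> x; rewrite mem_enum; apply: Ar.
Qed.

Definition subring_set (K : {set F}) :=
  [/\ 1 \in K, {in K &, forall x y, x - y \in K} & {in K &, forall x y, x * y \in K}].

Lemma subring_expr (K : {set F}) x n : subring_set K -> x \in K -> x ^+ n \in K.
Proof.
case=> K1 _ KM xK; elim: n => [|n IHn]; first by rewrite expr0.
by rewrite exprS KM.
Qed.

Lemma subring_inv (K : {set F}) x : subring_set K -> x \in K -> x^-1 \in K.
Proof.
move=> ringK xK; have [->|x0] := eqVneq x 0.
  by case: ringK => K1 KB _; rewrite invr0 -(subrr 1) KB.
suff -> : x^-1 = x ^+ (#|F| - 2) by apply: subring_expr.
apply: (mulfI x0); rewrite divff // -exprS.
apply: (mulfI x0); rewrite mulr1 -exprS.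
by rewrite -addn2 subnK ?finNzRing_gt1 ?expf_card.
Qed.

(** A proper subring is a subfield, over which the field has dimension at
    least two. *)
Lemma subring_card_sqr (K : {set F}) :
  subring_set K -> K != setT -> (#|K| ^ 2 <= #|F|)%N.
Proof.
move=> ringK; rewrite -subTset => /subsetPn[t _ tK].
rewrite -mulnn -cardsX -(card_in_imset (f := fun u => u.1 + u.2 * t)) ?max_card //.
case: (ringK) => K1 KB KM [a b] [c d]; rewrite !inE /= => /andP[aK bK] /andP[cK dK] eqt.
have [ebd|nbd] := eqVneq b d; first by move: eqt; rewrite ebd => /addIr->.
case/negP: tK; have -> : t = (a - c) * (d - b)^-1.
  have nz : d - b != 0 by rewrite subr_eq0 eq_sym.
  have ea : a = c + d * t - b * t by rewrite -eqt addrK.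
  by apply: (mulIf nz); rewrite divfK // ea; ring.
by rewrite KM ?subring_inv ?KB.
Qed.

End Counting.

Section Subgroups.

Variables (F : finFieldType) (gl : gl2 F) (H : {group gl}).
Local Notation sl := (@sl F gl).
Local Notation transv := (@transv F gl).
Implicit Types (a b c d k : F) (x y h : gl) (v w : F * F).
Hypothesis sHG : H \subset SL gl.

Lemma tv_orbit h v a : h \in H -> (transv (vact v h) a \in H) = (transv v a \in H).
Proof. by move=> hH; rewrite -tvJ ?(subsetP sHG _ hH) ?groupJr. Qed.

(** Conjugating by the transvections of centre w moves v to v + b w, so that
    all transvections are in H; and the elementary matrices generate. *)
Lemma tv_gen v w : v.1 * w.2 - v.2 * w.1 != 0 ->
  (forall a, transv v a \in H) -> (forall a, transv w a \in H) -> SL gl \subset H.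
Proof.
move=> nvw Hv Hw.
have Hvw b a : transv (v.1 + b * w.1, v.2 + b * w.2) a \in H.
  have := Hv a; rewrite -(@tv_orbit (transv w (b / (v.1 * w.2 - v.2 * w.1)))) //.
  by rewrite vact_tv divfK.
have Hall u a : transv u a \in H.
  have [e|nuw] := eqVneq (u.1 * w.2) (u.2 * w.1).
    have -> : u = vscale ((v.1 * u.2 - v.2 * u.1) / (v.1 * w.2 - v.2 * w.1)) w.
      rewrite [LHS]surjective_pairing /vscale.
      by congr pair; apply: (mulIf nvw); rewrite mulrAC divfK //; ring: e.
    by rewrite tvZ.
  have {nuw}nuw : u.1 * w.2 - u.2 * w.1 != 0 by rewrite subr_eq0.
  have -> : u = vscale ((u.1 * w.2 - u.2 * w.1) / (v.1 * w.2 - v.2 * w.1))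
     (v.1 + (v.1 * u.2 - v.2 * u.1) / (u.1 * w.2 - u.2 * w.1) * w.1,
      v.2 + (v.1 * u.2 - v.2 * u.1) / (u.1 * w.2 - u.2 * w.1) * w.2).
    rewrite [LHS]surjective_pairing /vscale /=.
    by congr pair; field; rewrite nvw nuw.
  by rewrite tvZ.
have Hup a : sl 1 a 0 1 \in H.
  have := Hall (0, 1) a; rewrite /transv /=.
  by congr (sl _ _ _ _ \in H); ring.
have Hlow a : sl 1 0 a 1 \in H.
  have := Hall (1, 0) (- a); rewrite /transv /=.
  by congr (sl _ _ _ _ \in H); ring.
have Hc a b c d : a * d - b * c = 1 -> c != 0 -> sl a b c d \in H.
  move=> det1 c0.
  have -> : sl a b c d = (sl 1 ((a - 1) / c) 0 1 * sl 1 0 c 1 * sl 1 ((d - 1) / c) 0 1)%g.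
    rewrite !sl_mul; try (by ring).
    by have -> : b = (a * d - 1) / c by [rewrite -det1; field]; congr sl; field.
  exact: groupM (groupM (Hup _) (Hlow _)) (Hup _).
apply/subsetP=> x /SLE[a [b [c [d [det1 ->]]]]].
have [c0|] := eqVneq c 0; last exact: Hc.
rewrite -(groupMr _ (Hlow 1)) sl_mul //; last by ring.
have dnz : d != 0 by apply/eqP=> d0; move/eqP: det1; rewrite c0 d0 !mulr0 subr0 eq_sym oner_eq0.
have ad : a * d = 1 by rewrite -det1 c0 mulr0 subr0.
by apply: Hc; rewrite c0 ?mul0r ?add0r ?mulr1 //; ring: ad.
Qed.

Lemma tv_full v h : (forall a, transv v a \in H) -> h \in H ->
  v.1 * (vact v h).2 - v.2 * (vact v h).1 != 0 -> SL gl \subset H.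
Proof. by move=> Hv hH nz; apply: (@tv_gen v (vact v h) nz Hv) => a; rewrite tv_orbit. Qed.

(** The multiplier ring of the additive group of all a with transv v a in H. *)
Definition stretch v := [set k | [forall a, (transv v a \in H) ==> (transv v (k * a) \in H)]].

Lemma stretchP v k :
  reflect (forall a, transv v a \in H -> transv v (k * a) \in H) (k \in stretch v).
Proof. by rewrite inE; apply: (iffP forallP) => st a; apply/implyP; apply: st. Qed.

Lemma stretch_subring v : subring_set (stretch v).
Proof.
split=> [|k l kK lK|k l /stretchP kK /stretchP lK]; apply/stretchP=> a aH.
- by rewrite mul1r.
- by move/stretchP: kK; move/stretchP: lK => lK kK; rewrite mulrBl -tvD -tvV groupM ?groupV ?kK ?lK.
- by rewrite -mulrA kK ?lK.
Qed.

Lemma stretch_full v a : a != 0 -> transv v a \in H -> stretch v = setT ->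
  forall b, transv v b \in H.
Proof.
move=> a0 aH KT b; have /stretchP/(_ a aH) : b / a \in stretch v by rewrite KT inE.
by rewrite divfK.
Qed.

Lemma tv_similar h k v a : h \in H ->
  (transv (vscale k (vact v h)) a \in H) = (transv v (k ^+ 2 * a) \in H).
Proof. by move=> hH; rewrite tvZ tv_orbit. Qed.

Lemma stretch_similar h k v : h \in H -> k != 0 ->
  stretch (vscale k (vact v h)) = stretch v.
Proof.
move=> hH k0; apply/setP=> l; apply/stretchP/stretchP=> st a aH; last first.
  by rewrite tv_similar // mulrCA; apply: st; rewrite -(tv_similar _ _ _ hH).
have k20 : k ^+ 2 != 0 by rewrite expf_neq0.
have ka : k ^+ 2 * (a / k ^+ 2) = a by rewrite mulrC divfK.
by have := st (a / k ^+ 2); rewrite !tv_similar // [_ * (l * _)]mulrCA ka; apply.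
Qed.

(** Conjugation by h takes transv v a to transv (k v) a = transv v (k^2 a). *)
Lemma stretch_eigen h k v : h \in H -> vact v h = vscale k v -> k ^+ 2 \in stretch v.
Proof. by move=> hH e; apply/stretchP=> a; rewrite -tvZ -e tv_orbit. Qed.

Section Levels.

Variable N : F * F -> F.
Hypothesis NZ : forall k v, N (vscale k v) = k ^+ 2 * N v.
Hypothesis level : forall v w, N v != 0 -> N w = N v ->
  exists2 h, h \in H & exists2 e, e ^+ 2 = 1 & w = vscale e (vact v h).

Lemma level_sqr v w k : N v != 0 -> k != 0 -> N w = k ^+ 2 * N v ->
  exists2 h, h \in H & exists2 l, l ^+ 2 = k ^+ 2 & w = vscale l (vact v h).
Proof.
move=> Nv k0; rewrite -NZ => Nw.
have [|h hH [e e2 ->]] := level _ Nw; first by rewrite NZ mulf_neq0 ?expf_neq0.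
exists h => //; exists (e * k); first by rewrite exprMn e2 mul1r.
by rewrite vact_scale /vscale /= !mulrA.
Qed.

(** Some h in H takes v to a vector proportional to v x, with factor k up to
    sign, so that v is an eigenvector of x h^-1. *)
Lemma ratio_stretch x v k : x \in H -> N v != 0 -> k != 0 ->
  N (vact v x) = k ^+ 2 * N v -> k ^+ 2 \in stretch v.
Proof.
move=> xH Nv k0 Nvx; have [h hH [l l2 e]] := level_sqr Nv k0 Nvx.
rewrite -l2; apply: (@stretch_eigen (x * h^-1)%g); first by rewrite groupM ?groupV.
by rewrite vactM e vact_scale -vactM mulgV vact1.
Qed.

(** Going from v to w inside H up to a scalar, applying x, coming back to v x
    and undoing x multiplies v by k, up to sign. *)
Lemma ratio_ratio_stretch x v w k l : x \in H -> N v != 0 -> k != 0 -> l != 0 ->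
    N w = l ^+ 2 * N v -> N (vact v x) != 0 ->
    N (vact w x) * N v = k ^+ 2 * N (vact v x) * N w ->
  k ^+ 2 \in stretch v.
Proof.
move=> xH Nv k0 l0 Nw Nvx eqr.
have [h1 h1H [m1 m1E e1]] := level_sqr Nv l0 Nw.
have Nwx : N (vact w x) = (k * l) ^+ 2 * N (vact v x).
  by apply: (mulIf Nv); rewrite eqr Nw; ring.
have [h2 h2H [m2 m2E e2]] := level_sqr Nvx (mulf_neq0 k0 l0) Nwx.
have m10 : m1 != 0 by have := expf_neq0 2 l0; rewrite -m1E expf_eq0.
have -> : k ^+ 2 = (m2 / m1) ^+ 2.
  by rewrite exprMn exprVn m1E m2E exprMn mulfK // expf_neq0.
apply: (@stretch_eigen (h1 * x * (x * h2)^-1)%g).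
  by rewrite !groupM ?groupV ?groupM.
rewrite vactM vactM.
have -> : vact (vact v h1) x = vscale (m2 / m1) (vact (vact v x) h2).
  have : vscale m1 (vact (vact v h1) x) = vscale m2 (vact (vact v x) h2).
    by rewrite -vact_scale -e1 e2.
  rewrite /vscale; case: (vact (vact v h1) x) => p q.
  case: (vact (vact v x) h2) => r s [/= e3 e4].
  by congr pair; apply: (mulfI m10); rewrite ?e3 ?e4; field.
by rewrite vact_scale -(vactM v x) -vactM mulgV vact1.
Qed.

End Levels.
End Subgroups.

(** * Nonsplit tori generate *)

Section FiniteFields.

Variable F : finFieldType.
Implicit Types x y : F.

Lemma primitive_element : exists g : F, (#|F|.-1).-primitive_root g.
Proof.
have q1 := finNzRing_gt1 F.
have q0 : (0 < #|F|.-1)%N by rewrite -ltnS prednK // ltnW.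
pose s := enum [pred x : F | x != 0].
suff /hasP[g _ gP] : has (#|F|.-1).-primitive_root s by exists g.
apply: has_prim_root => //; last 1 first.
- by rewrite -cardE -(cardC1 (0 : F)); apply/subset_leq_card/subsetP=> x; rewrite !inE.
- apply/allP=> x; rewrite mem_enum inE => x0; rewrite unity_rootE; apply/eqP.
  by apply: (mulfI x0); rewrite mulr1 -exprS prednK ?expf_card // ltnW.
- exact: enum_uniq.
Qed.

Lemma expf_pred_card x : x != 0 -> x ^+ #|F|.-1 = 1.
Proof.
move=> x0; apply: (mulfI x0).
by rewrite mulr1 -exprS prednK ?expf_card // ltnW // finNzRing_gt1.
Qed.

Definition is_square x := [exists y, x == y ^+ 2].

Lemma is_squareP x : reflect (exists y, x = y ^+ 2) (is_square x).
Proof. by apply: (iffP existsP) => -[y /eqP e]; exists y. Qed.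

Lemma is_square_sqr x : is_square (x ^+ 2).
Proof. by apply/is_squareP; exists x. Qed.

(** Nonsquares are the odd powers of a primitive element. *)
Lemma nonsquare_div x y : ~~ is_square x -> ~~ is_square y -> is_square (x / y).
Proof.
have [g gP] := primitive_element.
have Hpow z : ~~ is_square z -> exists n, z = g * g ^+ n.*2.
  move=> nz; have z0 : z != 0.
    by apply: contraNneq nz => ->; apply/is_squareP; exists 0; rewrite expr0n.
  have [i zi] := prim_rootP gP (expf_pred_card z0).
  have io : odd i.
    apply: contraNT nz => ie; apply/is_squareP; exists (g ^+ i./2).
    by rewrite -exprM muln2 zi -{1}[i : nat]odd_double_half (negPf ie).
  by exists i./2; rewrite -exprS zi -{1}[i : nat]odd_double_half io.
move=> /Hpow[n ->] /Hpow[m ->]; apply/is_squareP; exists (g ^+ n / g ^+ m).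
have g0 : g != 0.
  apply/eqP=> g0; have := prim_expr_order gP; rewrite g0 expr0n.
  by rewrite (gtn_eqF (prim_order_gt0 gP)) => /esym/eqP; rewrite oner_eq0.
by rewrite -!muln2 !exprM; field; rewrite g0 expf_neq0.
Qed.

Lemma square_char2 x : 2%:R = 0 :> F -> is_square x.
Proof.
move=> c2; have inj : injective (fun y : F => y ^+ 2).
  move=> y z /= /eqP; rewrite -subr_eq0 subr_sqr mulf_eq0 => /orP[].
    by rewrite subr_eq0 => /eqP.
  rewrite addr_eq0 => /eqP ->; apply/eqP; rewrite -subr_eq0.
  by apply/eqP; rewrite -opprD -mulr2n -mulr_natl c2 mul0r oppr0.
by have [f _ fK] := injF_bij inj; apply/is_squareP; exists (f x); rewrite fK.
Qed.

Lemma card_horner_roots (s : seq F) (A : {set F}) n : has (fun c => c != 0) s ->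
  (size s <= n.+1)%N -> {in A, forall x, horner_rec s x = 0} -> (#|A| <= n)%N.
Proof.
move=> nz sz Ar; apply: (@card_roots_leq _ (Poly s)).
- apply/eqP=> /polyP s0; have /hasP[c cs] := nz.
  by have := s0 (index c s); rewrite coef_Poly coef0 nth_index // => ->; rewrite eqxx.
- exact: leq_trans (size_Poly _) sz.
- by move=> x /Ar sx; rewrite /root horner_Poly sx.
Qed.

Lemma subring_prime (K : {set F}) : prime #|F| -> subring_set K -> K = setT.
Proof.
move=> q_pr [K1 KB _]; have qF : #|F| \in [pchar F] by apply: (card_finPcharP (n := 1)).
have KN n : n%:R \in K.
  have K0 : 0 \in K by rewrite -(subrr 1) KB.
  elim: n => // n IHn.
  have -> : n.+1%:R = n%:R - (0 - 1) :> F by rewrite sub0r opprK natr1.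
  by rewrite !KB.
have inj : injective (fun i : 'I_#|F| => (i : nat)%:R : F).
  move=> i k /= /eqP eik; apply: val_inj => /=.
  wlog le_ik : i k eik / (i <= k)%N.
    move=> W; case/orP: (leq_total i k) => le_ik; first exact: W.
    by symmetry; apply: W => //; rewrite eq_sym.
  move: eik; rewrite eq_sym -subr_eq0 -natrB // -(dvdn_pcharf qF) => dvd_q.
  have [e|/dvdn_leq/(_ dvd_q) le_q] := posnP (k - i).
    by apply/eqP; rewrite eqn_leq le_ik -subn_eq0 e.
  by have := leq_trans (ltn_ord k) (leq_trans le_q (leq_subr i k)); rewrite ltnn.
apply/eqP; rewrite eqEcard subsetT cardsT -[leqLHS]card_ord -(card_codom inj).
by apply/subset_leq_card/subsetP=> _ /codomP[i ->]; apply: KN.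
Qed.

End FiniteFields.

(** The next two bounds say that a proper subfield of order k is too small to
    contain the values that are counted in a field of order q. *)
Lemma sqr_leq_double k q : (k ^ 2 <= q -> 0 < q -> q <= k.-1 * 2 -> False)%N.
Proof. by rewrite -mulnn; case: k => [|k] /=; nia. Qed.

Lemma sqr_leq_sextuple k q : (k ^ 2 <= q -> 25 <= q -> q <= k.-1 * 6 -> False)%N.
Proof. by rewrite -mulnn; case: k => [|k] /=; nia. Qed.

Section Nonsplit.

Variables (F : finFieldType) (gl : gl2 F) (H : {group gl}).
Local Notation sl := (@sl F gl).
Local Notation transv := (@transv F gl).
Implicit Types (a b c d k : F) (x y h : gl) (v w : F * F).
Hypothesis sHG : H \subset SL gl.

Variable t : F.
Hypothesis t_nonsplit : forall z, z ^+ 2 - t * z + 1 != 0.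

(** The norm of v1 + v2 w, where w is a root of X^2 - t X + 1. *)
Definition cnorm v : F := v.1 ^+ 2 + t * v.1 * v.2 + v.2 ^+ 2.

Lemma cnorm_eq0 v : cnorm v = 0 -> v = (0, 0).
Proof.
case: v => a b; rewrite /cnorm /= => e.
have [b0|b0] := eqVneq b 0.
  by move: e; rewrite b0 mulr0 addr0 expr0n /= addr0 => /eqP; rewrite sqrf_eq0 => /eqP->.
case/eqP: (t_nonsplit (- a / b)).
have -> : (- a / b) ^+ 2 - t * (- a / b) + 1 = (a ^+ 2 + t * a * b + b ^+ 2) / b ^+ 2 by field.
by rewrite e mul0r.
Qed.

Lemma cnorm_neq0 a b : (a != 0) || (b != 0) -> cnorm (a, b) != 0.
Proof. by apply: contraTneq => /cnorm_eq0[-> ->]; rewrite eqxx. Qed.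

Lemma cnormZ k v : cnorm (vscale k v) = k ^+ 2 * cnorm v.
Proof. by rewrite /cnorm /=; ring. Qed.

(** The matrix of the multiplication by a + b w, for w^2 = t w - 1. *)
Definition torus_elt a b := sl a b (- b) (a + t * b).

Lemma cmul_det a b : cnorm (a, b) = 1 -> a * (a + t * b) - b * - b = 1.
Proof. by move=> <-; rewrite /cnorm /=; ring. Qed.

Hypothesis Hc : forall a b, cnorm (a, b) = 1 ->
  exists2 e, e ^+ 2 = 1 & torus_elt (e * a) (e * b) \in H.

Lemma cnorm_level v w : cnorm v != 0 -> cnorm w = cnorm v ->
  exists2 h, h \in H & exists2 e, e ^+ 2 = 1 & w = vscale e (vact v h).
Proof.
case: v w => v1 v2 [w1 w2] nv enw.
pose a := (w1 * (v1 + t * v2) + w2 * v2) / cnorm (v1, v2).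
pose b := (w2 * v1 - w1 * v2) / cnorm (v1, v2).
have nab : cnorm (a, b) = 1.
  have -> : cnorm (a, b) = cnorm (w1, w2) / cnorm (v1, v2).
    by move: nv; rewrite /a /b /cnorm /= => nv; field.
  by rewrite enw divff.
have [e e2 hH] := Hc nab; exists (torus_elt (e * a) (e * b)) => //; exists e => //.
have det1 : cnorm (e * a, e * b) = 1 by have := cnormZ e (a, b); rewrite /vscale /= => ->; rewrite e2 nab mulr1.
rewrite vact_sl ?cmul_det // /vscale /=.
have e1 : w1 = v1 * a + v2 * - b by move: nv; rewrite /a /b /cnorm /= => nv; field.
have e3 : w2 = v1 * b + v2 * (a + t * b) by move: nv; rewrite /a /b /cnorm /= => nv; field.
by congr pair; [rewrite [LHS]e1 | rewrite [LHS]e3]; ring: e2.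
Qed.

Variable j : F.
Hypothesis j0 : j != 0.
Hypothesis Hj : transv (1, 0) j \in H.
(* In characteristic 2, transv (1, 0) t inverts the torus, and generates with
   it a dihedral group. *)
Hypothesis j_not_inv : 2%:R != 0 :> F \/ j != t.

Let u := transv (1, 0) j.

Lemma vact_u v : vact v u = (v.1 - j * v.2, v.2).
Proof. by rewrite vact_tv /=; congr pair; ring. Qed.

Lemma u_neq0 v : cnorm v != 0 -> cnorm (vact v u) != 0.
Proof.
move=> nv; apply: contra_neq nv => /cnorm_eq0; rewrite vact_u => -[e1 e2].
by case: v e1 e2 => a b /= e1 e2; move: e1; rewrite e2 mulr0 subr0 => ->; rewrite /cnorm /=; ring.
Qed.

Let phi a := cnorm (vact (a, 1) u) / cnorm (a, 1).

Lemma cnorm_affine a : cnorm (a, 1) != 0.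
Proof. by rewrite cnorm_neq0 // oner_neq0 orbT. Qed.

Lemma phi_neq0 a : phi a != 0.
Proof. by rewrite mulf_neq0 ?invr_eq0 ?u_neq0 ?cnorm_affine. Qed.

(** phi a = y is an equation of degree at most 2 in a. *)
Lemma phi_fibre (A : {set F}) (y : F) : (#|[set a in A | phi a == y]| <= 2)%N.
Proof.
apply: (@card_horner_roots _ [:: j ^+ 2 - t * j + 1 - y; t * (1 - y) - 2%:R * j; 1 - y]) => //.
  rewrite /= orbF; have [->|y1] := eqVneq y 1; last by have -> : 1 - y != 0 by [rewrite subr_eq0 eq_sym]; rewrite !orbT.
  rewrite subrr mulr0 sub0r oppr_eq0 mulf_eq0 (negPf j0) orbF addrK.
  have -> : j ^+ 2 - t * j = j * (j - t) by ring.
  by rewrite mulf_eq0 (negPf j0) /= subr_eq0 eqxx orbF orbC; case: j_not_inv => ->; rewrite ?orbT.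
move=> a; rewrite inE => /andP[_ /eqP]; rewrite /phi => e.
have: cnorm (vact (a, 1) u) = y * cnorm (a, 1) by rewrite -e divfK ?cnorm_affine.
rewrite vact_u /cnorm /= => /eqP; rewrite -subr_eq0 => /eqP {}e.
by rewrite -[RHS]e; ring.
Qed.

Lemma phi_card (A K : {set F}) c : c != 0 -> 0 \in K ->
  {in A, forall a, phi a / c \in K} -> (#|A| <= #|K|.-1 * 2)%N.
Proof.
move=> c0 K0 AK; rewrite (cardsD1 0 K) K0 /=.
apply: (@leq_card_fibres _ _ (fun a => phi a / c)) => [a aA|y _].
  by rewrite !inE AK // andbT mulf_neq0 ?invr_eq0 ?phi_neq0.
rewrite (_ : [set _ in A | _] = [set a in A | phi a == y * c]) ?phi_fibre //.
by apply/setP=> a; rewrite !inE; congr (_ && _); apply/eqP/eqP => [<-|->]; rewrite ?divfK ?mulfK.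
Qed.

Let K := stretch H (1, 0).

Lemma cnorm_e1 : cnorm (1, 0) = 1.
Proof. by rewrite /cnorm /=; ring. Qed.

Lemma stretch_level v w : cnorm v != 0 -> is_square (cnorm w / cnorm v) ->
  cnorm w != 0 -> stretch H w = stretch H v.
Proof.
move=> nv /is_squareP[k ek] nw.
have ewv : cnorm w = k ^+ 2 * cnorm v by rewrite -ek divfK.
have k0 : k != 0 by apply: contraNneq nw => k0; rewrite ewv k0 expr0n mul0r.
have [h hH [l l2 ->]] := level_sqr cnormZ cnorm_level nv k0 ewv.
apply: stretch_similar => //.
by have := expf_neq0 2 k0; rewrite -l2 expf_eq0.
Qed.

Lemma stretch_ratio v : cnorm v != 0 -> is_square (cnorm (vact v u) / cnorm v) ->
  cnorm (vact v u) / cnorm v \in stretch H v.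
Proof.
move=> nv /is_squareP[k ek]; rewrite ek.
have evu : cnorm (vact v u) = k ^+ 2 * cnorm v by rewrite -ek divfK.
apply: (ratio_stretch sHG cnormZ cnorm_level Hj nv) => //.
by apply: contraTneq (u_neq0 nv) => k0; rewrite evu k0 expr0n mul0r eqxx.
Qed.

Lemma stretch_0 v : 0 \in stretch H v.
Proof. by case: (stretch_subring H v) => K1 KB _; rewrite -(subrr 1) KB. Qed.

Lemma K_full_gen : K = setT -> SL gl \subset H.
Proof.
move=> KT; have Hv := stretch_full j0 Hj KT.
have [e e2 hH] : exists2 e, e ^+ 2 = 1 & torus_elt (e * 0) (e * 1) \in H.
  by apply: Hc; rewrite /cnorm /=; ring.
apply: (tv_full sHG Hv hH).
have e0 : e != 0 by apply: contra_eq_neq e2 => ->; rewrite expr0n eq_sym oner_eq0.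
have n1 : cnorm (e * 0, e * 1) = 1 by rewrite /cnorm /=; ring: e2.
by rewrite vact_sl ?cmul_det //= !mul0r !mul1r !mulr1 addr0 subr0.
Qed.

(** The squares (m + w)^2, of coordinates (m^2 - 1, 2 m + t), are vectors of
    square norm, hence proportional to vectors of the orbit of (1, 0).  If u
    keeps their norms square, the ratios of norms are in K, and each ratio comes
    from at most 4 values of m. *)
Lemma square_class_card : 2%:R != 0 :> F ->
    (forall m, is_square (cnorm (vact (m ^+ 2 - 1, 2%:R * m + t) u))) ->
  (#|F| <= #|K|.-1 * 4)%N.
Proof.
move=> c2 sqm; pose vm m : F * F := (m ^+ 2 - 1, 2%:R * m + t).
have nvm m : cnorm (vm m) = cnorm (m, 1) ^+ 2 by rewrite /cnorm /=; ring.
have nvm0 m : cnorm (vm m) != 0 by rewrite nvm expf_neq0 ?cnorm_affine.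
pose psi m := cnorm (vact (vm m) u) / cnorm (vm m).
rewrite -cardsT (cardsD1 0 K) stretch_0 /=.
apply: (@leq_card_fibres _ _ psi) => [m _|y _].
  rewrite in_setD1 mulf_neq0 ?invr_eq0 ?u_neq0 //=.
  have -> : K = stretch H (vm m).
    symmetry; apply: stretch_level => //; rewrite cnorm_e1 ?oner_neq0 //.
    by rewrite divr1 nvm is_square_sqr.
  apply: stretch_ratio => //; have /is_squareP[k ek] := sqm m.
  by apply/is_squareP; exists (k / cnorm (m, 1)); rewrite nvm exprMn exprVn -ek.
pose c := 1 - y; pose J := j ^+ 2 - t * j.
apply: (@card_horner_roots _ [:: c + 2%:R * j * t + J * t ^+ 2;
   2%:R * t * c + 4%:R * j + 4%:R * J * t;
   (t ^+ 2 + 2%:R) * c - 2%:R * j * t + 4%:R * J; 2%:R * t * c - 4%:R * j; c]) => //.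
  rewrite /=; have [->|c0] := eqVneq c 0; last by rewrite !orbT.
  have -> : 2%:R * t * 0 - 4%:R * j = - (2%:R * 2%:R * j) by ring.
  by rewrite oppr_eq0 !mulf_eq0 (negPf c2) (negPf j0) !orbT.
move=> m; rewrite !inE /= /psi => /eqP e.
have {}e : cnorm (vact (vm m) u) = y * cnorm (vm m) by rewrite -e divfK.

move: e; rewrite vact_u /cnorm /= => /eqP; rewrite -subr_eq0 => /eqP e.
by rewrite -[RHS]e /c /J; ring.
Qed.

(** If u maps some vector of square norm to a vector of nonsquare norm, all
    vectors are proportional to vectors of one orbit of H, and all of them have
    the same multiplier ring K.  The values of phi are then in K when they are
    squares, and otherwise in one coset of the nonzero elements of K for each of
    the two classes of a defined by the norm of (a, 1).  As phi takes each value
    at most twice, #|F| <= 6 (#|K| - 1). *)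
Theorem nonsplit_generation :
  prime #|F| \/ (2%:R = 0 :> F) \/ (25 <= #|F|)%N -> SL gl \subset H.
Proof.
move=> hq; apply: K_full_gen; apply/eqP; apply/negPn/negP=> KT.
have ringK : subring_set K by apply: stretch_subring.
have leK := subring_card_sqr ringK KT.
have Kq c (A : {set F}) : c != 0 -> {in A, forall a, phi a / c \in K} ->
  (#|A| <= #|K|.-1 * 2)%N by move=> c0; apply: phi_card => //; apply: stretch_0.
have [c2|c2] := eqVneq (2%:R : F) 0.
  have: (#|[set: F]| <= #|K|.-1 * 2)%N.
    apply: (Kq 1 _ (oner_neq0 _)) => a _; rewrite divr1.
    have -> : K = stretch H (a, 1).
      by symmetry; apply: stretch_level; rewrite ?cnorm_e1 ?oner_neq0 ?cnorm_affine ?square_char2.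
    by apply: stretch_ratio; rewrite ?cnorm_affine ?square_char2.
  by rewrite cardsT; apply: sqr_leq_double leK (ltnW (finNzRing_gt1 F)).
have {hq}q25 : (25 <= #|F|)%N.
  by case: hq => [/subring_prime/(_ ringK) KE|[/eqP c2'|//]];
    [rewrite KE eqxx in KT | rewrite c2' in c2].
have [/forallP sqm|] := boolP [forall m, is_square (cnorm (vact (m ^+ 2 - 1, 2%:R * m + t) u))].
  apply: (sqr_leq_sextuple leK q25); apply: leq_trans (square_class_card c2 sqm) _.
  by rewrite leq_mul2l orbT.
rewrite negb_forall => /existsP[m0 nsq].
pose w0 : F * F := (m0 ^+ 2 - 1, 2%:R * m0 + t).
have w0E : cnorm w0 = cnorm (m0, 1) ^+ 2 by rewrite /cnorm /=; ring.
have nw0 : cnorm w0 != 0 by rewrite w0E expf_neq0 ?cnorm_affine.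
have Kw0 : stretch H w0 = K.
  by apply: stretch_level; rewrite ?cnorm_e1 ?oner_neq0 // divr1 w0E is_square_sqr.
have Kw0u : stretch H (vact w0 u) = K.
  have -> : vact w0 u = vscale 1 (vact w0 u).
    by rewrite /vscale !mul1r -surjective_pairing.
  by rewrite stretch_similar ?oner_neq0.
have Kall v : cnorm v != 0 -> stretch H v = K.
  move=> nv; have [sq|nsqv] := boolP (is_square (cnorm v)).
    by apply: stretch_level; rewrite ?cnorm_e1 ?oner_neq0 // divr1.
  rewrite -Kw0u; apply: stretch_level; rewrite ?u_neq0 //.
  exact: nonsquare_div nsqv nsq.
pose A (i : option bool) := [set a | if i is Some s then
  ~~ is_square (phi a) && (is_square (cnorm (a, 1)) == s) else is_square (phi a)].
have leA i : (#|A i| <= #|K|.-1 * 2)%N.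
  have [->|[a0 a0A]] := set_0Vmem (A i); first by rewrite cards0.
  case: i => [s|] in a0A *; last first.
    apply: (Kq 1 _ (oner_neq0 _)) => a; rewrite [_ \in A _]inE divr1 => sqa.
    by rewrite -(Kall (a, 1)) ?stretch_ratio ?cnorm_affine.
  apply: (Kq (phi a0) _ (phi_neq0 _)) => a.
  move: a0A; rewrite ![_ \in A _]inE => /andP[nsq0 /eqP cl0] /andP[nsqa /eqP cla].
  have /is_squareP[k ek] := nonsquare_div nsqa nsq0.
  have /is_squareP[l el] : is_square (cnorm (a, 1) / cnorm (a0, 1)).
    have [s0|s0] := boolP (is_square (cnorm (a0, 1))); last first.
      by apply: nonsquare_div => //; rewrite cla -cl0.
    have /is_squareP[x0 ->] := s0; move: s0; rewrite cl0 -cla => /is_squareP[x1 ->].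
    by rewrite -expr_div_n is_square_sqr.
  rewrite ek -(Kall (a0, 1)) ?cnorm_affine //.
  have n0 := cnorm_affine a0; have na := cnorm_affine a.
  apply: (@ratio_ratio_stretch _ _ _ sHG cnorm cnormZ cnorm_level u _ (a, 1) k l) => //.
  - by apply: contraTneq (phi_neq0 a) => k0; rewrite -[phi a](divfK (phi_neq0 a0)) ek k0 expr0n mul0r eqxx.
  - by apply: contraTneq na => l0; rewrite -[cnorm _](divfK n0) el l0 expr0n mul0r eqxx.
  - by rewrite -el divfK.
  - exact: u_neq0.
  - by rewrite -ek /phi; move: (phi_neq0 a0); rewrite /phi => p0; move: (u_neq0 n0) => nu0; field; rewrite ?nu0 ?n0 ?na.
have: (#|[set: F]| <= #|A None| + #|A (Some true)| + #|A (Some false)|)%N.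
  apply: leq_trans (leq_trans (leq_card_setU _ _).1 (leq_add (leq_card_setU _ _).1 (leqnn _))).
  apply/subset_leq_card/subsetP=> a _; rewrite !inE /=.
  by case: (is_square (phi a)) => //; case: (is_square (cnorm _)).
rewrite cardsT => le_q; apply: (sqr_leq_sextuple leK q25); apply: leq_trans le_q _.
by rewrite -[6%N]/(2 + 2 + 2)%N !mulnDr !leq_add.
Qed.

End Nonsplit.

(** * Split tori generate *)

(** The analogous bound for the split torus. *)
Lemma sqr_leq_quadruple k q : (k ^ 2 <= q -> 9 < q -> q.-1 <= k.-1 * 4 -> False)%N.
Proof. by rewrite -mulnn; case: k => [|k]; case: q => [|q] /=; nia. Qed.

Section Split.

Variables (F : finFieldType) (gl : gl2 F) (H : {group gl}).
Local Notation sl := (@sl F gl).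
Local Notation transv := (@transv F gl).
Implicit Types (a b c d e f g k s : F) (x y h : gl) (v w : F * F).
Hypothesis sHG : H \subset SL gl.

Definition dgsl s := sl s 0 0 s^-1.

Lemma dg_det s : s != 0 -> s * s^-1 - 0 * 0 = 1.
Proof. by move=> s0; rewrite divff // mulr0 subr0. Qed.

Lemma vact_dg v s : s != 0 -> vact v (dgsl s) = (s * v.1, s^-1 * v.2).
Proof. by move=> s0; rewrite vact_sl ?dg_det //; congr pair; ring. Qed.

Hypothesis Hdg : forall s, s != 0 -> exists2 e, e ^+ 2 = 1 & dgsl (e * s) \in H.

Let N v := v.1 * v.2.

Lemma sign_neq0 e : e ^+ 2 = 1 -> e != 0.
Proof. by move=> e2; apply: contra_eq_neq e2 => ->; rewrite expr0n eq_sym oner_eq0. Qed.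

Lemma sign_inv e : e ^+ 2 = 1 -> e^-1 = e.
Proof. by move=> e2; apply: (mulfI (sign_neq0 e2)); rewrite divff ?sign_neq0 // -expr2. Qed.

Lemma prodZ k v : N (vscale k v) = k ^+ 2 * N v.
Proof. by rewrite /N /=; ring. Qed.

Lemma prod_level v w : N v != 0 -> N w = N v ->
  exists2 h, h \in H & exists2 e, e ^+ 2 = 1 & w = vscale e (vact v h).
Proof.
case: v w => v1 v2 [w1 w2]; rewrite /N /= => nv ew.
have := nv; rewrite mulf_eq0 negb_or => /andP[v10 v20].
have := nv; rewrite -ew mulf_eq0 negb_or => /andP[w10 w20].
have s0 : w1 / v1 != 0 by rewrite mulf_neq0 ?invr_eq0.
have [e e2 hH] := Hdg s0; exists (dgsl (e * (w1 / v1))) => //; exists e => //.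
have e0 := sign_neq0 e2.
rewrite (vact_dg _ (mulf_neq0 e0 s0)) /vscale /= invfM (sign_inv e2).
have -> : w2 = v1 * v2 / w1 by rewrite -ew mulrC mulKf.
by congr pair; rewrite -[LHS]mul1r -e2; field; rewrite ?v10 ?w10.
Qed.

Definition has_transv v := exists2 a, a != 0 & transv v a \in H.

Lemma moved_similar k h v : k != 0 -> h \in H -> has_transv v -> has_transv (vscale k (vact v h)).
Proof.
move=> k0 hH [a a0 aH]; have k20 : k ^+ 2 != 0 by rewrite expf_neq0.
exists (a / k ^+ 2); first by rewrite mulf_neq0 ?invr_eq0.
by rewrite tv_similar // mulrC divfK.
Qed.

Lemma moved_orbit h v : h \in H -> has_transv (vact v h) -> has_transv v.
Proof. by move=> hH [a a0]; rewrite tv_orbit // => aH; exists a. Qed.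

Lemma moved_level v w : N v != 0 -> N w != 0 -> is_square (N w / N v) -> has_transv v -> has_transv w.
Proof.
move=> nv nw /is_squareP[k ek] mv.
have ewv : N w = k ^+ 2 * N v by rewrite -ek divfK.
have k0 : k != 0 by apply: contraNneq nw => k0; rewrite ewv k0 expr0n mul0r.
have [h hH [l l2 ->]] := level_sqr prodZ prod_level nv k0 ewv.
by apply: moved_similar => //; have := expf_neq0 2 k0; rewrite -l2 expf_eq0.
Qed.

Lemma squares_full (K : {set F}) : subring_set K -> (forall s, s ^+ 2 \in K) -> K = setT.
Proof.
case=> _ KB _ Ksq; apply/setP=> z; rewrite inE.
have [c2|c2] := eqVneq (2%:R : F) 0; first by have /is_squareP[s ->] := square_char2 z c2; apply: Ksq.
have -> : z = ((z + 1) / 2%:R) ^+ 2 - ((z - 1) / 2%:R) ^+ 2 by field.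
by apply: KB; apply: Ksq.
Qed.

Variables (v0 : F * F) (a : F).
Hypothesis nv0 : N v0 != 0.
Hypothesis a0 : a != 0.
Let u := transv v0 a.
Hypothesis uH : u \in H.
Let d := a * v0.1 * v0.2.

Lemma v0_neq0 : v0.1 != 0 /\ v0.2 != 0.
Proof. by move: nv0; rewrite mulf_eq0 negb_or => /andP. Qed.

(** An axis is fixed by the torus, whose eigenvalues put all squares into the
    multiplier ring; and the squares generate the field. *)
Lemma axis_full w : N w = 0 -> w != (0, 0) -> has_transv w -> SL gl \subset H.
Proof.
move=> Nw w0 [b b0 bH]; have [v10 v20] := v0_neq0.
have wE : (w.1 = 0 /\ w.2 != 0) \/ (w.2 = 0 /\ w.1 != 0).
  move: w0 Nw; case: w {bH} => p q; rewrite /N /= => pq0 /eqP.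
  rewrite mulf_eq0 => /orP[/eqP p0|/eqP q0]; [left|right]; split=> //.
    by apply: contraNneq pq0 => ->; rewrite p0.
  by apply: contraNneq pq0 => ->; rewrite q0.
have KT : stretch H w = setT.
  apply: squares_full (stretch_subring _ _) _ => s.
  have [->|s0] := eqVneq s 0; first by rewrite expr0n stretch_0.
  have [e e2 hH] := Hdg s0; have es0 := mulf_neq0 (sign_neq0 e2) s0.
  have -> : s ^+ 2 = (e * s) ^+ 2 by rewrite exprMn e2 mul1r.
  case: wE => [[w10 _]|[w20 _]]; last first.
    apply: (stretch_eigen sHG hH); rewrite vact_dg // /vscale.
    by rewrite w20 !mulr0.
  rewrite -[_ ^+ 2]invrK; apply: subring_inv (stretch_subring _ _) _.
  rewrite -exprVn; apply: (stretch_eigen sHG hH); rewrite vact_dg // /vscale.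
  by rewrite w10 !mulr0.
apply: (tv_full sHG (stretch_full b0 bH KT) uH); rewrite vact_tv /=.
case: wE => -[-> w0']; rewrite ?mul0r ?sub0r ?subr0 ?add0r.
  by rewrite oppr_eq0 !mulf_neq0 // oppr_eq0 mulf_neq0.
by rewrite mulf_neq0 // !mulf_neq0.
Qed.

Lemma vact_neq0 v x : v != (0, 0) -> vact v x != (0, 0).
Proof.
apply: contraNneq => e; have <- : vact (vact v x) x^-1%g = v by rewrite -vactM mulgV vact1.
by rewrite e /vact /= !mul0r addr0.
Qed.

Lemma moved_v0 : has_transv v0. Proof. by exists a. Qed.

(** The image of (1, 0) under u is off the axes, hence in the orbit of v0 up to
    a scalar, since all elements are squares. *)
Lemma split_generation_even : 2%:R = 0 :> F -> 1 + d != 0 -> SL gl \subset H.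
Proof.
move=> c2 d1; have [v10 v20] := v0_neq0.
apply: (@axis_full (1, 0)); rewrite /N /= ?mulr0 //.
  by rewrite xpair_eqE oner_eq0.
apply: (moved_orbit uH); apply: (moved_level nv0) moved_v0 => //; last exact: square_char2.
rewrite vact_tv /N /= mul1r mul0r subr0 add0r mulf_neq0 //; last by rewrite !mulf_neq0.
by move: d1; rewrite /d; congr (_ != 0); ring.
Qed.

Let vm m : F * F := (m * v0.1, m^-1 * v0.2).

Lemma prod_vm m : m != 0 -> N (vm m) = N v0.
Proof. by move=> m0; rewrite /N /=; field. Qed.

(** Here N(v) = v1 v2, with the axes as isotropic lines.  A transvection whose
    centre is an axis is found as follows.  If u maps some vm m, which has the
    norm of v0, to an axis, this axis will do.  If it maps some vm m to the other
    class of norms, all vectors off the axes are centres; and u cannot exchange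
    the two axes, since d = -1 and d = 1 exclude each other.  Otherwise the ratios
    of norms are squares in K, and counting them shows that K = F; then all
    transvections of centre v0 are available, and one of them maps some vm m to
    an axis. *)
Lemma split_generation_odd : 2%:R != 0 :> F -> (9 < #|F|)%N -> SL gl \subset H.
Proof.
move=> c2 q9; have [v10 v20] := v0_neq0.
have d0 : d != 0 by rewrite !mulf_neq0.
have neq0 v : N v != 0 -> v != (0, 0) by apply: contraNneq => ->; rewrite /N mul0r.
have moved_vm m : m != 0 -> has_transv (vm m).
  by move=> m0; apply: (moved_level nv0) moved_v0; rewrite prod_vm // divff // -(expr1n _ 2) is_square_sqr.
have axis_vm m x : m != 0 -> x \in H -> N (vact (vm m) x) = 0 -> SL gl \subset H.
  move=> m0 xH n0; apply: (axis_full n0).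
    by apply: vact_neq0; apply: neq0; rewrite prod_vm.
  have [b b0 bH] := moved_vm m m0; exists b => //; by rewrite tv_orbit.
have ratioE m : m != 0 ->
    m ^+ 2 * (N (vact (vm m) u) / N v0) = d * (1 + d) * m ^+ 4 + (1 - 2%:R * d ^+ 2) * m ^+ 2 - d * (1 - d).
  by move=> m0; rewrite vact_tv /N /= /d; field; rewrite ?m0 ?v10 ?v20.
have [/existsP[m /andP[m0 /eqP nm]]|] := boolP [exists m, (m != 0) && (N (vact (vm m) u) == 0)].
  exact: axis_vm nm.
rewrite negb_exists => /forallP nz.
have {}nz m : m != 0 -> N (vact (vm m) u) != 0.
  by move=> m0; have := nz m; rewrite m0.
have [/existsP[m /andP[m0 nsq]]|] :=
    boolP [exists m, (m != 0) && ~~ is_square (N (vact (vm m) u) / N v0)].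
  have all_moved v : N v != 0 -> has_transv v.
    move=> nv; have [sq|nsqv] := boolP (is_square (N v / N v0)).
      exact: moved_level nv0 nv sq moved_v0.
    apply: (@moved_level (vact (vm m) u)) => //; first exact: nz.
      by have := nonsquare_div nsqv nsq; congr is_square; field; rewrite ?nz ?nv0.
    have [b b0 bH] := moved_vm m m0; exists b => //; by rewrite tv_orbit.
  have [d1|d1] := eqVneq (1 + d) 0.
    apply: (@axis_full (0, 1)); rewrite /N /= ?mul0r //; first by rewrite xpair_eqE oner_eq0 andbF.
    apply: (moved_orbit uH); apply: all_moved.
    rewrite vact_tv /N /= mul1r mul0r sub0r add0r mulf_neq0 //.
      by rewrite mulrN mulNr oppr_eq0 !mulf_neq0.
    have -> : 1 + a * - v0.1 * v0.2 = 1 + 1 - (1 + d) by rewrite /d; ring.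
    by rewrite d1 subr0.
  apply: (@axis_full (1, 0)); rewrite /N /= ?mulr0 //; first by rewrite xpair_eqE oner_eq0.
  apply: (moved_orbit uH); apply: all_moved.
  rewrite vact_tv /N /= mul1r mul0r subr0 add0r mulf_neq0 //; last by rewrite !mulf_neq0.
  by move: d1; rewrite /d; congr (_ != 0); ring.
rewrite negb_exists => /forallP sq.
have {}sq m : m != 0 -> is_square (N (vact (vm m) u) / N v0).
  by move=> m0; have := sq m; rewrite m0 negbK.
pose K := stretch H v0.
have inK m : m != 0 -> N (vact (vm m) u) / N v0 \in K.
  move=> m0; have [k ek] := is_squareP _ (sq m m0).
  have ewv : N (vact (vm m) u) = k ^+ 2 * N (vm m) by rewrite -ek prod_vm // divfK.
  have k0 : k != 0 by apply: contraTneq (nz m m0) => k0; rewrite ewv k0 expr0n mul0r eqxx.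
  have [h hH [e e2 evm]] := prod_level nv0 (prod_vm m0).
  have -> : K = stretch H (vm m) by rewrite evm stretch_similar ?sign_neq0.
  rewrite ek; apply: (ratio_stretch sHG prodZ prod_level uH) => //.
  by rewrite prod_vm.
have [KT|KT] := eqVneq K setT; last first.
  have leK := subring_card_sqr (stretch_subring _ _) KT.
  exfalso; apply: (sqr_leq_quadruple leK q9).
  rewrite -(cardsC1 (0 : F)) (cardsD1 0 K) stretch_0 /=.
  apply: (@leq_card_fibres _ _ (fun m => N (vact (vm m) u) / N v0)) => [m|y _].
    by rewrite !in_setD1 in_setC1 => m0; rewrite inK // andbT mulf_neq0 ?invr_eq0 ?nz.
  apply: (@card_horner_roots _ [:: - (d * (1 - d)); 0; 1 - 2%:R * d ^+ 2 - y; 0; d * (1 + d)]) => //.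
    have [d1|d1] := eqVneq (1 - d) 0; last first.
      by have nz0 := mulf_neq0 d0 d1; rewrite /= oppr_eq0 nz0.
    have d2 : 1 + d != 0.
      by have -> : 1 + d = 2%:R - (1 - d) by [ring]; rewrite d1 subr0.
    by have nz4 := mulf_neq0 d0 d2; rewrite /= nz4 !orbT.
  move=> m; rewrite inE in_setC1 => /andP[m0 /eqP e].
  have := ratioE m m0; rewrite e => /eqP; rewrite -subr_eq0 => /eqP {}e.
  by rewrite -[RHS]oppr0 -[X in _ = - X]e /=; ring.
have tvH b : transv v0 b \in H by apply: stretch_full a0 uH KT b.
have [m m0 m1] : exists2 m : F, m != 0 & 1 - m ^+ 2 != 0.
  have [g gP] := primitive_element F.
  have g0 : g != 0.
    apply/eqP=> g0; have := prim_expr_order gP; rewrite g0 expr0n.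
    by rewrite (gtn_eqF (prim_order_gt0 gP)) => /esym/eqP; rewrite oner_eq0.
  exists g => //; rewrite subr_eq0 eq_sym; apply/eqP=> /eqP.
  rewrite -(prim_order_dvd gP) => /(dvdn_leq (isT : 0 < 2)%N); apply/negP; rewrite -ltnNge.
  by rewrite ltn_predRL; apply: leq_trans q9.
apply: (axis_vm m (transv v0 (m ^+ 2 / (1 - m ^+ 2) / (v0.1 * v0.2)))) => //.
rewrite vact_tv /N /=.
set A := (X in X * _); have -> : A = 0 by rewrite /A; field; rewrite ?m0 ?m1 ?v10 ?v20.
by rewrite mul0r.
Qed.

End Split.

Section SplitPair.

Variables (F : finFieldType) (gl : gl2 F) (H : {group gl}).
Local Notation sl := (@sl F gl).
Local Notation transv := (@transv F gl).
Local Notation dgsl := (@dgsl F gl).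
Hypothesis sHG : H \subset SL gl.
Hypothesis Hdg : forall s, s != 0 -> exists2 e, e ^+ 2 = 1 & dgsl (e * s) \in H.

Variables e f g h : F.
Hypothesis det1 : e * h - f * g = 1.
Hypothesis yH : sl e f g h \in H.

Lemma dg_mul_tv s : s != 0 -> f != 0 -> s * e + h / s = 2%:R ->
  (dgsl s * sl e f g h)%g = transv ((s * e - 1) / (f * s), 1) (f * s).
Proof.
move=> s0 f0 tr2; rewrite sl_mul ?dg_det // /transv /=.
have hE : h = s * (2%:R - s * e) by rewrite -tr2; field.
have gE : g = (e * (s * (2%:R - s * e)) - 1) / f by rewrite -hE -det1; field.
by congr sl; rewrite ?gE ?hE; field; rewrite ?s0 ?f0.
Qed.

(** Only one of the two lifts of a diagonal element is known to be in H; the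
    square removes the sign. *)
Lemma dg_mul_tv_sign s k : k ^+ 2 = 1 -> s != 0 -> f != 0 -> s * e + h / s = 2%:R ->
  dgsl (k * s) \in H -> transv ((s * e - 1) / (f * s), 1) (f * s + f * s) \in H.
Proof.
move=> k2 s0 f0 tr2 dH; have k0 := sign_neq0 k2.
rewrite -tvD -dg_mul_tv //.
suff -> : (dgsl s * sl e f g h * (dgsl s * sl e f g h) =
           dgsl (k * s)%R * sl e f g h * (dgsl (k * s)%R * sl e f g h))%g.
  by rewrite !groupM.
have det2 x : x != 0 -> (x * e + 0 * g) * (0 * f + x^-1 * h) - (x * f + 0 * h) * (0 * e + x^-1 * g) = 1.
  by move=> x0; rewrite -det1; field.
rewrite !sl_mul ?dg_det ?det2 ?mulf_neq0 // invfM (sign_inv k2).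
by congr sl; ring: k2.
Qed.

(** From - f g = r^2 and e h = 1 - r^2, the equation s e + h / s = 2 has the
    solutions s = (1 + r) / e and s = (1 - r) / e. *)
Lemma split_pair_odd r : 2%:R != 0 :> F -> (9 < #|F|)%N -> f * g = - r ^+ 2 -> r != 0 ->
  (e != 0) || (h != 0) -> SL gl \subset H.
Proof.
move=> c2 q9 fg r0 eh0.
have f0 : f != 0.
  by apply: contraTneq r0 => f0; move/eqP: fg; rewrite f0 mul0r eq_sym oppr_eq0 sqrf_eq0 => ->.
have eh : e * h = (1 + r) * (1 - r) by rewrite -[LHS](subrK (f * g)) det1 fg; ring.
have [s s0 [tr2 n0]] : exists2 s, s != 0 & s * e + h / s = 2%:R /\ s * e - 1 != 0.
  have [e0|e0] := eqVneq e 0.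
    move: eh0; rewrite e0 eqxx /= => h0; exists (h / 2%:R).
      by rewrite mulf_neq0 ?invr_eq0.
    by rewrite !mulr0 !add0r; split; [field; rewrite ?h0 ?c2 | rewrite oppr_eq0 oner_eq0].
  have [r' r'0 [eh' r'1]] : exists2 r', r' != 0 & e * h = (1 + r') * (1 - r') /\ 1 + r' != 0.
    have [r1|r1] := eqVneq (1 + r) 0; last by exists r.
    exists (- r); rewrite ?oppr_eq0 //; split; first by rewrite eh; ring.
    by have -> : 1 - r = 2%:R - (1 + r) by [ring]; rewrite r1 subr0.
  exists ((1 + r') / e); first by rewrite mulf_neq0 ?invr_eq0.
  have -> : h = (1 + r') * (1 - r') / e by rewrite -eh'; field.
  by split; [field; rewrite ?e0 ?r'1 | rewrite divfK // addrC addKr].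
have [k k2 dH] := Hdg s0.
apply: (split_generation_odd sHG Hdg _ _ (dg_mul_tv_sign k2 s0 f0 tr2 dH)) => //=.
  by rewrite mulr1 !mulf_neq0 ?invr_eq0 ?mulf_neq0.
by rewrite -mulr2n -mulr_natl !mulf_neq0.
Qed.

(** In characteristic 2 the trace s e + h / s vanishes for s^2 = h / e. *)
Lemma split_pair_even : 2%:R = 0 :> F -> e != 0 -> h != 0 -> f * g != 0 -> SL gl \subset H.
Proof.
move=> c2 e0 h0; rewrite mulf_eq0 negb_or => /andP[f0 g0].
have [s es] := is_squareP _ (square_char2 (h / e) c2).
have s0 : s != 0.
  by rewrite -(sqrf_eq0 s) -es mulf_neq0 ?invr_eq0.
have tr2 : s * e + h / s = 2%:R.
  have -> : h = s ^+ 2 * e by rewrite -es divfK.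
  have -> : s * e + s ^+ 2 * e / s = 2%:R * (s * e) by field.
  by rewrite c2 mul0r.
have [k k2 dH] := Hdg s0.
have k1 : k = 1.
  apply/eqP; rewrite -subr_eq0 -sqrf_eq0.
  have -> : (k - 1) ^+ 2 = k ^+ 2 - 1 - 2%:R * (k - 1) by ring.
  by rewrite c2 mul0r k2 subrr subr0.
have uH : transv ((s * e - 1) / (f * s), 1) (f * s) \in H.
  by rewrite -dg_mul_tv // groupM // -[s]mul1r -k1.
have n0 : s * e - 1 != 0.
  apply/eqP=> /eqP; rewrite subr_eq0 => /eqP se1.
  have /eqP := det1; have -> : h = s by move: tr2; rewrite se1 -[2%:R]/(1 + 1) => /addrI h1; rewrite -[h](divfK s0) h1 mul1r.
  by rewrite [e * s]mulrC se1 -subr_eq0 addrAC subrr sub0r oppr_eq0 mulf_eq0 (negPf f0) (negPf g0).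
apply: (split_generation_even sHG Hdg _ _ uH c2) => //=.
- by rewrite mulr1 !mulf_neq0 ?invr_eq0 ?mulf_neq0.
- by rewrite mulf_neq0.
have -> : 1 + f * s * ((s * e - 1) / (f * s)) * 1 = s * e by field; rewrite ?f0 ?s0.
by rewrite mulf_neq0.
Qed.

End SplitPair.

(** * Eigenvectors and the Beauville conditions *)

Section Eigenvectors.

Variables (F : finFieldType) (gl : gl2 F).
Local Notation sl := (@sl F gl).
Local Notation transv := (@transv F gl).
Implicit Types (a b c d e f g h k s : F) (x y z : gl) (v w : F * F).

Definition wedge v w : F := v.1 * w.2 - v.2 * w.1.

Definition eigen v x k := [/\ v != (0, 0), k != 0 & vact v x = vscale k v].

Lemma SL_det x : x \in SL gl -> \det (gmx x) = 1.
Proof. by rewrite inE => /eqP. Qed.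

Lemma eigenX v x k n : eigen v x k -> eigen v (x ^+ n)%g (k ^+ n).
Proof.
case=> v0 k0 vx; split; rewrite ?expf_neq0 //.
elim: n => [|n IHn]; first by rewrite vact1 /vscale expr0 !mul1r -surjective_pairing.
rewrite expgSr vactM IHn vact_scale vx /vscale /= exprSr.
by rewrite !mulrA.
Qed.

Lemma vscale_inj k l v : v != (0, 0) -> vscale k v = vscale l v -> k = l.
Proof.
case: v => a b; rewrite xpair_eqE negb_and /vscale /= => nz [ea eb].
by case/orP: nz => nz; [apply: (mulIf nz) | apply: (mulIf nz)].
Qed.

Lemma eigen_expg1 v x k n : eigen v x k -> (x ^+ n = 1)%g -> k ^+ n = 1.
Proof.
move=> ev xn1; have [v0 _] := eigenX n ev; rewrite xn1 vact1 => e.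
by apply: (vscale_inj v0); rewrite -e /vscale !mul1r -surjective_pairing.
Qed.

Lemma eigenJ v x k z : eigen v x k -> eigen (vact v z) (x ^ z)%g k.
Proof.
case=> v0 k0 vx; split=> //; last by rewrite -vactM -conjgC vactM vx vact_scale.
apply: contraNneq v0 => e; have <- : vact (vact v z) z^-1%g = v by rewrite -vactM mulgV vact1.
by rewrite e /vact /= !mul0r addr0.
Qed.

Lemma vact_inj x y : (forall v, vact v x = vact v y) -> x = y.
Proof.
move=> exy; apply: gmx_inj; rewrite [LHS]mx2_eta [RHS]mx2_eta.
have := exy (1, 0); have := exy (0, 1); rewrite /vact /= !mul1r !mul0r !add0r !addr0.
by case=> -> -> [-> ->].
Qed.

Lemma wedge_decomp v w (u : F * F) : wedge v w != 0 ->
  exists al be, u = (al * v.1 + be * w.1, al * v.2 + be * w.2).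
Proof.
move=> nz; exists (wedge u w / wedge v w), (wedge v u / wedge v w).
case: u v w nz => u1 u2 [v1 v2] [w1 w2]; rewrite /wedge /= => nz.
by congr pair; field.
Qed.

Lemma vact_lin x al be v w : vact (al * v.1 + be * w.1, al * v.2 + be * w.2) x =
  (al * (vact v x).1 + be * (vact w x).1, al * (vact v x).2 + be * (vact w x).2).
Proof. by rewrite /vact /=; congr pair; ring. Qed.

Lemma scalar_of_eigen v w x k : wedge v w != 0 -> vact v x = vscale k v ->
  vact w x = vscale k w -> forall u, vact u x = vscale k u.
Proof.
move=> nz vx wx u; have [al [be ->]] := wedge_decomp u nz.
by rewrite vact_lin vx wx /vscale /=; congr pair; ring.
Qed.

Lemma wedge_eq0 v w : v != (0, 0) -> wedge v w = 0 -> exists k, w = vscale k v.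
Proof.
case: v w => v1 v2 [w1 w2]; rewrite xpair_eqE negb_and /wedge /vscale /= => nz e.
have {}e : v1 * w2 = v2 * w1 by apply/eqP; rewrite -subr_eq0 e.
case/orP: nz => nz; [exists (w1 / v1) | exists (w2 / v2)]; rewrite divfK //; congr pair.
  by apply: (mulfI nz); rewrite e; field.
by apply: (mulfI nz); rewrite -e; field.
Qed.

(** An element y that commutes with x maps an eigenvector v, and then also v x,
    to its multiple by the same k.  As v x is not proportional to v, y is scalar,
    and it has determinant 1. *)
Lemma commute_eigen_sqr1 x y v k : x \in SL gl -> y \in SL gl -> commute x y ->
  (forall w l, ~ eigen w x l) -> eigen v y k -> (y ^+ 2 = 1)%g.
Proof.
move=> xG yG cxy nx [v0 k0 vy].
have nz : wedge v (vact v x) != 0.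
  apply/eqP=> /(wedge_eq0 v0)[l el]; apply: (nx v l); split=> //.
  apply: contraNneq v0 => l0; have <- : vact (vact v x) x^-1%g = v by rewrite -vactM mulgV vact1.
  by rewrite el l0 /vact /vscale /= !mul0r addr0.
have vxy : vact (vact v x) y = vscale k (vact v x) by rewrite -vactM cxy vactM vy vact_scale.
have ysc := scalar_of_eigen nz vy vxy.
have k2 : k ^+ 2 = 1.
  have [p [q [r [s [det1 ey]]]]] := SLE yG.
  have := ysc (1, 0); have := ysc (0, 1); rewrite ey !vact_sl // /vscale /=.
  rewrite !mul1r !mul0r !add0r !addr0 !mulr0 !mulr1 => -[er es] [ep eq].
  by rewrite -det1 er es ep eq; ring.
apply: vact_inj => u; rewrite expgS expg1 vactM !ysc vact1 /vscale /= !mulrA -expr2 k2 !mul1r.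
by rewrite -surjective_pairing.
Qed.

(** An eigenvalue is a root of the characteristic polynomial. *)
Lemma nonsplit_no_eigen p q r s : p * s - q * r = 1 ->
  (forall k, k ^+ 2 - (p + s) * k + 1 != 0) -> forall v l, ~ eigen v (sl p q r s) l.
Proof.
move=> det1 ns [v1 v2] l [v0 l0]; rewrite vact_sl // /vscale /= => -[e1 e2].
have f1 : (l ^+ 2 - (p + s) * l + 1) * v1 = 0.
  have -> : (l ^+ 2 - (p + s) * l + 1) * v1 =
    - r * (v1 * q + v2 * s - l * v2) + (s - l) * (v1 * p + v2 * r - l * v1) by rewrite -det1; ring.
  by rewrite e1 e2 !subrr; ring.
have f2 : (l ^+ 2 - (p + s) * l + 1) * v2 = 0.
  have -> : (l ^+ 2 - (p + s) * l + 1) * v2 =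
    (p - l) * (v1 * q + v2 * s - l * v2) - q * (v1 * p + v2 * r - l * v1) by rewrite -det1; ring.
  by rewrite e1 e2 !subrr; ring.
move/eqP: f1; move/eqP: f2; rewrite !mulf_eq0 (negPf (ns l)) /= => /eqP v20 /eqP v10.
by rewrite v10 v20 eqxx in v0.
Qed.

Lemma split_eigen p q r s k : p * s - q * r = 1 -> p + s = k + k^-1 -> k != 0 ->
  k ^+ 2 != 1 -> exists v, eigen v (sl p q r s) k.
Proof.
move=> det1 tr k0 k21.
have kE : k * s = k ^+ 2 + 1 - k * p.
  have -> : k * s = k * (p + s) - k * p by ring.
  by rewrite tr; field.
have kk : k != k^-1 by apply: contra_neq k21 => kk; rewrite expr2 {2}kk divff.
have [r0|r0] := eqVneq ((r, k - p) : F * F) (0, 0); last first.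
  exists (r, k - p); split=> //; rewrite vact_sl // /vscale /=; congr pair; first by ring.
  have -> : r * q + (k - p) * s = k * s - (p * s - q * r) by ring.
  by rewrite det1 kE; ring.
case: r0 => r0 /eqP; rewrite subr_eq0 => /eqP kp.
have es : s = k^-1 by apply: (addrI p); rewrite tr kp.
exists (k - s, q); split=> //.
  by rewrite xpair_eqE negb_and subr_eq0 es kk.
by rewrite vact_sl // /vscale /= r0 -kp; congr pair; ring.
Qed.

Lemma split_expg p q r s k n : p * s - q * r = 1 -> p + s = k + k^-1 -> k != 0 ->
  k ^+ 2 != 1 -> k ^+ n = 1 -> (sl p q r s ^+ n = 1)%g.
Proof.
move=> det1 tr k0 k21 kn.
have [v ev] := split_eigen det1 tr k0 k21.
have [w ew] : exists w, eigen w (sl p q r s) k^-1.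
  apply: split_eigen => //; rewrite ?invr_eq0 //; first by rewrite invrK tr addrC.
  by rewrite exprVn invr_eq1.
have kk : k != k^-1 by apply: contra_neq k21 => kk; rewrite expr2 {2}kk divff.
have nz : wedge v w != 0.
  case: ev ew => v0 _ ev [w0 _ ew]; apply/eqP=> /(wedge_eq0 v0)[l el].
  case/eqP: kk; apply: (vscale_inj w0); rewrite -ew el vact_scale ev /vscale /=.
  by congr pair; ring.
have [_ _ evn] := eigenX n ev; have [_ _ ewn] := eigenX n ew.
rewrite exprVn kn invr1 in ewn; rewrite kn in evn.
apply: vact_inj => u; rewrite (scalar_of_eigen nz evn ewn) vact1 /vscale !mul1r.
by rewrite -surjective_pairing.
Qed.

Lemma split_order_geq p q r s k n : p * s - q * r = 1 -> p + s = k + k^-1 -> k != 0 ->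
  k ^+ 2 != 1 -> (forall m, (0 < m < n)%N -> k ^+ m != 1) -> (n <= #[sl p q r s])%N.
Proof.
move=> det1 tr k0 k21 kn; have [v ev] := split_eigen det1 tr k0 k21.
rewrite leqNgt; apply/negP=> lt_n; have := kn #[sl p q r s]%g.
by rewrite order_gt0 lt_n (eigen_expg1 ev (expg_order _)) eqxx => /(_ isT).
Qed.

Lemma tvX v a n : (transv v a ^+ n)%g = transv v (a *+ n).
Proof. by elim: n => [|n IHn]; rewrite ?mulr0n ?tv0 // expgS IHn tvD -mulrS. Qed.

(** A unipotent matrix is a transvection. *)
Lemma trace2_tv p q r s : p * s - q * r = 1 -> p + s = 2%:R ->
  exists v a, sl p q r s = transv v a.
Proof.
move=> det1 tr; have sE : s = 2%:R - p by rewrite -tr addrC addKr.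
have [q0|q0] := eqVneq q 0.
  have p1 : p = 1.
    apply/eqP; rewrite -subr_eq0 -sqrf_eq0; apply/eqP.
    have -> : (p - 1) ^+ 2 = 1 - (p * s - q * r) by rewrite q0 sE; ring.
    by rewrite det1 subrr.
  by exists (1, 0), (- r); rewrite /transv; congr sl; rewrite ?q0 ?sE ?p1 /=; ring.
exists ((p - 1) / q, 1), q; rewrite /transv /=.
have rE : r = (p * s - 1) / q by rewrite -det1; field.
by congr sl; rewrite ?rE ?sE; field.
Qed.

Lemma trace2_expg p q r s n : p * s - q * r = 1 -> p + s = 2%:R -> n%:R = 0 :> F ->
  (sl p q r s ^+ n = 1)%g.
Proof.
move=> det1 tr n0; have [v [a ->]] := trace2_tv det1 tr.
by rewrite tvX -mulr_natr n0 mulr0 tv0.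
Qed.

End Eigenvectors.

Section Criterion.

Variables (F : finFieldType) (gl : gl2 F).
Local Notation sl := (@sl F gl).
Implicit Types (a b c d e f g h k s : F) (x y z : gl) (v w : F * F).

(** The determinant of x y - y x, for x and y of rows (a, b), (c, d) and
    (e, f), (g, h). *)
Definition commdet a b c d e f g h : F :=
  - (b * g - c * f) ^+ 2 -
  (a * f + b * h - e * b - f * d) * (c * e + d * g - g * a - h * c).

(** z = x y - y x satisfies x z = z x^-1 and y z = z y^-1, because x + x^-1 is
    the scalar tr x and y + y^-1 the scalar tr y. *)
Lemma inverting a b c d e f g h :
    a * d - b * c = 1 -> e * h - f * g = 1 -> commdet a b c d e f g h != 0 ->
  exists z : gl, [/\ (sl a b c d ^ z = (sl a b c d)^-1)%g,
    (sl e f g h ^ z = (sl e f g h)^-1)%g & \det (gmx z) = commdet a b c d e f g h].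
Proof.
move=> det1 det2 nz.
pose M := mx2 (b * g - c * f) (a * f + b * h - e * b - f * d)
  (c * e + d * g - g * a - h * c) (c * f - b * g).
have dM : \det M = commdet a b c d e f g h by rewrite mx2_det /commdet; ring.
have [z zM] : {z : gl | gmx z = M} by apply: gmx_onto; rewrite dM.
have ad : a * d = 1 + b * c by rewrite -det1; ring.
have eh : e * h = 1 + f * g by rewrite -det2; ring.
exists z; split; last by rewrite zM.
- apply: (mulgI z); rewrite -conjgC sl_inv //; apply: gmx_inj.
  rewrite !gmxM zM !sl_val //; last by rewrite -det1; ring.
  by rewrite !mx2_mul; congr mx2; ring: ad eh.
- apply: (mulgI z); rewrite -conjgC sl_inv //; apply: gmx_inj.
  rewrite !gmxM zM !sl_val //; last by rewrite -det2; ring.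
  by rewrite !mx2_mul; congr mx2; ring: ad eh.
Qed.

Lemma det_gmxV z : \det (gmx z^-1%g) * \det (gmx z) = 1.
Proof. by rewrite -det_mulmx -gmxM mulVg gmx1 det1. Qed.

Lemma SL_norm z : z \in 'N(SL gl).
Proof.
rewrite inE; apply/subsetP=> _ /imsetP[x xG ->].
by rewrite inE conjgE !gmxM !det_mulmx (SL_det xG) mul1r det_gmxV.
Qed.

Definition triple x y := (x, y, (x * y)^-1%g).

(** The elements z1 and z2 inverting the two pairs differ, up to scalars, by an
    element of SL_2 when the ratio of their determinants is a square. *)
Lemma strongly_real_pair a b c d e f g h a' b' c' d' e' f' g' h' r :
    a * d - b * c = 1 -> e * h - f * g = 1 ->
    a' * d' - b' * c' = 1 -> e' * h' - f' * g' = 1 -> r != 0 ->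
    commdet a b c d e f g h * commdet a' b' c' d' e' f' g' h' = r ^+ 2 ->
  strongly_real (SL_group gl) (triple (sl a b c d) (sl e f g h))
    (triple (sl a' b' c' d') (sl e' f' g' h')).
Proof.
move=> d1 d2 d1' d2' r0 er.
have := expf_neq0 2 r0; rewrite -er mulf_eq0 negb_or => /andP[D1 D2].
have [z1 [x1z y1z dz1]] := inverting d1 d2 D1.
have [z2 [x2z y2z dz2]] := inverting d1' d2' D2.
pose k := r / commdet a' b' c' d' e' f' g' h'.
have k0 : k != 0 by rewrite mulf_neq0 ?invr_eq0.
have dk : \det (mx2 k 0 0 k) = k ^+ 2 by rewrite mx2_det; ring.
have [zk ekz] : {zk : gl | gmx zk = mx2 k 0 0 k} by apply: gmx_onto; rewrite dk expf_neq0.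
have zkC x : (x ^ zk = x)%g.
  apply: (mulgI zk); rewrite -conjgC; apply: gmx_inj; rewrite !gmxM ekz.
  by rewrite [gmx x]mx2_eta !mx2_mul; congr mx2; ring.
pose g0 := (z1^-1 * (zk * z2))%g.
have g0G : g0 \in SL gl.
  rewrite inE !gmxM !det_mulmx ekz dk dz2; apply/eqP.
  apply: (mulIf D1); rewrite mul1r mulrAC -{1}dz1 det_gmxV mul1r.
  by apply: (mulIf D2); rewrite er /k; field.
have inSL p q s t : p * t - q * s = 1 -> sl p q s t \in SL_group gl by apply: sl_in.
exists (conj_aut (SL_group gl) z1), (conj_aut (SL_group gl) z1 * conj_aut (SL_group gl) g0)%g.
split.
- exact: Aut_aut.
- by rewrite groupM ?Aut_aut.
- by exists g0.
- by apply: Or31; rewrite /inverts !norm_conj_autE ?SL_norm ?inSL.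
apply: Or31; rewrite /inverts !permM.
have conj2 x : x \in SL gl -> conj_aut (SL_group gl) g0 (conj_aut (SL_group gl) z1 x) = (x ^ z2)%g.
  move=> xG; rewrite !norm_conj_autE ?SL_norm //; last first.
    by rewrite -(memJ_norm _ (SL_norm z1)) in xG.
  by rewrite -conjgM /g0 mulKVg conjgM zkC.
by rewrite !conj2 ?inSL.
Qed.

Definition no_conj x y := forall u v : gl, u \in <[x]>%g -> v \in <[y]>%g -> u != 1%g ->
  v \notin (u ^: SL gl)%g.

Lemma no_conj_coprime x y m n : (x ^+ m = 1)%g -> (y ^+ n = 1)%g -> coprime m n -> no_conj x y.
Proof.
move=> xm yn cmn u v /cycleP[i ->] /cycleP[j ->] u1; apply: contraNN u1.
case/imsetP=> z _ ev; rewrite -order_eq1 -dvdn1 -(eqP cmn) dvdn_gcd !order_dvdn.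
rewrite -expgM mulnC expgM xm expg1n eqxx /=.
by rewrite -(conjg_eq1 _ z) conjXg -ev -expgM mulnC expgM yn expg1n.
Qed.

(** A common conjugate of powers of x and y commutes with a conjugate of x and
    has an eigenvector, hence has order at most 2; and one of the orders is odd. *)
Lemma no_conj_nonsplit x y v k m n : x \in SL gl -> y \in SL gl ->
    (forall w l, ~ eigen w x l) -> eigen v y k ->
    (x ^+ m = 1)%g -> (y ^+ n = 1)%g -> odd m || odd n ->
  no_conj x y.
Proof.
move=> xG yG nx ey xm yn odd_mn u w /cycleP[i ->] /cycleP[j ->] u1; apply: contraNN u1.
case/imsetP=> z zG ew.
have := eigenJ z^-1%g (eigenX j ey); rewrite ew conjgK => ex.
have x2 : (x ^+ i ^+ 2 = 1)%g.
  by apply: (commute_eigen_sqr1 xG _ _ nx ex); [rewrite groupX | apply: commuteX].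
have odd_order t : (x ^+ i ^+ t = 1)%g -> odd t -> (x ^+ i = 1)%g.
  move=> xt odd_t; apply/eqP; rewrite -order_eq1 -dvdn1 -(eqP (_ : coprime 2 t)).
    by rewrite dvdn_gcd !order_dvdn x2 xt !eqxx.
  by rewrite coprime2n.
apply/eqP; case/orP: odd_mn; apply: odd_order.
  by rewrite -expgM mulnC expgM xm expg1n.
by apply/eqP; rewrite -(conjg_eq1 _ z) conjXg -ew -expgM mulnC expgM yn expg1n.
Qed.

Lemma no_conjVl x y : no_conj x y -> no_conj x^-1%g y.
Proof. by rewrite /no_conj cycleV. Qed.

Lemma no_conjVr x y : no_conj x y -> no_conj x y^-1%g.
Proof. by rewrite /no_conj cycleV. Qed.

Lemma Beauville_pair x1 y1 x2 y2 :
    x1 \in SL gl -> y1 \in SL gl -> x2 \in SL gl -> y2 \in SL gl ->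
    SL gl \subset <<[set x1; y1]>>%g -> SL gl \subset <<[set x2; y2]>>%g ->
    hyperbolic (triple x1 y1) -> hyperbolic (triple x2 y2) ->
    (forall a b : gl, a \in [:: x1; y1; (x1 * y1)%g] -> b \in [:: x2; y2; (x2 * y2)%g] ->
       no_conj a b) ->
  Beauville_structure (SL_group gl) (triple x1 y1) (triple x2 y2).
Proof.
move=> x1G y1G x2G y2G gen1 gen2 hyp1 hyp2 nc.
have gen x y : x \in SL gl -> y \in SL gl -> SL gl \subset <<[set x; y]>>%g ->
    generating_triple (SL_group gl) (triple x y).
  move=> xG yG sG; rewrite /generating_triple /=; apply/eqP; rewrite eqEsubset.
  rewrite (subset_trans sG) ?genS ?subsetUl // andbT gen_subG !subUset !sub1set.
  by rewrite groupV groupM ?xG ?yG.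
split; [by split; apply: gen | by split; rewrite /product_one /triple /= mulgV | by [] | ].
move=> a b aE bE; apply: (_ : no_conj a b).
suff {a b aE bE} side (a x y : gl) : a \in entries (triple x y) ->
    exists2 a', a' \in [:: x; y; (x * y)%g] & a = a' \/ a = a'^-1%g.
  have [a' a'E ea] := side a _ _ aE; have [b' b'E eb] := side b _ _ bE.
  have nc' := nc _ _ a'E b'E.
  by case: ea => ->; case: eb => ->; do ?[apply: no_conjVl]; do ?[apply: no_conjVr].
rewrite /entries /= !inE => /or3P[] /eqP ->; [exists x|exists y|exists (x * y)%g];
  rewrite ?inE ?eqxx ?orbT //; by [left | right].
Qed.

End Criterion.

(** * Generators of the nonsplit torus *)

Section Torus.

Variables (F : finFieldType) (gl : gl2 F).
Local Notation sl := (@sl F gl).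
Local Notation transv := (@transv F gl).
Local Notation torus_elt := (@torus_elt F gl).
Implicit Types (a b c d e f g h k s : F) (x y : gl) (v w : F * F).

(** z and z^-1 have the same image under z |-> z + z^-1, and already the number
    of nonzero z is too small for this map to be onto. *)
Lemma nonsplit_trace_exists : exists t : F, forall z, z ^+ 2 - t * z + 1 != 0.
Proof.
suff [t tN] : exists t : F, t \notin [seq z + z^-1 | z in predC1 0].
  exists t => z; apply: contraNneq tN => e.
  have z0 : z != 0 by apply: contra_eq_neq e => ->; rewrite expr0n mulr0 subrr add0r oner_neq0.
  apply/imageP; exists z; rewrite ?inE //.
  have tz : t * z = z ^+ 2 + 1 by rewrite -[LHS]addr0 -e; ring.
  by apply: (mulIf z0); rewrite tz; field.
apply/existsP; rewrite -negb_forall; apply/negP=> /forallP all_t.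
have: (#|F| <= #|predC1 (0%R : F)|)%N.
  apply: leq_trans (leq_image_card (fun z => z + z^-1) _).
  by apply/subset_leq_card/subsetP=> t _; have := all_t t; rewrite ?negbK.
by rewrite cardC1 leqNgt prednK ?ltnS ?leqnn // ltnW // finNzRing_gt1.
Qed.

Lemma involution_SL x : 2%:R != 0 :> F -> x \in SL gl -> (x ^+ 2 = 1)%g ->
  x = 1%g \/ x = sl (-1) 0 0 (-1).
Proof.
move=> c2 /SLE[p [q [r [s [det1 ->]]]]]; rewrite expgS expg1 => x2.
have det2 : s * p - - q * - r = 1 by rewrite -det1; ring.
have : sl p q r s = (sl p q r s)^-1%g by apply: (mulgI (sl p q r s)); rewrite x2 mulgV.
rewrite sl_inv // => /sl_inj[] // ps qq rr _.
have half0 (z : F) : z = - z -> z = 0.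
  by move=> zz; apply: (mulfI c2); rewrite mulr0 mulr_natl mulr2n {2}zz subrr.
rewrite -ps (half0 _ qq) (half0 _ rr).
have : (p - 1) * (p + 1) == 0.
  have -> : (p - 1) * (p + 1) = p * s - q * r - 1 by rewrite -ps (half0 _ qq); ring.
  by rewrite det1 subrr.
by rewrite mulf_eq0 subr_eq0 addr_eq0 => /orP[]/eqP ->; [left; rewrite sl1 | right].
Qed.

Variable t : F.
Hypothesis t_nonsplit : forall z, z ^+ 2 - t * z + 1 != 0.
Local Notation cnorm := (cnorm t).
Local Notation telt := (torus_elt t).

Definition torus : {set gl} := 'C_(SL gl)[sl 0 1 (-1) t]%g.
Canonical torus_group := [group of torus].

Lemma gen_det : 0 * t - 1 * -1 = 1 :> F. Proof. by ring. Qed.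

Lemma torusE x : reflect (exists a b, cnorm (a, b) = 1 /\ x = telt a b) (x \in torus).
Proof.
rewrite inE; apply: (iffP andP) => [[/SLE[p [q [r [s [det1 ->]]]]] /cent1P cx]|[a [b [nab ->]]]].
  exists p, q; move/(congr1 (@gmx _ _)): cx.
  rewrite !gmxM !sl_val ?gen_det // !mx2_mul => /mx2_inj[e1 e2 _ _].
  have er : r = - q.
    by have -> : r = 0 * p + 1 * r by [ring]; rewrite -e1; ring.
  have es : s = p + t * q.
    by have -> : s = 0 * q + 1 * s by [ring]; rewrite -e2; ring.
  by rewrite /torus_elt -er -es; split=> //; rewrite -det1 /cnorm /= er es; ring.
have det1 := cmul_det nab; split; first exact: sl_in.
apply/cent1P; rewrite /commute /torus_elt !sl_mul ?gen_det //.
by congr sl; ring.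
Qed.

Lemma torus_mul a b c d : cnorm (a, b) = 1 -> cnorm (c, d) = 1 ->
  (telt a b * telt c d)%g = telt (a * c - b * d) (a * d + b * c + t * b * d).
Proof. by move=> n1 n2; rewrite /torus_elt sl_mul ?cmul_det //; congr sl; ring. Qed.

Lemma torus_abelian : abelian torus.
Proof.
apply/centsP=> _ /torusE[a [b [n1 ->]]] _ /torusE[c [d [n2 ->]]].
by rewrite /commute !torus_mul //; congr torus_elt; ring.
Qed.

Lemma torus_cyclic : cyclic torus.
Proof.
apply: (@div_ring_mul_group_cyclic _ _ 'M[F]_2 (@gmx F gl)) torus_abelian.
- exact: gmx1.
- by move=> x y _ _; rewrite gmxM.
move=> x; rewrite in_setD1 => /andP[x1 /torusE[a [b [nab ex]]]].
have -> : gmx x - 1 = mx2 (a - 1) b (- b) (a + t * b - 1).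
  rewrite ex sl_val ?cmul_det // -[1]/(1%:M) mx2_1 [LHS]mx2_eta !mxE /=.
  by congr mx2; rewrite subr0.
rewrite -[_ \is a GRing.unit]/(_ \in unitmx) unitmxE mx2_det unitfE.
have -> : (a - 1) * (a + t * b - 1) - b * - b = cnorm (a - 1, b) by rewrite /cnorm /=; ring.
apply: cnorm_neq0 => //; apply: contraR x1; rewrite negb_or !negbK subr_eq0 => /andP[/eqP a1 /eqP b0].
by rewrite ex a1 b0 /torus_elt mulr0 addr0 oppr0 sl1.
Qed.

(** The torus acts transitively on each level set of the norm, and the
    #|F|^2 - 1 nonzero vectors are distributed over #|F| - 1 level sets. *)
Lemma torus_card : (#|F| < #|torus|)%N.
Proof.
pose V := [set v : F * F | v != (0, 0)].
have cV : #|V| = (#|F| ^ 2).-1.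
  by rewrite -mulnn -card_prod -(cardC1 ((0, 0) : F * F)); apply: eq_card => v; rewrite !inE.
have: (#|V| <= #|[set~ (0%R : F)]| * #|torus|)%N.
  apply: (leq_card_fibres (f := cnorm)) => [v|y _].
    rewrite !inE; case: v => a b; rewrite xpair_eqE negb_and; exact: cnorm_neq0.
  have [->|[v]] := set_0Vmem [set v in V | cnorm v == y]; first by rewrite cards0.
  rewrite inE => /andP[]; rewrite inE => v0 /eqP nv.
  have nv0 : cnorm v != 0 by move: v0; case: (v) => a b; rewrite xpair_eqE negb_and; apply: cnorm_neq0.
  apply: leq_trans (leq_imset_card (fun x => vact v x) _); apply/subset_leq_card/subsetP=> w.
  rewrite inE => /andP[_ /eqP nw].
  have [|h hT [e e2 ew]] := @cnorm_level F gl torus_group t _ v w nv0 (etrans nw (esym nv)).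
    move=> a b nab; exists 1; first by rewrite expr1n.
    by rewrite !mul1r; apply/torusE; exists a, b.
  case/torusE: hT ew => [a [b [nab ->]]] ew.
  have neab : cnorm (e * a, e * b) = 1.
    by have := cnormZ t e (a, b); rewrite /vscale /= => ->; rewrite e2 nab mulr1.
  apply/imsetP; exists (telt (e * a) (e * b)); first by apply/torusE; exists (e * a), (e * b).
  by rewrite ew !vact_sl ?cmul_det // /vscale /=; congr pair; ring.
have q1 := finNzRing_gt1 F; rewrite cV cardsC1.
case: #|F| q1 => [|[|q]] // _.
have -> : ((q.+2 ^ 2).-1 = q.+1 * q.+3)%N by rewrite -mulnn; lia.
by rewrite leq_pmul2l.
Qed.

Lemma torus_gen : exists a b, [/\ cnorm (a, b) = 1, b != 0,
  (#|F| < #[telt a b])%N & <[telt a b]>%g = torus].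
Proof.
have /cyclicP[x eT] := torus_cyclic.
have /torusE[a [b [nab ex]]] : x \in torus by rewrite eT cycle_id.
exists a, b; split=> //; [|by rewrite -ex orderE -eT torus_card|by rewrite eT ex].
apply/eqP=> b0; have := torus_card.
rewrite eT -orderE; apply/negP; rewrite -leqNgt.
have x2 : (x ^+ 2 = 1)%g.
  rewrite expgS expg1 ex torus_mul // b0 -sl1 /torus_elt; move: nab; rewrite b0 /cnorm /= => nab.
  by congr sl; rewrite -?nab; ring.
have : (#[x] <= 2)%N by rewrite dvdn_leq // order_dvdn x2.
by move/leq_trans; apply; apply: finNzRing_gt1.
Qed.

(** If 4 divides #|F| - 1, then -1 is a square, and an element of the torus of
    order 4, which would have square -1 and trace 0, would have an eigenvector.
    So the order of a generator is 2 m with m odd, and its opposite has order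
    m. *)
Lemma torus_gen_odd : 2%:R != 0 :> F -> exists a b,
  [/\ cnorm (a, b) = 1, b != 0, (#|F| < #[telt a b]%g.*2)%N,
      (4 %| #|F|.-1)%N -> odd #[telt a b]%g
    & forall c d, cnorm (c, d) = 1 ->
        exists2 e, e ^+ 2 = 1 & telt (e * c) (e * d) \in <[telt a b]>%g].
Proof.
move=> c2; have [a [b [nab b0 ltN genT]]] := torus_gen.
set x := telt a b in ltN genT *.
have xG : x \in SL gl by apply: sl_in (cmul_det nab).
pose m1 := sl (-1) 0 0 (-1).
have d1 : -1 * -1 - 0 * 0 = 1 :> F by ring.
have n1 : cnorm (-1, 0) = 1 by rewrite /cnorm /=; ring.
have m1E : m1 = telt (-1) 0 by rewrite /torus_elt mulr0 addr0 oppr0.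
have m1_neq1 : m1 != 1%g.
  apply/eqP; rewrite -sl1 => /sl_inj[] // => [|e _ _ _]; first by ring.
  by case/eqP: c2; rewrite -[2%:R]/(1 + 1) -{1}e addNr.
have m1_2 : (m1 ^+ 2 = 1)%g.
  by rewrite expgS expg1 /m1 sl_mul // -sl1; congr sl; ring.
have inT c d : cnorm (c, d) = 1 -> telt c d \in <[x]>%g.
  by move=> ncd; rewrite genT; apply/torusE; exists c, d.
have even_N : ~~ odd #[x]%g.
  have : (#[m1]%g %| #[x]%g)%N by rewrite order_dvdG // m1E inT.
  have -> : #[m1]%g = 2 by apply: nt_prime_order.
  by rewrite dvdn2.
have [N_odd | not4] := boolP ((4 %| #|F|.-1) && true)%N; last first.
  exists a, b; split=> //; first by rewrite -addnn ltn_addl.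
    by move: not4; rewrite andbT => /negPf ->.
  by move=> c d ncd; exists 1; rewrite ?expr1n // !mul1r inT.
move: N_odd; rewrite andbT => q4.
pose m := #[x]%g./2.
have Nm : #[x]%g = m.*2 by rewrite -[LHS]odd_double_half (negPf even_N).
have m_gt0 : (0 < m)%N by rewrite -double_gt0 -Nm order_gt0.
have xm : (x ^+ m = m1)%g.
  have [] := involution_SL c2 (groupX m xG) => //.
    by rewrite -expgM muln2 -Nm expg_order.
  move/eqP; rewrite -order_dvdn Nm -muln2 => /dvdn_leq; lia.
have m_odd : odd m.
  apply/negPn/negP=> m_even.
  have mE : m = m./2.*2 by rewrite -[LHS]odd_double_half (negPf m_even).
  pose y := (x ^+ m./2)%g.
  have y2 : (y ^+ 2 = m1)%g by rewrite /y -expgM muln2 -mE.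
  have [c [d [ncd ey]]] : exists c d, cnorm (c, d) = 1 /\ y = telt c d.
    by apply/torusE; rewrite -genT groupX ?cycle_id.
  have [g gP] := primitive_element F.
  pose i0 : F := g ^+ (#|F|.-1 %/ 4).
  have q1 := finNzRing_gt1 F; have qp : (0 < #|F|.-1)%N by case: #|F| q1 => [|[|q]].
  have i2 : i0 ^+ 2 = -1.
    have i4 : (i0 ^+ 2 - 1) * (i0 ^+ 2 + 1) = 0.
      have -> : (i0 ^+ 2 - 1) * (i0 ^+ 2 + 1) = i0 ^+ 4 - 1 by ring.
      by rewrite /i0 -exprM divnK // (prim_expr_order gP) subrr.
    move/eqP: i4; rewrite mulf_eq0 => /orP[|]; last by rewrite addr_eq0 => /eqP.
    rewrite subr_eq0 /i0 -exprM -(prim_order_dvd gP) => /dvdn_leq.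
    have := divnK q4; rewrite muln_gt0; lia.
  move: y2; rewrite ey expgS expg1 torus_mul // m1E => /(congr1 (@gmx _ _)).
  have nn : cnorm (c * c - d * d, c * d + d * c + t * d * d) = 1.
    have -> : cnorm (c * c - d * d, c * d + d * c + t * d * d) = cnorm (c, d) ^+ 2.
      by rewrite /cnorm /=; ring.
    by rewrite ncd expr1n.
  rewrite !sl_val ?cmul_det // => /mx2_inj[e1 e2 _ _].
  have : d * (c + c + t * d) = 0 by rewrite -e2; ring.
  move/eqP; rewrite mulf_eq0 => /orP[/eqP d0|/eqP tr0].
    have /eqP : (-1 : F) = 1 by rewrite -e1 -ncd /cnorm /= d0; ring.
    by rewrite eq_sym -addr_eq0 (negPf c2).
  have : cnorm (c - i0, d) = 0.
    have -> : cnorm (c - i0, d) = cnorm (c, d) + i0 ^+ 2 - i0 * (c + c + t * d).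
      by rewrite /cnorm /=; ring.
    by rewrite ncd i2 tr0; ring.
  case/(cnorm_eq0 t_nonsplit) => _ d0.
  have /eqP : (-1 : F) = 1 by rewrite -e1 -ncd /cnorm /= d0; ring.
  by rewrite eq_sym -addr_eq0 (negPf c2).
have cmN c d : cnorm (c, d) = 1 -> (m1 * telt c d)%g = telt (- c) (- d).
  by move=> ncd; rewrite m1E torus_mul //; congr torus_elt; ring.
have cnN c d : cnorm (- c, - d) = cnorm (c, d) by rewrite /cnorm /=; ring.
have m1X i : (m1 ^+ i = if odd i then m1 else 1)%g.
  rewrite -{1}(odd_double_half i) expgD -mul2n expgM m1_2 expg1n mulg1.
  by case: odd; rewrite ?expg1.
have cx : commute m1 x by rewrite -xm; apply: commute_sym; apply: commuteX.
have zE : telt (- a) (- b) = (m1 * x)%g by rewrite cmN.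
exists (- a), (- b); rewrite cnN oppr_eq0 zE.
split=> //.
- apply: leq_trans ltN _; rewrite Nm leq_double dvdn_leq ?order_gt0 //.
  have : (x ^+ #[m1 * x].*2 = 1)%g.
    have := expg_order (m1 * x)%g; move: #[_]%g => k; rewrite expgMn // => e.
    by rewrite -mul2n mulnC expgM -[(x ^+ k)%g](mulKg (m1 ^+ k)%g) e mulg1 expgVn -expgM mulnC expgM m1_2 expg1n invg1.
  by move/eqP; rewrite -order_dvdn Nm -!muln2 dvdn_pmul2r.
- move=> _; have : (#[m1 * x]%g %| m)%N.
    by rewrite order_dvdn expgMn // m1X m_odd xm -[(m1 * m1)%g]/(m1 ^+ 2)%g m1_2.
  by move=> dvd_m; apply: dvdn_odd dvd_m m_odd.
move=> c d ncd; have /cycleP[i ei] := inT c d ncd.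
have zi : ((m1 * x) ^+ i = if odd i then telt (- c) (- d) else telt c d)%g.
  by rewrite expgMn // m1X -ei; case: odd; rewrite ?mul1g ?cmN.
case oi: (odd i) zi => zi; [exists (-1) | exists 1]; rewrite ?sqrrN ?expr1n //.
  by rewrite !mulN1r -zi groupX ?cycle_id.
by rewrite !mul1r -zi groupX ?cycle_id.
Qed.

End Torus.

(** * Triples in odd characteristic *)

Section Hyperbolic.
Import Order.TTheory Num.Theory.

Lemma inv_sum_lt1 (a b c a0 b0 c0 : nat) :
    (0 < a0)%N -> (0 < b0)%N -> (0 < c0)%N -> (a0 <= a)%N -> (b0 <= b)%N -> (c0 <= c)%N ->
    (a0%:R^-1 + b0%:R^-1 + c0%:R^-1 < 1 :> rat) ->
  (a%:R^-1 + b%:R^-1 + c%:R^-1 < 1 :> rat).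
Proof.
move=> a00 b00 c00 la lb lc; apply: le_lt_trans.
have inv_le m n : (0 < m)%N -> (m <= n)%N -> (n%:R^-1 <= m%:R^-1 :> rat).
  by move=> m0 mn; rewrite lef_pV2 ?ler_nat // posrE ltr0n // (leq_trans m0).
by rewrite !lerD ?inv_le.
Qed.

Lemma inv_sum_334 (a b c : nat) : (3 <= a)%N -> (3 <= b)%N -> (4 <= c)%N ->
  (a%:R^-1 + b%:R^-1 + c%:R^-1 < 1 :> rat).
Proof.
have lt1 : (3%:R^-1 + 3%:R^-1 + 4%:R^-1 < 1 :> rat) by lra.
move=> la lb lc; exact: (@inv_sum_lt1 a b c 3 3 4 isT isT isT la lb lc lt1).
Qed.

Lemma inv_sum_433 (a b c : nat) : (4 <= a)%N -> (3 <= b)%N -> (3 <= c)%N ->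
  (a%:R^-1 + b%:R^-1 + c%:R^-1 < 1 :> rat).
Proof.
have lt1 : (4%:R^-1 + 3%:R^-1 + 3%:R^-1 < 1 :> rat) by lra.
move=> la lb lc; exact: (@inv_sum_lt1 a b c 4 3 3 isT isT isT la lb lc lt1).
Qed.

Lemma inv_sum_273 (a b c : nat) : (2 <= a)%N -> (7 <= b)%N -> (3 <= c)%N ->
  (a%:R^-1 + b%:R^-1 + c%:R^-1 < 1 :> rat).
Proof.
have lt1 : (2%:R^-1 + 7%:R^-1 + 3%:R^-1 < 1 :> rat) by lra.
move=> la lb lc; exact: (@inv_sum_lt1 a b c 2 7 3 isT isT isT la lb lc lt1).
Qed.

End Hyperbolic.

Section Triples.

Variables (F : finFieldType) (gl : gl2 F).
Local Notation sl := (@sl F gl).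
Local Notation transv := (@transv F gl).
Local Notation torus_elt := (@torus_elt F gl).
Local Notation dgsl := (@dgsl F gl).
Implicit Types (a b c d e f g h k s : F) (x y : gl) (v w : F * F).

Lemma order_geq3 x : (x ^+ 1 != 1)%g -> (x ^+ 2 != 1)%g -> (3 <= #[x])%N.
Proof.
move=> x1 x2; rewrite leqNgt; apply/negP.
by have := expg_order x; have := order_gt0 x; case: #[x]%g => [|[|[|n]]] // _ /eqP; rewrite ?(negPf x1) ?(negPf x2).
Qed.

Lemma dgX k n : k != 0 -> (dgsl k ^+ n)%g = dgsl (k ^+ n).
Proof.
move=> k0; elim: n => [|n IHn]; first by rewrite /dgsl expr0 invr1 sl1.
rewrite expgS IHn /dgsl sl_mul ?dg_det ?expf_neq0 // exprS invfM.
by congr sl; ring.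
Qed.

Lemma gen_sub x y : x \in SL gl -> y \in SL gl -> <<[set x; y]>>%g \subset SL gl.
Proof. by move=> xG yG; rewrite gen_subG subUset !sub1set xG. Qed.

(** The traces of y and of x y, for x diagonal with eigenvalues k and k^-1, are
    two linear equations for the diagonal of y; the last hypothesis says that
    1 - e h is the square of r' up to the square factor (k - k^-1)^2. *)
Lemma split_pair_exists k m n r :
    k != 0 -> k ^+ 2 != 1 -> m != 0 -> n != 0 -> r != 0 ->
    (n + n^-1 - (k * m + (k * m)^-1)) * (n + n^-1 - (k / m + m / k)) = r ^+ 2 ->
  exists e f g h r', [/\ e * h - f * g = 1, e + h = m + m^-1,
    k * e + k^-1 * h = n + n^-1, f * g = - r' ^+ 2 & r' != 0].
Proof.
move=> k0 k21 m0 n0 r0 er; pose d := k - k^-1.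
have d0 : d != 0.
  by rewrite subr_eq0; apply: contra_neq k21 => kk; rewrite expr2 {2}kk divff.
have kk0 : k ^+ 2 - 1 != 0 by rewrite subr_eq0.
have dE : d = (k ^+ 2 - 1) / k by rewrite /d; field.
pose b := m + m^-1; pose c := n + n^-1.
exists ((c - b / k) / d), 1, (- (r / d) ^+ 2), ((k * b - c) / d), (r / d).
split.
- rewrite [X in _ - 1 * - X]exprMn -er dE /b /c; field.
  by rewrite k0 kk0 m0 n0.
- by rewrite dE /b /c; field; rewrite k0 kk0 m0 n0.
- by rewrite dE /b /c; field; rewrite k0 kk0 m0 n0.
- by rewrite mul1r.
- by rewrite mulf_neq0 ?invr_eq0.
Qed.

Lemma no_eigen_cmul (t a b : F) : (forall z, z ^+ 2 - t * z + 1 != 0) ->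
  cnorm t (a, b) = 1 -> b != 0 -> forall v l, ~ eigen v (torus_elt t a b) l.
Proof.
move=> ns nab b0; apply: nonsplit_no_eigen (cmul_det nab) _ => k.
have -> : k ^+ 2 - (a + (a + t * b)) * k + 1 = cnorm t (a - k, b).
  by rewrite -[1 in LHS]nab /cnorm /=; ring.
by apply: cnorm_neq0; rewrite // b0 orbT.
Qed.

Lemma trace_cmul_neq2 (t a b : F) : (forall z, z ^+ 2 - t * z + 1 != 0) ->
  cnorm t (a, b) = 1 -> b != 0 -> a + (a + t * b) != 2%:R.
Proof.
move=> ns nab b0; rewrite -subr_eq0 -oppr_eq0.
have -> : - (a + (a + t * b) - 2%:R) = cnorm t (a - 1, b).
  have -> : cnorm t (a - 1, b) = cnorm t (a, b) + 1 - (a + (a + t * b)) by rewrite /cnorm /=; ring.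
  by rewrite nab; ring.
by apply: cnorm_neq0; rewrite // b0 orbT.
Qed.

Section Characteristic.

Variables (p e : nat).
Hypothesis (p_pr : prime p) (e_gt0 : (0 < e)%N) (qE : #|F| = (p ^ e)%N).

Lemma coprime_char n : (n %| #|F|.-1)%N -> coprime p n.
Proof.
move=> dvd_n; have q0 : (0 < #|F|)%N by apply: ltnW (finNzRing_gt1 F).
apply: coprime_dvdr dvd_n _; apply: (@coprime_dvdl p #|F|); first by rewrite qE dvdn_exp.
by rewrite coprime_sym -{2}(prednK q0) coprimenS.
Qed.

Lemma pcharF : p%:R = 0 :> F.
Proof. by apply/eqP; case/andP: (card_finPcharP qE p_pr). Qed.

Lemma order_char x : (2 < p)%N -> (x ^+ p = 1)%g -> x != 1%g -> (3 <= #[x])%N.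
Proof.
move=> p2 xp x1; suff -> : #[x]%g = p by [].
have : (#[x]%g %| p)%N by rewrite order_dvdn xp.
by case/primeP: p_pr => _ /[apply] /orP[]; rewrite ?order_eq1 ?(negPf x1) // => /eqP.
Qed.

(** With x = transv (1, 0) (- j), the trace of y = x^-1 z, for z in the torus, is
    a linear function of j; the choice of j makes y unipotent. *)
Lemma unipotent_triple_odd : 2%:R != 0 :> F -> (5 < #|F|)%N ->
    prime #|F| \/ (25 <= #|F|)%N ->
  exists a b c d u v w z : F, let x := sl a b c d in let y := sl u v w z in
    [/\ a * d - b * c = 1, u * z - v * w = 1,
        SL gl \subset <<[set x; y]>>%g,
        [/\ (x ^+ p = 1)%g, (y ^+ p = 1)%g,
            forall v' l, ~ eigen v' (x * y)%g l & (4 %| #|F|.-1)%N -> odd #[(x * y)%g]]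
      & hyperbolic (triple x y) /\ exists2 r, r != 0 & commdet a b c d u v w z = - r ^+ 2].
Proof.
move=> c2 q5 hq; have [t ns] := nonsplit_trace_exists F.
have [a [b [nab b0 ltN oddN genT]]] := torus_gen_odd gl ns c2.
have T2 := trace_cmul_neq2 ns nab b0.
pose j := (a + (a + t * b) - 2%:R) / b.
have j0 : j != 0 by rewrite mulf_neq0 ?invr_eq0 // subr_eq0.
have d1 : 1 * 1 - 0 * j = 1 by ring.
have d2 : a * (a + t * b - j * b) - b * (- b - j * a) = 1.
  by rewrite -[RHS]nab /cnorm /=; ring.
have xyE : (sl 1 0 j 1 * sl a b (- b - j * a) (a + t * b - j * b))%g = torus_elt t a b.
  by rewrite sl_mul // /torus_elt; congr sl; ring.
have xE : sl 1 0 j 1 = transv (1, 0) (- j) by rewrite /transv; congr sl; rewrite /=; ring.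
have xp : (sl 1 0 j 1 ^+ p = 1)%g by apply: trace2_expg pcharF.
have tr2 : a + (a + t * b - j * b) = 2%:R by rewrite /j; field.
have yp : (sl a b (- b - j * a) (a + t * b - j * b) ^+ p = 1)%g by apply: trace2_expg tr2 pcharF.
exists 1, 0, j, 1, a, b, (- b - j * a), (a + t * b - j * b) => x y.
have xG : x \in SL gl by apply: sl_in.
have yG : y \in SL gl by apply: sl_in.
have p2 : (2 < p)%N.
  rewrite ltn_neqAle prime_gt1 // andbT; apply: contraNneq c2 => p2.
  by rewrite p2 pcharF.
split=> //.
- have HG := gen_sub xG yG.
  have xH : x \in <<[set x; y]>>%g by rewrite mem_gen // !inE eqxx.
  have yH : y \in <<[set x; y]>>%g by rewrite mem_gen // !inE eqxx orbT.
  have zH : torus_elt t a b \in <<[set x; y]>>%g by rewrite -xyE groupM.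
  apply: (@nonsplit_generation _ _ _ HG t ns _ (- j)) => //.
  + move=> c d ncd; have [k k2 inT] := genT c d ncd; exists k => //.
    by apply: subsetP inT; rewrite cycle_subG.
  + by rewrite oppr_eq0.
  + by rewrite -xE.
  + by left.
  by case: hq; [left | right; right].
- split=> //; first by rewrite xyE; apply: no_eigen_cmul.
  by rewrite xyE.
split.
  rewrite /hyperbolic /triple orderV xyE.
  apply: inv_sum_334.
  - apply: order_char => //; apply/eqP; rewrite -sl1 => /sl_inj[] //; first by ring.
    by move=> _ _ e1 _; rewrite e1 eqxx in j0.
  - apply: order_char => //; apply/eqP; rewrite -sl1 => /sl_inj[] //; first by ring.
    by move=> _ e1 _ _; rewrite e1 eqxx in b0.
  have := leq_ltn_trans q5 ltN; case: #[_]%g => [|[|[|[|]]]] //.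
exists (j * b); first by rewrite mulf_neq0.
by rewrite /commdet; ring.
Qed.

(** The eigenvalues of the second triple are k, m, n and their inverses.  All
    orders divide N, and the last equation makes the determinant of x y - y x
    minus a square: for eigenvalues k and m, this determinant is minus the
    product on the left. *)
Lemma admits_of_eigenvalues (k m n r : F) (N : nat) :
    2%:R != 0 :> F -> (9 < #|F|)%N -> prime #|F| \/ (25 <= #|F|)%N ->
    (N %| #|F|.-1)%N -> odd N || (4 %| #|F|.-1)%N ->
    (forall s, s != 0 -> exists2 e, e ^+ 2 = 1 & exists i, e * s = k ^+ i) ->
    k ^+ N = 1 -> m ^+ N = 1 -> n ^+ N = 1 -> k != 0 -> m != 0 -> n != 0 ->
    k ^+ 2 != 1 -> k ^+ 3 != 1 -> m ^+ 2 != 1 -> m ^+ 2 != -1 -> n ^+ 2 != 1 -> r != 0 ->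
    (n + n^-1 - (k * m + (k * m)^-1)) * (n + n^-1 - (k / m + m / k)) = r ^+ 2 ->
  admits_strongly_real_Beauville_structure (SL_group gl).
Proof.
move=> c2 q9 hq dvdN oddN gen_k kN mN nN k0 m0 n0 k21 k31 m21 m2N n21 r0 er.
have [a [b [c [d [u [v [w [z [d1 d2 gen1 [xp yp ns oddz] [hyp1 [r1 r10 D1]]]]]]]]]]] :=
  unipotent_triple_odd c2 (ltn_trans (isT : 5 < 9)%N q9) hq.
have [f1 [f2 [f3 [f4 [r2 [d4 trm trn f23 r20]]]]]] := split_pair_exists k0 k21 m0 n0 r0 er.
have d3 := dg_det k0.
set x := sl a b c d in xp gen1 hyp1 ns oddz; set y := sl u v w z in yp gen1 hyp1 ns oddz.
pose x' := dgsl k; pose y' := sl f1 f2 f3 f4.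
have xG : x \in SL gl by apply: sl_in.
have yG : y \in SL gl by apply: sl_in.
have x'G : x' \in SL gl by apply: sl_in.
have y'G : y' \in SL gl by apply: sl_in.
have xyE : (x' * y')%g = sl (k * f1) (k * f2) (k^-1 * f3) (k^-1 * f4).
  by rewrite /x' sl_mul //; congr sl; ring.
have d5 : k * f1 * (k^-1 * f4) - k * f2 * (k^-1 * f3) = 1 by rewrite -d4; field.
have trk : k + k^-1 = k + k^-1 by [].
have x'N : (x' ^+ N = 1)%g by apply: (split_expg gl d3 trk k0 k21 kN).
have y'N : (y' ^+ N = 1)%g by apply: (split_expg gl d4 trm m0 m21 mN).
have xy'N : ((x' * y') ^+ N = 1)%g by rewrite xyE; apply: (split_expg gl d5 trn n0 n21 nN).
have [v1 ev1] := split_eigen gl d3 trk k0 k21.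
have [v2 ev2] := split_eigen gl d4 trm m0 m21.
have [v3 ev3] := split_eigen gl d5 trn n0 n21; rewrite -xyE in ev3.
have neq1 (l : F) : l ^+ 2 != 1 -> l != 1 by apply: contra_neq => ->; rewrite expr1n.
exists (triple x y), (triple x' y'); split; last first.
  apply: (@strongly_real_pair _ _ _ _ _ _ _ _ _ _ _ _ _ _ _ _ _ _ (r1 * ((k - k^-1) * r2))) => //.
    rewrite !mulf_neq0 // subr_eq0; apply: contra_neq k21 => kk.
    by rewrite expr2 {2}kk divff.
  rewrite D1 /commdet.
  set X := (X in _ * X = _); have -> : X = f2 * f3 * (k - k^-1) ^+ 2 by rewrite /X; ring.
  by rewrite f23; ring.
apply: Beauville_pair => //.
- apply: (@split_pair_odd _ _ _ (gen_sub x'G y'G) _ f1 f2 f3 f4 d4 _ r2) => //.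
  + move=> s s0; have [l l2 [i ei]] := gen_k s s0; exists l => //.
    by rewrite ei -dgX // groupX // mem_gen // !inE eqxx.
  + by rewrite mem_gen // !inE eqxx orbT.
  rewrite -negb_and; apply: contra m2N => /andP[/eqP e1 /eqP e4].
  move: trm; rewrite e1 e4 addr0 => e0; rewrite -addr_eq0.
  have -> : m ^+ 2 + 1 = m * (m + m^-1) by field.
  by rewrite -e0 mulr0.
- rewrite /hyperbolic /triple orderV xyE.
  apply: inv_sum_433.
  + apply: (split_order_geq gl d3 trk k0 k21) => -[|[|[|[|i]]]] // _.
    by rewrite expr1; apply: neq1.
  + by apply: (split_order_geq gl d4 trm m0 m21) => -[|[|[|i]]] // _; rewrite expr1; apply: neq1.
  + by apply: (split_order_geq gl d5 trn n0 n21) => -[|[|[|i]]] // _; rewrite expr1; apply: neq1.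
have cop := coprime_char dvdN.
have nc_p (g g' : gl) : (g ^+ p = 1)%g -> (g' ^+ N = 1)%g -> no_conj g g'.
  by move=> gp g'N; apply: no_conj_coprime gp g'N cop.
have nc_z (g' : gl) v' l : g' \in SL gl -> eigen v' g' l -> (g' ^+ N = 1)%g -> no_conj (x * y)%g g'.
  move=> g'G ev g'N; apply: (no_conj_nonsplit (groupM xG yG) g'G ns ev (expg_order _) g'N).
  by case/orP: oddN => [->|/oddz ->]; rewrite ?orbT.
have x'y'G : (x' * y')%g \in SL gl by rewrite groupM.
move=> g g'; rewrite !inE => /or3P[]/eqP -> /or3P[]/eqP ->;
  by [apply: nc_p | apply: nc_z ev1 _ | apply: nc_z ev2 _ | apply: nc_z ev3 _].
Qed.

End Characteristic.

End Triples.

(** * Fields of odd order at least 11 *)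

Section OddFields.

Variables (F : finFieldType) (gl : gl2 F) (p e : nat).
Hypothesis (p_pr : prime p) (e_gt0 : (0 < e)%N) (qE : #|F| = (p ^ e)%N).
Hypothesis (c2 : 2%:R != 0 :> F) (q9 : (9 < #|F|)%N) (hq : prime #|F| \/ (25 <= #|F|)%N).

Lemma prim_neq0 n (k : F) : n.-primitive_root k -> k != 0.
Proof.
move=> kP; apply/eqP=> k0; have := prim_expr_order kP; rewrite k0 expr0n.
by rewrite (gtn_eqF (prim_order_gt0 kP)) => /esym/eqP; rewrite oner_eq0.
Qed.

(** Take m = k.  The required product is a square for n = k^2 + 1 + k^-2. *)
Lemma admits_1mod4 : (4 %| #|F|.-1)%N ->
  admits_strongly_real_Beauville_structure (SL_group gl).
Proof.
move=> q4; have [k kP] := primitive_element F.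
have k0 := prim_neq0 kP.
have q12 : (12 <= #|F|.-1)%N.
  by case/dvdnP: q4 q9 => m; case: #|F| => // q /= ->; lia.
have kX i : (0 < i < 12)%N -> k ^+ i - 1 != 0.
  case/andP=> i0 i12; rewrite subr_eq0 -(prim_order_dvd kP); apply/negP=> /dvdn_leq -/(_ i0).
  by rewrite leqNgt (leq_trans i12).
have k21 : k ^+ 2 != 1 by rewrite -subr_eq0 kX.
have k31 : k ^+ 3 != 1 by rewrite -subr_eq0 kX.
have nk2 : k ^+ 2 + 1 != 0.
  by apply: contraNneq (kX 4 isT) => nk; have -> : k ^+ 4 - 1 = (k ^+ 2 + 1) * (k ^+ 2 - 1) by [ring]; rewrite nk mul0r.
have nk4 : k ^+ 4 + 1 != 0.
  by apply: contraNneq (kX 8 isT) => nk; have -> : k ^+ 8 - 1 = (k ^+ 4 + 1) * (k ^+ 4 - 1) by [ring]; rewrite nk mul0r.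
pose n := k ^+ 2 + 1 + k^-1 ^+ 2.
have n0 : n != 0.
  have nk : k ^+ 4 + k ^+ 2 + 1 != 0.
    by apply: contraNneq (kX 6 isT) => nk; have -> : k ^+ 6 - 1 = (k ^+ 4 + k ^+ 2 + 1) * (k ^+ 2 - 1) by [ring]; rewrite nk mul0r.
  have -> : n = (k ^+ 4 + k ^+ 2 + 1) / k ^+ 2 by rewrite /n; field.
  by rewrite mulf_neq0 ?invr_eq0 ?expf_neq0.
have n1 : n - 1 != 0.
  have -> : n - 1 = (k ^+ 4 + 1) / k ^+ 2 by rewrite /n; field.
  by rewrite mulf_neq0 ?invr_eq0 ?expf_neq0.
have nN1 : n + 1 != 0.
  have -> : n + 1 = (k ^+ 2 + 1) ^+ 2 / k ^+ 2 by rewrite /n; field.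
  by rewrite mulf_neq0 ?invr_eq0 ?expf_neq0.
pose r := (k ^+ 2 + 1) * (n - 1) / (n * k).
apply: (@admits_of_eigenvalues F gl p e p_pr e_gt0 qE k k n r #|F|.-1) => //;
  rewrite ?expf_pred_card ?q4 ?orbT //.
- move=> s s0; exists 1; first by rewrite expr1n.
  have [i ->] := prim_rootP kP (expf_pred_card s0).
  by exists i; rewrite mul1r.
- by rewrite -addr_eq0.
- rewrite -subr_eq0; have -> : n ^+ 2 - 1 = (n - 1) * (n + 1) by ring.
  by rewrite mulf_neq0.
- by rewrite !mulf_neq0 ?invr_eq0 ?mulf_neq0.
have -> : n + n^-1 - (k / k + k / k) = (n - 1) ^+ 2 / n by field; rewrite ?k0 ?n0.
have -> : n + n^-1 - (k * k + (k * k)^-1) = (k ^+ 2 + 1) ^+ 2 / (n * k ^+ 2).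
  have e1 : n - k ^+ 2 = (k ^+ 2 + 1) / k ^+ 2 by rewrite /n; field.
  have e2 : n * k ^+ 2 - 1 = k ^+ 2 * (k ^+ 2 + 1) by rewrite /n; field.
  have -> : n + n^-1 - (k * k + (k * k)^-1) = (n - k ^+ 2) * (n * k ^+ 2 - 1) / (n * k ^+ 2).
    by field; rewrite k0 n0.
  by rewrite e1 e2; field; rewrite k0 n0.
by rewrite /r; field; rewrite ?k0 ?n0.
Qed.

Section HalfTorus.

Variables (l : nat) (k : F).
Hypotheses (l_odd : odd l) (ql : #|F|.-1 = l.*2) (kP : l.-primitive_root k).

(** When (#|F| - 1) / 2 is odd, -1 is not a square. *)
Lemma half_gen s : s != 0 -> exists2 d, d ^+ 2 = 1 & exists i, d * s = k ^+ i.
Proof.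
move=> s0; have s2l : (s ^+ l) ^+ 2 = 1 by rewrite -exprM muln2 -ql expf_pred_card.
exists (s ^+ l) => //; have dl : (s ^+ l * s) ^+ l = 1.
  rewrite exprMn -[X in _ ^+ X * _](odd_double_half l) l_odd exprD expr1 -mul2n exprM s2l expr1n mulr1.
  by rewrite -expr2.
by have [i ->] := prim_rootP kP dl; exists i.
Qed.

(** The eigenvalues are squares here, so that all orders are odd. *)
Lemma half_admits m n r i j : m = k ^+ i -> n = k ^+ j ->
    k ^+ 2 != 1 -> k ^+ 3 != 1 -> m ^+ 2 != 1 -> n ^+ 2 != 1 -> r != 0 ->
    (n + n^-1 - (k * m + (k * m)^-1)) * (n + n^-1 - (k / m + m / k)) = r ^+ 2 ->
  admits_strongly_real_Beauville_structure (SL_group gl).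
Proof.
move=> em en k21 k31 m21 n21 r0 er.
have k0 := prim_neq0 kP; have kl := prim_expr_order kP.
have Xl x : k ^+ x ^+ l = 1 by rewrite exprAC kl expr1n.
have m0 : m != 0 by rewrite em expf_neq0.
have n0 : n != 0 by rewrite en expf_neq0.
apply: (@admits_of_eigenvalues F gl p e p_pr e_gt0 qE k m n r l) => //.
- by rewrite ql -muln2 dvdn_mulr.
- by rewrite l_odd.
- exact: half_gen.
- by rewrite em Xl.
- by rewrite en Xl.
apply/eqP=> m2; have ml : m ^+ l = 1 by rewrite em Xl.
have /eqP : m ^+ 2 ^+ l = 1 by rewrite exprAC ml expr1n.
rewrite m2 -signr_odd l_odd expr1 eq_sym -addr_eq0.
by rewrite (negPf c2).
Qed.

(** For (m, n) = (k, k^4), (k, k^6) and (k^2, k^5) the required product is, up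
    to a square factor, A = k^4 + k^2 + 1, B = k^4 + 1 and A B; one of these
    three is a square. *)
Lemma half_admits_k_k4 y : y ^+ 2 = k ^+ 4 + k ^+ 2 + 1 ->
    [/\ k ^+ 2 != 1, k ^+ 3 != 1, k ^+ 4 != 1, k ^+ 6 != 1 & k ^+ 8 != 1] ->
  admits_strongly_real_Beauville_structure (SL_group gl).
Proof.
move=> ey [k2 k3 k4 k6 k8]; have k0 := prim_neq0 kP.
apply: (@half_admits k (k ^+ 4) ((k ^+ 2 - 1) * (k ^+ 4 - 1) * y / k ^+ 4) 1 4) => //.
- by rewrite -exprM.
- rewrite !mulf_neq0 ?invr_eq0 ?expf_neq0 ?subr_eq0 //.
  apply: contraNneq k6 => y0; rewrite -subr_eq0.
  have -> : k ^+ 6 - 1 = (k ^+ 4 + k ^+ 2 + 1) * (k ^+ 2 - 1) by ring.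
  by rewrite -ey y0 expr0n mul0r.
have -> : ((k ^+ 2 - 1) * (k ^+ 4 - 1) * y / k ^+ 4) ^+ 2 =
  ((k ^+ 2 - 1) * (k ^+ 4 - 1) / k ^+ 4) ^+ 2 * y ^+ 2 by field.
by rewrite ey; field.
Qed.

Lemma half_admits_k_k6 y : y ^+ 2 = k ^+ 4 + 1 ->
    [/\ k ^+ 2 != 1, k ^+ 3 != 1, k ^+ 4 != 1, k ^+ 6 != 1 & k ^+ 8 != 1] -> k ^+ 12 != 1 ->
  admits_strongly_real_Beauville_structure (SL_group gl).
Proof.
move=> ey [k2 k3 k4 k6 k8] k12; have k0 := prim_neq0 kP.
apply: (@half_admits k (k ^+ 6) ((k ^+ 6 - 1) * (k ^+ 4 - 1) * y / k ^+ 6) 1 6) => //.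
- by rewrite -exprM.
- rewrite !mulf_neq0 ?invr_eq0 ?expf_neq0 ?subr_eq0 //.
  apply: contraNneq k8 => y0; rewrite -subr_eq0.
  have -> : k ^+ 8 - 1 = (k ^+ 4 + 1) * (k ^+ 4 - 1) by ring.
  by rewrite -ey y0 expr0n mul0r.
have -> : ((k ^+ 6 - 1) * (k ^+ 4 - 1) * y / k ^+ 6) ^+ 2 =
  ((k ^+ 6 - 1) * (k ^+ 4 - 1) / k ^+ 6) ^+ 2 * y ^+ 2 by field.
by rewrite ey; field.
Qed.

Lemma half_admits_k2_k5 y : y ^+ 2 = (k ^+ 4 + 1) * (k ^+ 4 + k ^+ 2 + 1) ->
    [/\ k ^+ 2 != 1, k ^+ 3 != 1, k ^+ 4 != 1, k ^+ 6 != 1 & k ^+ 8 != 1] -> k ^+ 10 != 1 ->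
  admits_strongly_real_Beauville_structure (SL_group gl).
Proof.
move=> ey [k2 k3 k4 k6 k8] k10; have k0 := prim_neq0 kP.
apply: (@half_admits (k ^+ 2) (k ^+ 5) ((k ^+ 2 - 1) * (k ^+ 4 - 1) * y / k ^+ 5) 2 5) => //.
- by rewrite -exprM.
- by rewrite -exprM.
- rewrite !mulf_neq0 ?invr_eq0 ?expf_neq0 ?subr_eq0 //.
  apply: contra_neq (_ : (k ^+ 8 - 1) * (k ^+ 6 - 1) != 0) => [y0|]; last first.
    by rewrite mulf_neq0 // subr_eq0.
  have -> : (k ^+ 8 - 1) * (k ^+ 6 - 1) = ((k ^+ 4 + 1) * (k ^+ 4 + k ^+ 2 + 1)) * ((k ^+ 2 - 1) * (k ^+ 4 - 1)) by ring.
  by rewrite -ey y0 expr0n mul0r.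
have -> : ((k ^+ 2 - 1) * (k ^+ 4 - 1) * y / k ^+ 5) ^+ 2 =
  ((k ^+ 2 - 1) * (k ^+ 4 - 1) / k ^+ 5) ^+ 2 * y ^+ 2 by field.
by rewrite ey; field.
Qed.

End HalfTorus.

Lemma admits_3mod4 l : #|F|.-1 = l.*2 -> odd l ->
  admits_strongly_real_Beauville_structure (SL_group gl).
Proof.
move=> ql l_odd.
have l_gt0 : (0 < l)%N by case: l l_odd {ql}.
have [l9|l9] := leqP 9 l.
  have [g gP] := primitive_element F; rewrite ql -muln2 in gP.
  have kP : l.-primitive_root (g ^+ 2).
    by have := dvdn_prim_root gP (dvdn_mulr 2 (dvdnn l)); rewrite mulKn.
  move: (g ^+ 2) kP => k kP {g gP}.
  have kX i : (0 < i < 9)%N -> k ^+ i != 1.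
    case/andP=> i0 i9; rewrite -(prim_order_dvd kP); apply/negP=> /dvdn_leq -/(_ i0).
    by rewrite leqNgt (leq_trans i9).
  have kX2 i : (0 < i < 9)%N -> k ^+ (i.*2) != 1.
    move=> hi; rewrite -(prim_order_dvd kP) -mul2n Gauss_dvdr ?coprimen2 //.
    by rewrite (prim_order_dvd kP) kX.
  have kk : [/\ k ^+ 2 != 1, k ^+ 3 != 1, k ^+ 4 != 1, k ^+ 6 != 1 & k ^+ 8 != 1].
    by split; apply: kX.
  have [/is_squareP[y ey]|ns1] := boolP (is_square (k ^+ 4 + k ^+ 2 + 1)).
    exact: (half_admits_k_k4 l_odd ql kP (esym ey)).
  have [/is_squareP[y ey]|ns2] := boolP (is_square (k ^+ 4 + 1)).
    exact: (half_admits_k_k6 l_odd ql kP (esym ey) kk (kX2 6 isT)).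
  have /is_squareP[y ey] := nonsquare_div ns2 ns1.
  apply: (@half_admits_k2_k5 l k l_odd ql kP (y * (k ^+ 4 + k ^+ 2 + 1)) _ kk (kX2 5 isT)).
  have n0 : k ^+ 4 + k ^+ 2 + 1 != 0.
    by apply: contraNneq ns1 => ->; apply/is_squareP; exists 0; rewrite expr0n.
  by rewrite exprMn -ey; field.
(* the only remaining order is 11, where 4 generates the squares *)
have l5 : l = 5%N.
  move: l_odd l9 q9 ql hq; case: #|F| => // q /=.
  case: l l_gt0 => [|[|[|[|[|[|[|[|[|]]]]]]]]] // _ _ _ q9' ql'; rewrite {}ql' // in q9' *.
  by case=> // pr15; have /negP := (isT : ~~ prime 15); case.
have q11 : #|F| = 11%N.
  by move: ql (finNzRing_gt1 F); rewrite l5; case: #|F| => // q /= ->.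
have c11 : 11%:R = 0 :> F.
  by apply/eqP; have := @card_finPcharP F 11 1; rewrite q11 => /(_ erefl isT) /andP[].
have nz i : (0 < i < 11)%N -> i%:R != 0 :> F.
  move=> hi; have c : 11 \in [pchar F] by apply: (@card_finPcharP F 11 1).
  by rewrite -(dvdn_pcharf c); case: i hi => [|i] // hi; apply/negP=> /dvdn_leq; lia.
have k5 : 4%:R ^+ 5 = 1 :> F.
  (* 4^5 = 1 + 93 * 11 *)
  by rewrite -[RHS]addr0 -(mulr0 93%:R) -c11; ring.
have kP : l.-primitive_root (4%:R : F).
  rewrite l5; have [m mP] := prim_order_exists (isT : 0 < 5)%N k5.
  case/primeP: (isT : prime 5) => _ /[apply] /orP[/eqP m1|/eqP <- //].
  move: mP; rewrite m1 => /prim_expr_order; rewrite expr1 => /eqP; rewrite -subr_eq0.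
  have -> : 4%:R - 1 = 3%:R :> F by ring.
  by rewrite (negPf (nz 3 isT)).
apply: (@half_admits_k_k4 l 4%:R l_odd ql kP 3%:R).
  (* 4^4 + 4^2 + 1 = 3^2 + 24 * 11 *)
  by rewrite -[LHS]addr0 -(mulr0 24%:R) -c11; ring.
have neq (a b c : nat) : (0 < c < 11)%N -> (a = b * 11 + c + 1)%N -> a%:R != 1 :> F.
  by move=> hc ->; rewrite !natrD natrM c11 mulr0 add0r -subr_eq0 addrK nz.
split; rewrite -natrX.
- exact: (@neq _ 1 4).
- exact: (@neq _ 5 8).
- exact: (@neq _ 23 2).
- exact: (@neq _ 372 3).
- exact: (@neq _ 5957 8).
Qed.

Theorem admits_large_odd : admits_strongly_real_Beauville_structure (SL_group gl).
Proof.
have [q4|nq4] := boolP (4 %| #|F|.-1)%N; first exact: admits_1mod4.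
have p_odd : odd p.
  have [p2|//] := even_prime p_pr.
  by case/eqP: c2; have := pcharF p_pr qE; rewrite p2.
have q_odd : odd #|F| by rewrite qE oddX p_odd orbT.
apply: (@admits_3mod4 #|F|.-1./2).
  by move: q_odd; case: #|F| => // q /= q_even; rewrite -[LHS]odd_double_half (negPf q_even).
move: nq4 q_odd; case: #|F| => // q /= nq4 q_even.
apply: contraNT nq4 => h; apply/dvdnP; exists (q./2./2).
by rewrite -{1}[q]odd_double_half (negPf q_even) -{1}[q./2]odd_double_half (negPf h); lia.
Qed.

End OddFields.

(** * Fields of even order *)

Section EvenFields.

Variables (F : finFieldType) (gl : gl2 F) (e : nat).
Local Notation sl := (@sl F gl).
Local Notation transv := (@transv F gl).
Local Notation torus_elt := (@torus_elt F gl).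
Local Notation dgsl := (@dgsl F gl).
Hypothesis (e_gt0 : (0 < e)%N) (qE : #|F| = (2 ^ e)%N) (q5 : (5 < #|F|)%N).

Let c2 : 2%:R = 0 :> F. Proof. exact: (pcharF (isT : prime 2) qE). Qed.

(** In characteristic 2 an involution of determinant 1 has trace 0. *)
Lemma trace_neq0_order p q r s : p * s - q * r = 1 -> p + s != 0 -> (3 <= #[sl p q r s])%N.
Proof.
move=> det1 tr; have x2 : (sl p q r s ^+ 2 != 1)%g.
  apply: contra_neq tr => x2.
  have det2 : s * p - - q * - r = 1 by rewrite -det1; ring.
  have : sl p q r s = (sl p q r s)^-1%g.
    by apply: (mulgI (sl p q r s)); rewrite mulgV -x2 expgS expg1.
  rewrite sl_inv // => /sl_inj[] // -> _ _ _.
  by rewrite -mulr2n -mulr_natl c2 mul0r.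
apply: order_geq3 => //; rewrite expg1; apply: contra_neq x2 => ->.
by rewrite expg1n.
Qed.

(** The parameter j gives x y the trace T^2, where T is the trace of the
    generator y of the torus.  It is the trace of y^2, which has no
    eigenvector. *)
Lemma unipotent_triple_even :
  exists a b c d u v w z : F, let x := sl a b c d in let y := sl u v w z in
    [/\ a * d - b * c = 1, u * z - v * w = 1,
        SL gl \subset <<[set x; y]>>%g,
        [/\ (x ^+ 2 = 1)%g, forall v' l, ~ eigen v' y l & forall v' l, ~ eigen v' (x * y)%g l]
      & hyperbolic (triple x y) /\ exists2 r, r != 0 & commdet a b c d u v w z = - r ^+ 2].
Proof.
have [t ns] := nonsplit_trace_exists F.
have [a [b [nab b0 ltN genT]]] := torus_gen gl ns.
pose T := a + (a + t * b).
have T0 : T != 0 by rewrite -c2; apply: trace_cmul_neq2 nab b0.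
have TE : T = t * b by rewrite /T addrA -mulr2n -mulr_natl c2 mul0r add0r.
have n2 : cnorm t (a * T - 1, b * T) = 1.
  have -> : cnorm t (a * T - 1, b * T) = cnorm t (a, b) * T ^+ 2 - T * T + 1 by rewrite /T /cnorm /=; ring.
  by rewrite nab; ring.
have bT : b * T != 0 by rewrite mulf_neq0.
have T1 : T - 1 != 0.
  rewrite subr_eq0; apply: contraTneq ltN => T1.
  have x3 : (torus_elt t a b ^+ 3 = 1)%g.
    have x2 : (torus_elt t a b * torus_elt t a b)%g = torus_elt t (a * T - 1) (b * T).
      have e1 : a * a - b * b = a * T - 1 by rewrite -nab /T /cnorm /=; ring.
      by rewrite torus_mul //; congr torus_elt; rewrite // /T; ring.
    rewrite !expgS expg0 mulg1 mulgA x2 -sl1 torus_mul // /torus_elt.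
    have nabE : b ^+ 2 = 1 - a ^+ 2 - t * a * b by rewrite -nab /cnorm /=; ring.
    have tb : t * b = 1 - a - a by rewrite -T1 /T; ring.
    have m1 : -1 = 1 :> F by apply/eqP; rewrite eq_sym -addr_eq0 -[1 + 1]/(2%:R) c2.
    have A1 : (a * T - 1) * a - b * T * b = 1.
      rewrite T1 -[RHS]m1; have -> : (a * 1 - 1) * a - b * 1 * b = a ^+ 2 - a - b ^+ 2 by ring.
      rewrite nabE; have -> : t * a * b = a * (t * b) by ring.
      by rewrite tb; ring.
    have A2 : (a * T - 1) * b + b * T * a + t * (b * T) * b = 0.
      rewrite T1; have -> : (a * 1 - 1) * b + b * 1 * a + t * (b * 1) * b = b * (a + a + t * b) - b by ring.
      by rewrite tb; ring.
    by congr sl; rewrite ?A1 ?A2; ring.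
  rewrite -leqNgt; apply: (@leq_trans 3); last by apply: leq_trans q5.
  by rewrite dvdn_leq // order_dvdn x3.
pose j := (T ^+ 2 - T) / b.
have j0 : j != 0.
  rewrite mulf_neq0 ?invr_eq0 //.
  have -> : T ^+ 2 - T = T * (T - 1) by ring.
  by rewrite mulf_neq0.
have d1 : 1 * 1 - 0 * j = 1 by ring.
have d2 := cmul_det nab.
have xyE : (sl 1 0 j 1 * torus_elt t a b)%g = sl a b (j * a - b) (j * b + a + t * b).
  by rewrite /torus_elt sl_mul //; congr sl; ring.
have d3 : a * (j * b + a + t * b) - b * (j * a - b) = 1 by rewrite -d2; ring.
have tr3 : a + (j * b + a + t * b) = T ^+ 2 by rewrite /j /T; field.
have xE : sl 1 0 j 1 = transv (1, 0) (- j) by rewrite /transv; congr sl; rewrite /=; ring.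
exists 1, 0, j, 1, a, b, (- b), (a + t * b) => x y.
have yE : y = torus_elt t a b by [].
have xG : x \in SL gl by apply: sl_in.
have yG : y \in SL gl by apply: sl_in.
have [x1 x2] : x != 1%g /\ (x ^+ 2 = 1)%g.
  split; last by apply: trace2_expg.
  apply/eqP; rewrite -sl1 => /sl_inj[] //; first by ring.
  by move=> _ _ e1 _; rewrite e1 eqxx in j0.
split=> //.
- have HG := gen_sub xG yG.
  have xH : x \in <<[set x; y]>>%g by rewrite mem_gen // !inE eqxx.
  have yH : y \in <<[set x; y]>>%g by rewrite mem_gen // !inE eqxx orbT.
  apply: (@nonsplit_generation _ _ _ HG t ns _ (- j)) => //.
  + move=> c d ncd; exists 1; rewrite ?expr1n // !mul1r.
    have : torus_elt t c d \in <[y]>%g by rewrite yE genT; apply/torusE; exists c, d.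
    by apply: subsetP; rewrite cycle_subG.
  + by rewrite oppr_eq0.
  + by rewrite -xE.
  + right; apply: contra_neq T0 => jt.
    apply/eqP; rewrite -sqrf_eq0; apply/eqP.
    have -> : T ^+ 2 = T - - j * b by rewrite /j; field.
    by rewrite jt TE subrr.
  by right; left.
- split=> //; first by rewrite yE; apply: no_eigen_cmul.
  rewrite xyE; apply: nonsplit_no_eigen d3 _ => k; rewrite tr3.
  have -> : k ^+ 2 - T ^+ 2 * k + 1 = cnorm t (a * T - 1 - k, b * T).
    have -> : cnorm t (a * T - 1 - k, b * T) = cnorm t (a * T - 1, b * T) + k ^+ 2 - (T * T - 2%:R) * k.
      by rewrite /T /cnorm /=; ring.
    by rewrite n2 c2; ring.
  by apply: cnorm_neq0; rewrite // bT orbT.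
split.
  rewrite /hyperbolic /triple orderV.
  apply: inv_sum_273.
  - by rewrite ltn_neqAle eq_sym order_eq1 x1 order_gt0.
  - by rewrite yE; apply: leq_trans ltN; rewrite ltnS.
  by rewrite xyE; apply: trace_neq0_order; rewrite // tr3 expf_neq0.
exists (j * b); first by rewrite mulf_neq0.
by rewrite /commdet; ring.
Qed.

(** In the second triple x, y and x y have the same trace k + k^-1. *)
Theorem admits_even : admits_strongly_real_Beauville_structure (SL_group gl).
Proof.
have [a [b [c [d [u [v [w [z [d1 d2 gen1 [x2 nsy nsxy] [hyp1 [r1 r10 D1]]]]]]]]]]] := unipotent_triple_even.
set x := sl a b c d in x2 gen1 hyp1 nsxy; set y := sl u v w z in nsy gen1 hyp1 nsxy.
have [k kP] := primitive_element F.
have k0 := prim_neq0 kP.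
have q8 : (7 <= #|F|.-1)%N.
  by move: q5; rewrite qE; case: (e) => [|[|[|m]]] //; rewrite !expnS; have := expn_gt0 2 m; case: (2 ^ m)%N => //; lia.
have kX i : (0 < i < 7)%N -> k ^+ i != 1.
  case/andP=> i0 i7; rewrite -(prim_order_dvd kP); apply/negP=> /dvdn_leq -/(_ i0).
  by rewrite leqNgt (leq_trans i7).
have k21 := kX 2 isT; have k31 := kX 3 isT.
have k11 : k + 1 != 0.
  have := kX 1%N isT; rewrite expr1 -subr_eq0; apply: contra_neq => kk.
  by have -> : k - 1 = k + 1 - 2%:R by [ring]; rewrite kk c2 subrr.
pose f1 := (k + 1) / k; pose f4 := k + 1; pose f3 := f1 * f4 - 1.
have d3 := dg_det k0.
have d4 : f1 * f4 - 1 * f3 = 1 by rewrite /f3; ring.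
have tr4 : f1 + f4 = k + k^-1.
  by rewrite -[RHS]addr0 -c2 /f1 /f4; field.
have tr5 : k * f1 + k^-1 * f4 = k + k^-1.
  by rewrite -[RHS]addr0 -c2 /f1 /f4; field.
have f30 : f3 != 0.
  have -> : f3 = (k ^+ 2 + k + 1) / k by rewrite /f3 /f1 /f4; field.
  rewrite mulf_neq0 ?invr_eq0 //; apply: contraNneq k31 => kk; rewrite -subr_eq0.
  have -> : k ^+ 3 - 1 = (k ^+ 2 + k + 1) * (k - 1) by ring.
  by rewrite kk mul0r.
pose x' := dgsl k; pose y' := sl f1 1 f3 f4.
have xG : x \in SL gl by apply: sl_in.
have yG : y \in SL gl by apply: sl_in.
have x'G : x' \in SL gl by apply: sl_in.
have y'G : y' \in SL gl by apply: sl_in.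
have xyE : (x' * y')%g = sl (k * f1) k (k^-1 * f3) (k^-1 * f4).
  by rewrite /x' sl_mul //; congr sl; ring.
have d5 : k * f1 * (k^-1 * f4) - k * (k^-1 * f3) = 1 by rewrite -d4; field.
have trk : k + k^-1 = k + k^-1 by [].
pose N := #|F|.-1.
have kN : k ^+ N = 1 by apply: expf_pred_card.
have x'N : (x' ^+ N = 1)%g by apply: (split_expg gl d3 trk k0 k21 kN).
have y'N : (y' ^+ N = 1)%g by apply: (split_expg gl d4 tr4 k0 k21 kN).
have xy'N : ((x' * y') ^+ N = 1)%g by rewrite xyE; apply: (split_expg gl d5 tr5 k0 k21 kN).
have [v1 ev1] := split_eigen gl d3 trk k0 k21.
have [v2 ev2] := split_eigen gl d4 tr4 k0 k21.
have [v3 ev3] := split_eigen gl d5 tr5 k0 k21; rewrite -xyE in ev3.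
have ge4 p q r s : p * s - q * r = 1 -> p + s = k + k^-1 -> (4 <= #[sl p q r s])%N.
  move=> dd tt; apply: (split_order_geq gl dd tt k0 k21) => -[|[|[|[|i]]]] // _.
  by apply: kX.
have D2 : commdet k 0 0 k^-1 f1 1 f3 f4 = f3 * (k - k^-1) ^+ 2 by rewrite /commdet; ring.
have kk0 : k - k^-1 != 0.
  by rewrite subr_eq0; apply: contra_neq k21 => kk; rewrite expr2 {2}kk divff.
have [r er] := is_squareP _ (square_char2 (commdet a b c d u v w z * commdet k 0 0 k^-1 f1 1 f3 f4) c2).
exists (triple x y), (triple x' y'); split; last first.
  apply: (@strongly_real_pair _ _ _ _ _ _ _ _ _ _ _ _ _ _ _ _ _ _ r) => //.
  by rewrite -sqrf_eq0 -er D1 D2 !mulf_neq0 ?oppr_eq0 ?expf_neq0.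
have NN : odd N.
  by rewrite /N qE -subn1 oddB ?expn_gt0 // oddX /= orbF eqn0Ngt e_gt0.
apply: Beauville_pair => //.
- apply: (@split_pair_even _ _ _ (gen_sub x'G y'G) _ f1 1 f3 f4 d4) => //.
  + move=> s s0; exists 1; first by rewrite expr1n.
    have [i ->] := prim_rootP kP (expf_pred_card s0).
    by rewrite mul1r -dgX // groupX // mem_gen // !inE eqxx.
  + by rewrite mem_gen // !inE eqxx orbT.
  + by rewrite mulf_neq0 ?invr_eq0.
  + by rewrite mul1r.
- rewrite /hyperbolic /triple orderV xyE.
  apply: inv_sum_433; first exact: (ge4 _ _ _ _ d3).
    exact: ltnW (ge4 _ _ _ _ d4 tr4).
  exact: ltnW (ge4 _ _ _ _ d5 tr5).
have cop : coprime 2 N by rewrite coprime2n.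
have x'y'G : (x' * y')%g \in SL gl by rewrite groupM.
have nc_p (g' : gl) : (g' ^+ N = 1)%g -> no_conj x g'.
  by move=> g'N; apply: no_conj_coprime x2 g'N cop.
have nc_z (g g' : gl) v' l : g \in SL gl -> (forall v' l, ~ eigen v' g l) ->
    g' \in SL gl -> eigen v' g' l -> (g' ^+ N = 1)%g -> no_conj g g'.
  move=> gG nsg g'G ev g'N; apply: (no_conj_nonsplit gG g'G nsg ev (expg_order _) g'N).
  by rewrite NN orbT.
have xyG : (x * y)%g \in SL gl by rewrite groupM.
move=> g g'; rewrite !inE => /or3P[]/eqP -> /or3P[]/eqP ->;
  by [apply: nc_p | apply: nc_z _ _ _ ev1 _ | apply: nc_z _ _ _ ev2 _ | apply: nc_z _ _ _ ev3 _].
Qed.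

End EvenFields.

(** * The fields of order 7 and 9 *)

Section Computation.

Variables (m s : nat).
Hypothesis m_gt1 : (1 < m)%N.

(** A pair (a, b) stands for a + b i, where i^2 = s, modulo m. *)
Definition cnum := (nat * nat)%type.
Definition cadd (x y : cnum) : cnum := ((x.1 + y.1) %% m, (x.2 + y.2) %% m)%N.
Definition cmulc (x y : cnum) : cnum :=
  ((x.1 * y.1 + s * (x.2 * y.2)) %% m, (x.1 * y.2 + x.2 * y.1) %% m)%N.
Definition copp (x : cnum) : cnum := cmulc (m.-1, 0)%N x.
Definition cunit (x : cnum) : bool :=
  has (fun y => cmulc x y == (1, 0)%N) [seq (a, b) | a <- iota 0 m, b <- iota 0 m].

Definition cmat := (cnum * cnum * cnum * cnum)%type.
Definition cprod (M N : cmat) : cmat :=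
  let: (a, b, c, d) := M in let: (e, f, g, h) := N in
  (cadd (cmulc a e) (cmulc b g), cadd (cmulc a f) (cmulc b h),
   cadd (cmulc c e) (cmulc d g), cadd (cmulc c f) (cmulc d h)).
Definition cdet (M : cmat) : cnum :=
  let: (a, b, c, d) := M in cadd (cmulc a d) (copp (cmulc b c)).
Definition cid : cmat := ((1, 0), (0, 0), (0, 0), (1, 0))%N.
Definition cword (M N : cmat) (w : seq bool) : cmat :=
  foldr (fun l P => cprod (if l then M else N) P) cid w.
Definition ccommdet (M N : cmat) : cnum :=
  let: (a, b, c, d) := M in let: (e, f, g, h) := N in
  let sub x y := cadd x (copp y) in
  let u := sub (cmulc b g) (cmulc c f) in
  copp (cadd (cmulc u u)
   (cmulc (sub (cadd (cmulc a f) (cmulc b h)) (cadd (cmulc e b) (cmulc f d)))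
          (sub (cadd (cmulc c e) (cmulc d g)) (cadd (cmulc g a) (cmulc h c))))).

Variables (F : finFieldType) (gl : gl2 F) (i : F).
Local Notation sl := (@sl F gl).
Hypotheses (m0 : m%:R = 0 :> F) (i2 : i ^+ 2 = s%:R).

Definition cev (x : cnum) : F := x.1%:R + x.2%:R * i.

Lemma natr_modn n : (n %% m)%:R = n%:R :> F.
Proof. by rewrite [in RHS](divn_eq n m) natrD natrM m0 mulr0 add0r. Qed.

Lemma cevD x y : cev (cadd x y) = cev x + cev y.
Proof. by rewrite /cev /= !natr_modn !natrD; ring. Qed.

Lemma cevM x y : cev (cmulc x y) = cev x * cev y.
Proof. by rewrite /cev /= !natr_modn !natrD !natrM -i2; ring. Qed.

Lemma cevN x : cev (copp x) = - cev x.
Proof.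
rewrite /copp cevM {1}/cev /= mul0r addr0 -subn1 natrB 1?ltnW //.
by rewrite m0 sub0r mulN1r.
Qed.

Lemma cev0 : cev (0, 0)%N = 0. Proof. by rewrite /cev /= mul0r addr0. Qed.
Lemma cev1 : cev (1, 0)%N = 1. Proof. by rewrite /cev /= mul0r addr0. Qed.

Lemma cunit_neq0 x : cunit x -> cev x != 0.
Proof.
case/hasP=> y _ /eqP xy; have := cev1; rewrite -xy cevM => e.
by apply: contraTneq (oner_neq0 F) => x0; rewrite -e x0 mul0r eqxx.
Qed.

Definition cgl (M : cmat) : gl :=
  let: (a, b, c, d) := M in sl (cev a) (cev b) (cev c) (cev d).

Definition unimod (M : cmat) : Prop :=
  let: (a, b, c, d) := M in cev a * cev d - cev b * cev c = 1.

Lemma cdet_unimod M : cdet M == (1, 0)%N -> unimod M.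
Proof. by case: M => [[[a b] c] d] /eqP/(congr1 cev); rewrite /cdet cevD cevN !cevM cev1. Qed.

Lemma unimod_id : unimod cid.
Proof. by rewrite /unimod /cid cev0 cev1; ring. Qed.

Lemma unimod_prod M N : unimod M -> unimod N -> unimod (cprod M N).
Proof.
case: M N => [[[a b] c] d] [[[e f] g] h]; rewrite /unimod /cprod !cevD !cevM => d1 d2.
by rewrite -[RHS]mulr1 -{1}d1 -d2; ring.
Qed.

Lemma unimod_word M N w : unimod M -> unimod N -> unimod (cword M N w).
Proof.
move=> dM dN; elim: w => [|l w IHw]; first exact: unimod_id.
by apply: unimod_prod IHw; case: l.
Qed.

Lemma cgl_SL M : unimod M -> cgl M \in SL gl.
Proof. by case: M => [[[a b] c] d]; apply: sl_in. Qed.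

Lemma cgl_prod M N : unimod M -> unimod N -> (cgl M * cgl N)%g = cgl (cprod M N).
Proof.
case: M N => [[[a b] c] d] [[[e f] g] h] d1 d2.
by rewrite /cgl /cprod sl_mul // !cevD !cevM.
Qed.

Lemma cgl_id : cgl cid = 1%g.
Proof. by rewrite /cgl /cid cev0 cev1 sl1. Qed.

Lemma cgl_pow M n : unimod M -> (cgl M ^+ n)%g = cgl (cword M M (nseq n true)).
Proof.
move=> dM; elim: n => [|n IHn]; first by rewrite expg0 -cgl_id.
by rewrite expgS IHn cgl_prod //; apply: unimod_word.
Qed.

Lemma cgl_word (H : {group gl}) M N w : unimod M -> unimod N ->
  cgl M \in H -> cgl N \in H -> cgl (cword M N w) \in H.
Proof.
move=> dM dN MH NH; elim: w => [|l w IHw]; first by rewrite cgl_id.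
have dw := unimod_word w dM dN.
by case: l; rewrite -[cword _ _ _]/(cprod _ (cword M N w)) -cgl_prod // groupM.
Qed.

Lemma cgl_commdet M N : let: (a, b, c, d) := M in let: (e, f, g, h) := N in
  commdet (cev a) (cev b) (cev c) (cev d) (cev e) (cev f) (cev g) (cev h) = cev (ccommdet M N).
Proof.
case: M N => [[[a b] c] d] [[[e f] g] h].
by rewrite /ccommdet /commdet !(cevD, cevN, cevM); ring.
Qed.

(** For coprime exponents n and n' no conjugacy has to be examined. *)
Lemma computed_pair M N M' N' n n' r : 
    cdet M == (1, 0)%N -> cdet N == (1, 0)%N -> cdet M' == (1, 0)%N -> cdet N' == (1, 0)%N ->
    let powers k := [seq cword A A (nseq k true) | A <- [:: M; N; cprod M N]] in
    let powers' k := [seq cword A A (nseq k true) | A <- [:: M'; N'; cprod M' N']] in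
    all (pred1 cid) (powers n) -> all (pred1 cid) (powers' n') -> coprime n n' ->
    cunit r -> cmulc (ccommdet M N) (ccommdet M' N') == cmulc r r ->
    SL gl \subset <<[set cgl M; cgl N]>>%g -> SL gl \subset <<[set cgl M'; cgl N']>>%g ->
    hyperbolic (triple (cgl M) (cgl N)) -> hyperbolic (triple (cgl M') (cgl N')) ->
  admits_strongly_real_Beauville_structure (SL_group gl).
Proof.
move=> /cdet_unimod uM /cdet_unimod uN /cdet_unimod uM' /cdet_unimod uN' powers powers'.
rewrite /powers /powers' /= !andbT => /and3P[/eqP pM /eqP pN /eqP pMN] /and3P[/eqP pM' /eqP pN' /eqP pMN'].
move=> cop /cunit_neq0 r0 /eqP er gen gen' hyp hyp'.
exists (triple (cgl M) (cgl N)), (triple (cgl M') (cgl N')); split; last first.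
  move: er => /(congr1 cev); rewrite !cevM => er.
  have := cgl_commdet M N; have := cgl_commdet M' N'.
  case: M N M' N' uM uN uM' uN' er {pM pN pMN pM' pN' pMN' gen gen' hyp hyp' powers powers'} =>
    [[[a b] c] d] [[[e f] g] h] [[[a' b'] c'] d'] [[[e' f'] g'] h'] uM uN uM' uN' er e1 e2.
  by apply: (@strongly_real_pair _ _ _ _ _ _ _ _ _ _ _ _ _ _ _ _ _ _ (cev r)) => //; rewrite e1 e2 er expr2.
have uMN := unimod_prod uM uN; have uMN' := unimod_prod uM' uN'.
apply: Beauville_pair; rewrite ?cgl_SL // !cgl_prod //.
have expM A k : unimod A -> cword A A (nseq k true) = cid -> (cgl A ^+ k = 1)%g.
  by move=> uA pA; rewrite cgl_pow // pA cgl_id.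
move=> x y; rewrite !inE => /or3P[]/eqP -> /or3P[]/eqP ->;
  by apply: no_conj_coprime cop; apply: expM.
Qed.

Lemma order_prime_power M a b : unimod M -> prime b ->
    cword M M (nseq (b ^ a.+1) true) == cid ->
    (let: (p, q, r, t) := cword M M (nseq (b ^ a) true) in
      cunit (cadd p (m.-1, 0)%N) || cunit q || cunit r) ->
  #[cgl M]%g = (b ^ a.+1)%N.
Proof.
move=> uM b_pr /eqP p1 p2.
have x1 : (cgl M ^+ (b ^ a.+1) = 1)%g by rewrite cgl_pow // p1 cgl_id.
have x2 : (cgl M ^+ (b ^ a) != 1)%g.
  have := unimod_word (nseq (b ^ a) true) uM uM.
  rewrite cgl_pow //; case: (cword M M _) p2 => [[[p q] r] t] p2 u.
  have p0 : [|| cev (cadd p (m.-1, 0)%N) != 0, cev q != 0 | cev r != 0].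
    by case/orP: p2 => [/orP[]|] /cunit_neq0 ->; rewrite ?orbT.
  apply: contraTneq p0; rewrite -sl1 => /sl_inj[] //; first by ring.
  move=> ep -> -> _; rewrite eqxx cevD ep {1}/cev /= mul0r addr0 -subn1 natrB 1?ltnW //.
  by rewrite m0 sub0r addrN eqxx.
have : (#[cgl M]%g %| b ^ a.+1)%N by rewrite order_dvdn x1.
case/(dvdn_pfactor _ _ b_pr) => j; rewrite leq_eqVlt ltnS => /orP[/eqP -> //|le_j eo].
by move: x2; rewrite -order_dvdn eo dvdn_exp2l.
Qed.

End Computation.

Section SmallFields.

Variables (F : finFieldType) (gl : gl2 F).
Local Notation sl := (@sl F gl).
Local Notation transv := (@transv F gl).

Lemma tv_prime_full (H : {group gl}) v a h : prime #|F| -> H \subset SL gl -> a != 0 ->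
  transv v a \in H -> h \in H -> wedge v (vact v h) != 0 -> SL gl \subset H.
Proof.
move=> q_pr sHG a0 aH hH nz; apply: (tv_full sHG _ hH nz).
exact: (stretch_full a0 aH (subring_prime q_pr (stretch_subring H v))).
Qed.

(** The orders are 7, 7, 3 and 8, 8, 8; over a prime field one transvection is
    enough.  In the second group x y^-1 is the opposite of a transvection, and
    y^-1 is reached as y^7. *)
Lemma admits_7 : #|F| = 7 -> admits_strongly_real_Beauville_structure (SL_group gl).
Proof.
move=> q7; have m0 : 7%:R = 0 :> F := pcharF (isT : prime 7) (q7 : #|F| = 7 ^ 1)%N.
have i2 : (0 : F) ^+ 2 = 0%:R by rewrite expr0n.
have q_pr : prime #|F| by rewrite q7.
have nz k : (0 < k < 7)%N -> k%:R != 0 :> F.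
  move=> hk; have := @cunit_neq0 7 0 _ _ m0 i2 (k, 0)%N; rewrite /cev /= mul0r addr0; apply.
  by case: k hk => [|[|[|[|[|[|[|k]]]]]]].
pose M : cmat := ((1, 0), (1, 0), (0, 0), (1, 0))%N.
pose N : cmat := ((1, 0), (0, 0), (4, 0), (1, 0))%N.
pose M' : cmat := ((0, 0), (6, 0), (1, 0), (3, 0))%N.
pose N' : cmat := ((1, 0), (2, 0), (4, 0), (2, 0))%N.
pose ev : cmat -> gl := @cgl F gl 0.
have uM : unimod (0 : F) M by apply: (@cdet_unimod 7 0 isT _ _ m0 i2).
have uN : unimod (0 : F) N by apply: (@cdet_unimod 7 0 isT _ _ m0 i2).
have uM' : unimod (0 : F) M' by apply: (@cdet_unimod 7 0 isT _ _ m0 i2).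
have uN' : unimod (0 : F) N' by apply: (@cdet_unimod 7 0 isT _ _ m0 i2).
have sG A B : unimod (0 : F) A -> unimod (0 : F) B -> <<[set ev A; ev B]>>%g \subset SL gl.
  by move=> uA uB; apply: gen_sub; apply: cgl_SL.
have inl A B : ev A \in <<[set ev A; ev B]>>%g by rewrite mem_gen // !inE eqxx.
have inr A B : ev B \in <<[set ev A; ev B]>>%g by rewrite mem_gen // !inE eqxx orbT.
have ev0 k : cev (0 : F) (k, 0)%N = k%:R by rewrite /cev /= mul0r addr0.
apply: (@computed_pair 7 0 isT F gl 0 m0 i2 M N M' N' 21 8 (4, 0)%N); [by vm_compute | by vm_compute | by vm_compute | by vm_compute | by vm_compute |
    by vm_compute | by vm_compute | by vm_compute | by vm_compute | | | | ].
- apply: (@tv_prime_full _ (0, 1) 1 (ev N) q_pr (sG _ _ uM uN)) (inr _ _) _ => //.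
  + exact: oner_neq0.
  + have -> : transv (0, 1) 1 = ev M by rewrite /transv /ev /cgl /M !ev0 /=; congr sl; ring.
    exact: inl.
  + rewrite /ev /cgl /N !ev0 vact_sl /wedge /=; last by ring.
    have -> : 0 * (0 * 0%:R + 1 * 1%:R) - 1 * (0 * 1%:R + 1 * 4%:R) = 3%:R - 7%:R :> F by ring.
    by rewrite m0 subr0 nz.
- apply: (@tv_prime_full _ (2%:R, 1) 2%:R (ev M') q_pr (sG _ _ uM' uN')) (inl _ _) _.
  + exact: nz.
  + pose wd := [:: true] ++ nseq 7 false ++ [:: true] ++ nseq 7 false.
    suff <- : ev (cword 7 0 M' N' wd) = transv (2%:R, 1) 2%:R.
      exact: (cgl_word m0 i2 wd uM' uN' (inl M' N') (inr M' N')).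
    have -> : cword 7 0 M' N' wd = ((5, 0), (2, 0), (6, 0), (4, 0))%N by vm_compute.
    rewrite /ev /cgl !ev0 /transv /=.
    have -> : 6%:R = - 2%:R * 2%:R ^+ 2 :> F by rewrite -[RHS]addr0 -(mulr0 2%:R) -m0; ring.
    have -> : 4%:R = 1 - 2%:R * 2%:R * 1 :> F by rewrite -[RHS]addr0 -m0; ring.
    by congr sl; ring.
  rewrite /ev /cgl /M' !ev0 vact_sl /wedge /=; last by rewrite -[RHS]addr0 -(mulr0 (-1)) -m0; ring.
  have -> : 2%:R * (2%:R * 6%:R + 1 * 3%:R) - 1 * (2%:R * 0%:R + 1 * 1%:R) = 7%:R * 4%:R + 1 :> F by ring.
  by rewrite m0 mul0r add0r oner_eq0.
- rewrite /hyperbolic /triple orderV (@cgl_prod 7 0 F gl 0 m0 i2) //.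
  apply: inv_sum_433.
  + by rewrite (@order_prime_power 7 0 isT F gl 0 m0 i2 M 0 7).
  + by rewrite (@order_prime_power 7 0 isT F gl 0 m0 i2 N 0 7).
  + rewrite (@order_prime_power 7 0 isT F gl 0 m0 i2 (cprod 7 0 M N) 0 3) //.
    exact: unimod_prod.
rewrite /hyperbolic /triple orderV (@cgl_prod 7 0 F gl 0 m0 i2) //.
apply: inv_sum_433.
- by rewrite (@order_prime_power 7 0 isT F gl 0 m0 i2 M' 2 2).
- by rewrite (@order_prime_power 7 0 isT F gl 0 m0 i2 N' 2 2).
rewrite (@order_prime_power 7 0 isT F gl 0 m0 i2 (cprod 7 0 M' N') 2 2) //.
exact: unimod_prod.
Qed.

(** The orders are 5, 5, 5 and 8, 8, 8.  In each group two short words are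
    transvections with the same centre, whose parameters span the field over its
    prime field. *)
Lemma admits_9 : #|F| = 9 -> admits_strongly_real_Beauville_structure (SL_group gl).
Proof.
move=> q9; have m0 : 3%:R = 0 :> F := pcharF (isT : prime 3) (q9 : #|F| = 3 ^ 2)%N.
have [i i2] : exists i : F, i ^+ 2 = 2%:R.
  have [g gP] := primitive_element F; rewrite q9 /= in gP.
  exists (g ^+ 2); have : (g ^+ 4 - 1) * (g ^+ 4 + 1) == 0.
    have -> : (g ^+ 4 - 1) * (g ^+ 4 + 1) = g ^+ 8 - 1 by ring.
    by rewrite (prim_expr_order gP) subrr.
  rewrite mulf_eq0 subr_eq0 -(prim_order_dvd gP) addr_eq0 /= => /eqP g4.
  by rewrite -exprM g4 -[LHS]addr0 -m0; ring.
have Fij z : exists a b : nat, z = a%:R + b%:R * i.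
  pose f (u : 'I_3 * 'I_3) : F := cev i (u.1 : nat, u.2 : nat).
  have inj : injective f.
    move=> [x y] [x' y'] /= e; apply/eqP; rewrite xpair_eqE -!val_eqE /=.
    have : cev i (cadd 3 (x : nat, y : nat) (copp 3 2 (x' : nat, y' : nat))) = 0.
      by rewrite (cevD i m0) (cevN (isT : 1 < 3)%N m0 i2) // -[cev i (x : nat, y : nat)]/(f (x, y)) e subrr.
    apply: contra_eqT => ne; apply: (cunit_neq0 m0 i2).
    move: (nat_of_ord x) (nat_of_ord y) (nat_of_ord x') (nat_of_ord y')
      (ltn_ord x) (ltn_ord y) (ltn_ord x') (ltn_ord y') ne => {x y x' y' e}.
    by do 4![move=> [|[|[|?]]]] => //= _ _ _ _; vm_compute.
  have bij : bijective f by apply: inj_card_bij => //; rewrite card_prod !card_ord q9.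
  by have [f' _ fK] := bij; exists (f' z).1, (f' z).2; rewrite -[LHS]fK.
pose M : cmat := ((0, 0), (2, 0), (1, 0), (1, 1))%N.
pose N : cmat := ((0, 2), (0, 2), (1, 1), (1, 2))%N.
pose M' : cmat := ((0, 0), (2, 0), (1, 0), (0, 1))%N.
pose N' : cmat := ((0, 1), (1, 2), (1, 1), (0, 0))%N.
pose ev : cmat -> gl := @cgl F gl i.
have uM : unimod i M by apply: (@cdet_unimod 3 2 isT _ _ m0 i2).
have uN : unimod i N by apply: (@cdet_unimod 3 2 isT _ _ m0 i2).
have uM' : unimod i M' by apply: (@cdet_unimod 3 2 isT _ _ m0 i2).
have uN' : unimod i N' by apply: (@cdet_unimod 3 2 isT _ _ m0 i2).
have sG A B : unimod i A -> unimod i B -> <<[set ev A; ev B]>>%g \subset SL gl.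
  by move=> uA uB; apply: gen_sub; apply: cgl_SL.
have inl A B : ev A \in <<[set ev A; ev B]>>%g by rewrite mem_gen // !inE eqxx.
have inr A B : ev B \in <<[set ev A; ev B]>>%g by rewrite mem_gen // !inE eqxx orbT.
have gen A B v h : unimod i A -> unimod i B -> let H := <<[set ev A; ev B]>>%g in
    transv v 1 \in H -> transv v i \in H -> h \in H -> wedge v (vact v h) != 0 -> SL gl \subset H.
  move=> uA uB H H1 Hi hH; apply: (tv_full (sG _ _ uA uB) _ hH) => z.
  have [a [b ->]] := Fij z.
  by rewrite -tvD mulr_natl -!tvX groupM ?groupX.
have word A B w : unimod i A -> unimod i B -> ev (cword 3 2 A B w) \in <<[set ev A; ev B]>>%g.
  by move=> uA uB; apply: (cgl_word m0 i2 w uA uB (inl A B) (inr A B)).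
have two : -1 = 2%:R :> F by rewrite -[LHS]addr0 -m0; ring.
apply: (@computed_pair 3 2 isT F gl i m0 i2 M N M' N' 5 8 (1, 0)%N); [by vm_compute | by vm_compute | by vm_compute | by vm_compute | by vm_compute |
    by vm_compute | by vm_compute | by vm_compute | by vm_compute | | | | ].
- apply: (gen M N (1, 0) (ev M)) => //.
  + have := word M N [:: false; false; false; true; true; true; false; true] uM uN.
    have -> : cword 3 2 M N [:: false; false; false; true; true; true; false; true] =
      ((1, 0), (0, 0), (1, 0), (1, 0))%N by vm_compute.
    rewrite -groupV.
    have -> : ev ((1, 0), (0, 0), (1, 0), (1, 0))%N = transv (1, 0) (-1).
      by rewrite /ev /cgl /transv /cev /=; congr sl; ring.
    by rewrite tvV opprK.
  + have := word M N [:: true; true; false; true; false; false; false; true] uM uN.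
    have -> : cword 3 2 M N [:: true; true; false; true; false; false; false; true] =
      ((1, 0), (0, 0), (0, 1), (1, 0))%N by vm_compute.
    rewrite -groupV.
    have -> : ev ((1, 0), (0, 0), (0, 1), (1, 0))%N = transv (1, 0) (- i).
      by rewrite /ev /cgl /transv /cev /=; congr sl; ring.
    by rewrite tvV opprK.
  rewrite /ev /cgl /M vact_sl // /wedge /cev /=.
  set X := (X in X != 0); have -> : X = 2%:R by rewrite /X; ring.
  by rewrite -two oppr_eq0 oner_neq0.
- have w1 := word M' N' [:: true; false; true; true; false; false; false] uM' uN'.
  have w2 := word M' N' [:: true; true; true; false; true; false; false] uM' uN'.
  have e1 : ev (cword 3 2 M' N' [:: true; false; true; true; false; false; false]) = transv (0, 1) i.
    have -> : cword 3 2 M' N' [:: true; false; true; true; false; false; false] =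
      ((1, 0), (0, 1), (0, 0), (1, 0))%N by vm_compute.
    by rewrite /ev /cgl /transv /cev /=; congr sl; ring.
  have e2 : ev (cword 3 2 M' N' [:: true; true; true; false; true; false; false]) = transv (0, 1) (2%:R + i).
    have -> : cword 3 2 M' N' [:: true; true; true; false; true; false; false] =
      ((1, 0), (2, 1), (0, 0), (1, 0))%N by vm_compute.
    by rewrite /ev /cgl /transv /cev /=; congr sl; ring.
  rewrite e1 in w1; rewrite e2 in w2.
  apply: (gen M' N' (0, 1) (ev M')) => //.
  have := groupX 2 (groupM (groupM w1 w1) w2).
  have one : (i + i + (2%:R + i)) *+ 2 = 1.
    by rewrite -mulr_natl -[RHS]addr0 -(mulr0 (2%:R * i + 1)) -m0; ring.
  by rewrite !tvD tvX one.
  rewrite /ev /cgl /M' vact_sl // /wedge /cev /=.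
  set X := (X in X != 0); have -> : X = -1 by rewrite /X; ring.
  by rewrite oppr_eq0 oner_neq0.
- rewrite /hyperbolic /triple orderV (@cgl_prod 3 2 F gl i m0 i2) //.
  apply: inv_sum_433.
  + by rewrite (@order_prime_power 3 2 isT F gl i m0 i2 M 0 5).
  + by rewrite (@order_prime_power 3 2 isT F gl i m0 i2 N 0 5).
  + rewrite (@order_prime_power 3 2 isT F gl i m0 i2 (cprod 3 2 M N) 0 5) //.
    exact: unimod_prod.
rewrite /hyperbolic /triple orderV (@cgl_prod 3 2 F gl i m0 i2) //.
apply: inv_sum_433.
- by rewrite (@order_prime_power 3 2 isT F gl i m0 i2 M' 2 2).
- by rewrite (@order_prime_power 3 2 isT F gl i m0 i2 N' 2 2).
rewrite (@order_prime_power 3 2 isT F gl i m0 i2 (cprod 3 2 M' N') 2 2) //.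
exact: unimod_prod.
Qed.

End SmallFields.

(** * Fields of order at most 5 *)

Section SmallOrders.
Import Order.TTheory Num.Theory.

Variable gT : finGroupType.
Implicit Types (x y z : gT).

Lemma hyperbolic_order_gt3 x y z : hyperbolic (x, y, z) ->
  exists2 a, a \in [:: x; y; z] & (3 < #[a])%N.
Proof.
rewrite /hyperbolic => hyp; apply/hasP; apply: contraTT hyp => /hasPn small.
have inv_ge a : a \in [:: x; y; z] -> (3%:R^-1 <= #[a]%g%:R^-1 :> rat).
  move=> /small; rewrite -leqNgt => le3.
  by rewrite lef_pV2 ?ler_nat // posrE ltr0n // order_gt0.
have lx := inv_ge x; have ly := inv_ge y; have lz := inv_ge z.
move: lx ly lz; rewrite !inE !eqxx !orbT => /(_ isT) lx /(_ isT) ly /(_ isT) lz.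
rewrite -leNgt; lra.
Qed.

Lemma hyperbolic_neq1 x y z : hyperbolic (x, y, z) -> 1%g \notin [:: x; y; z].
Proof.
rewrite /hyperbolic !inE => hyp.
have inv_ge0 (a : gT) : (0 <= #[a]%g%:R^-1 :> rat) by rewrite invr_ge0 ler0n.
have gx := inv_ge0 x; have gy := inv_ge0 y; have gz := inv_ge0 z.
apply/negP=> /or3P[]/eqP e1; move: hyp gx gy gz; rewrite -e1 order1 invr1; lra.
Qed.

Lemma no_conjugate_powers_sym (G : {group gT}) t1 t2 :
  no_conjugate_powers G t1 t2 -> no_conjugate_powers G t2 t1.
Proof.
move=> nc a b aE bE u v ua vb u1; apply/imsetP=> -[g gG ev].
have v1 : v != 1%g by rewrite ev conjg_eq1.
case/imsetP: (nc b a bE aE v u vb ua v1); exists g^-1%g; rewrite ?groupV //.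
by rewrite ev conjgK.
Qed.

(** The subgroups of order r are Sylow subgroups. *)
Lemma no_conjugate_powers_prime (G : {group gT}) t1 t2 r a b : prime r ->
    (logn r #|G| <= 1)%N -> no_conjugate_powers G t1 t2 ->
    a \in G -> b \in G -> a \in entries t1 -> b \in entries t2 ->
  (r %| #[a])%N -> (r %| #[b])%N -> False.
Proof.
move=> r_pr logG nc aG bG aE bE ra rb.
pose u := (a ^+ (#[a] %/ r))%g; pose v := (b ^+ (#[b] %/ r))%g.
have ord (c : gT) : (r %| #[c])%N -> #[(c ^+ (#[c] %/ r))%g] = r.
  by move=> rc; rewrite orderXdiv ?dvdn_div // divnA // mulKn.
have sylow (c : gT) : c \in G -> #[c] = r -> r.-Sylow(G) <[c]>%g.
  move=> cG oc; rewrite pHallE cycle_subG cG /= -orderE oc p_part.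
  have : (r ^ 1 %| #|G|)%N by rewrite expn1 -oc order_dvdG.
  rewrite pfactor_dvdn // => logG1.
  by have /eqP -> : logn r #|G| == 1%N; [rewrite eqn_leq logG | rewrite expn1].
have uG : u \in G by rewrite groupX.
have vG : v \in G by rewrite groupX.
have [g gG eg] := Sylow_trans (sylow u uG (ord a ra)) (sylow v vG (ord b rb)).
have /imsetP[w wu ew] : v \in (<[u]> :^ g)%g by rewrite -eg cycle_id.
have v1 : v != 1%g by rewrite -order_eq1 ord // (gtn_eqF (prime_gt1 r_pr)).
have w1 : w != 1%g by apply: contraNneq v1 => w1; rewrite ew w1 conj1g.
have sub_u : w \in <[a]>%g.
  by apply: subsetP wu; rewrite cycle_subG groupX ?cycle_id.
have vb : v \in <[b]>%g by rewrite groupX ?cycle_id.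
have /negP[] := nc a b aE bE w v sub_u vb w1.
by rewrite ew; apply/imsetP; exists g.
Qed.

End SmallOrders.

Section Obstructions.

Variables (F : finFieldType) (gl : gl2 F).
Local Notation sl := (@sl F gl).
Implicit Types (a b c d e f g h k s : F) (x y z : gl).

Let m1 := sl (-1) 0 0 (-1).

Lemma m1_det : -1 * -1 - 0 * 0 = 1 :> F. Proof. by ring. Qed.

Lemma m1_sqr : (m1 ^+ 2 = 1)%g.
Proof. by rewrite expgS expg1 /m1 sl_mul ?m1_det // -sl1; congr sl; ring. Qed.

Lemma sl_sqr p q r s t : p * s - q * r = 1 -> p + s = t ->
  (sl p q r s ^+ 2 = sl (t * p - 1) (t * q) (t * r) (t * s - 1))%g.
Proof.
move=> det1 <-; rewrite expgS expg1 sl_mul //; congr sl; rewrite -?det1; ring.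
Qed.

Lemma sl_sqr_det p q r s t : p * s - q * r = 1 -> p + s = t ->
  (t * p - 1) * (t * s - 1) - (t * q) * (t * r) = 1.
Proof.
move=> det1 tr; have -> : (t * p - 1) * (t * s - 1) - (t * q) * (t * r) =
  t ^+ 2 * (p * s - q * r) - t * (p + s) + 1 by ring.
by rewrite det1 tr; ring.
Qed.

Lemma trace0_expg p q r s : p * s - q * r = 1 -> p + s = 0 -> (sl p q r s ^+ 2 = m1)%g.
Proof. by move=> det1 tr; rewrite (sl_sqr det1 tr); congr sl; ring. Qed.

Lemma traceN1_expg p q r s : p * s - q * r = 1 -> p + s = -1 -> (sl p q r s ^+ 3 = 1)%g.
Proof.
move=> det1 tr; apply: (mulIg (sl p q r s)^-1%g).
rewrite mul1g expgSr mulgK (sl_sqr det1 tr) sl_inv //.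
have sE : s = -1 - p by rewrite -tr addrC addKr.
by congr sl; rewrite ?sE; ring.
Qed.

Lemma m1_mul p q r s : p * s - q * r = 1 -> (m1 * sl p q r s)%g = sl (- p) (- q) (- r) (- s).
Proof. by move=> det1; rewrite /m1 sl_mul ?m1_det //; congr sl; ring. Qed.

Lemma oppr_det p q r s : p * s - q * r = 1 -> (- p) * (- s) - (- q) * (- r) = 1.
Proof. by move=> <-; ring. Qed.

Lemma m1_central x : x \in SL gl -> commute m1 x.
Proof.
case/SLE=> [p [q [r [s [det1 ->]]]]]; rewrite /commute m1_mul // /m1 sl_mul ?m1_det //.
by congr sl; ring.
Qed.

Lemma opp_expg p q r s n : p * s - q * r = 1 -> (sl (- p) (- q) (- r) (- s) ^+ n = 1)%g ->
  (sl p q r s ^+ n = m1 ^+ n)%g.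
Proof.
move=> det1; rewrite -m1_mul // expgMn; last exact/m1_central/sl_in.
by move/(congr1 (mulg (m1 ^+ n)%g)); rewrite mulgA -expgMn // -expg2 m1_sqr expg1n mul1g mulg1.
Qed.

(** The fifth cyclotomic polynomial is a polynomial in X + X^-1, which vanishes
    where X + X^-1 satisfies t^2 + t = 1. *)
Lemma trace_golden_expg p q r s t : p * s - q * r = 1 -> p + s = t -> t ^+ 2 + t = 1 ->
  (sl p q r s ^+ 5 = 1)%g.
Proof.
move=> det1 tr t2; apply: (mulIg (sl p q r s)^-1%g).
rewrite mul1g expgSr mulgK -[4%N]/(2 * 2)%N expgM (sl_sqr det1 tr).
have det2 := sl_sqr_det det1 tr.
have tr2 : t * p - 1 + (t * s - 1) = t ^+ 2 - 2%:R by rewrite -tr; ring.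
rewrite (sl_sqr det2 tr2) sl_inv //.
have t2E : t ^+ 2 = 1 - t by rewrite -t2 addrK.
have sE : s = t - p by rewrite -tr addrC addKr.
have tt : (t ^+ 2 - 2%:R) * t = -1.
  have -> : (t ^+ 2 - 2%:R) * t = t ^+ 2 * t - 2%:R * t by ring.
  rewrite t2E; have -> : (1 - t) * t - 2%:R * t = - t - t ^+ 2 by ring.
  by rewrite t2E; ring.
by congr sl; rewrite ?sE ?mulrBr ?mulrA ?tt ?t2E; ring.
Qed.

Lemma SL_not_abelian : ~~ abelian (SL gl).
Proof.
apply/negP=> /centsP ab.
have d1 : 1 * 1 - 1 * 0 = 1 :> F by ring.
have d2 : 1 * 1 - 0 * 1 = 1 :> F by ring.
have := ab _ (sl_in gl d1) _ (sl_in gl d2).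
rewrite /commute !sl_mul // => /(congr1 (@gmx _ _)); rewrite !sl_val; try ring.
by move=> /mx2_inj[/eqP + _ _ _]; rewrite -subr_eq0; set X := (X in X == 0);
  have -> : X = 1 by [rewrite /X; ring]; rewrite oner_eq0.
Qed.

Lemma generating_not_commute x y z : generating_triple (SL_group gl) (x, y, z) ->
  (x * y * z = 1)%g -> ~ commute x y.
Proof.
rewrite /generating_triple /= => gen xyz cxy; have /negP := SL_not_abelian; apply.
have ze : z = (x * y)^-1%g by apply: (mulgI (x * y)%g); rewrite xyz mulgV.
have genE : <<[set x; y; z]>>%g = SL gl := gen.
rewrite -genE abelian_gen.
have cxz : commute x z by rewrite ze; apply/commuteV/commuteM.
have cyz : commute y z by rewrite ze; apply/commuteV/commuteM => //; apply: commute_sym.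
apply/centsP=> u uE v vE; move: uE vE; rewrite !inE -!orbA => /or3P[]/eqP -> /or3P[]/eqP -> //;
  by apply: commute_sym.
Qed.

(** For unipotent elements 1 + A and 1 + B, the product has trace 2 only if
    tr (A B) = 0, that is, if the nilpotents A and B are proportional. *)
Lemma trace2_commute a b c d e f g h : 2%:R != 0 :> F ->
    a * d - b * c = 1 -> e * h - f * g = 1 -> a + d = 2%:R -> e + h = 2%:R ->
    a * e + b * g + (c * f + d * h) = 2%:R ->
  commute (sl a b c d) (sl e f g h).
Proof.
move=> c2 d1 d2 t1 t2 t3; pose n := a - 1; pose m := e - 1.
have aE : a = 1 + n by rewrite /n; ring.
have eE : e = 1 + m by rewrite /m; ring.
have dE : d = 1 - n by rewrite /n; have -> : d = 2%:R - a by [rewrite -t1 addrC addKr]; ring.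
have hE : h = 1 - m by rewrite /m; have -> : h = 2%:R - e by [rewrite -t2 addrC addKr]; ring.
have n2 : n ^+ 2 = - (b * c).
  by apply/eqP; rewrite -subr_eq0; move/eqP: d1; rewrite -subr_eq0 -oppr_eq0 aE dE => /eqP d1; apply/eqP; rewrite -[RHS]d1; ring.
have m2 : m ^+ 2 = - (f * g).
  by apply/eqP; rewrite -subr_eq0; move/eqP: d2; rewrite -subr_eq0 -oppr_eq0 eE hE => /eqP d2; apply/eqP; rewrite -[RHS]d2; ring.
have nm : 2%:R * n * m = - (b * g + c * f).
  by apply/eqP; rewrite -subr_eq0; move/eqP: t3; rewrite -subr_eq0 aE dE eE hE => /eqP t3; apply/eqP; rewrite -[RHS]t3; ring.
have sq0 (z : F) : z ^+ 2 = 0 -> z = 0 by move/eqP; rewrite sqrf_eq0 => /eqP.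
have e1 : b * g - c * f = 0.
  apply: sq0; have -> : (b * g - c * f) ^+ 2 = (- (b * g + c * f)) ^+ 2 - 4%:R * (- (b * c)) * (- (f * g)) by ring.
  by rewrite -nm -n2 -m2; ring.
have e2 : n * f - m * b = 0.
  apply: sq0; have -> : (n * f - m * b) ^+ 2 = n ^+ 2 * f ^+ 2 + m ^+ 2 * b ^+ 2 - (2%:R * n * m) * (f * b) by ring.
  by rewrite n2 m2 nm; ring.
have e3 : n * g - m * c = 0.
  apply: sq0; have -> : (n * g - m * c) ^+ 2 = n ^+ 2 * g ^+ 2 + m ^+ 2 * c ^+ 2 - (2%:R * n * m) * (g * c) by ring.
  by rewrite n2 m2 nm; ring.
rewrite /commute !sl_mul //; congr sl; apply/eqP; rewrite -subr_eq0; apply/eqP; rewrite ?aE ?dE ?eE ?hE.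
- by rewrite -[RHS]e1; ring.
- by rewrite -[RHS](mulr0 2%:R) -e2; ring.
- by rewrite -[RHS](mulr0 (- 2%:R)) -e3; ring.
- by rewrite -[RHS]oppr0 -e1; ring.
Qed.

(** A triple of elements of order 4 generates a quaternion group, whose
    elements invert or centralize y. *)
Lemma trace0_not_generating x y z : 2%:R != 0 :> F -> x \in SL gl -> y \in SL gl ->
    (x ^+ 2 = m1)%g -> (y ^+ 2 = m1)%g -> (z ^+ 2 = m1)%g -> (x * y * z = 1)%g ->
  ~ generating_triple (SL_group gl) (x, y, z).
Proof.
move=> c2 xG yG x2 y2 z2 xyz; rewrite /generating_triple /= => gen.
have ze : z = (x * y)^-1%g by apply: (mulgI (x * y)%g); rewrite xyz mulgV.
have m1V : (m1^-1 = m1)%g by apply: (mulgI m1); rewrite mulgV -expg2 m1_sqr.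
have xy2 : ((x * y) ^+ 2 = m1)%g by rewrite -m1V -z2 ze expgVn invgK.
have yx : (y ^ x = y^-1)%g.
  apply: (mulgI x); rewrite -conjgC; apply: (mulIg y); rewrite mulgKV.
  apply: (mulgI x); rewrite -[RHS]expg2 x2 -xy2 expg2 !mulgA //.
have yV2 : ((y^-1) ^ x = y)%g by rewrite conjVg yx invgK.
pose Y := [set y; y^-1%g].
have inN w : (y ^ w)%g \in Y -> w \in 'N(Y)%g.
  rewrite inE => yw; rewrite inE; apply/subsetP=> _ /imsetP[v + ->].
  rewrite inE => /orP[]/set1P ->; rewrite ?conjVg;
    by case/orP: yw => /set1P ->; rewrite ?invgK !inE eqxx ?orbT.
have xN : x \in 'N(Y)%g by apply: inN; rewrite yx !inE eqxx orbT.
have yN : y \in 'N(Y)%g by apply: inN; rewrite conjgE mulKg !inE eqxx.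
have genE : <<[set x; y; z]>>%g = SL gl := gen.
have norm w : w \in SL gl -> (y ^ w)%g \in Y.
  have sub : SL gl \subset 'N(Y)%g.
    by rewrite -genE gen_subG !subUset !sub1set xN yN ze groupV groupM.
  by move=> wG; rewrite (memJ_norm _ (subsetP sub w wG)) !inE eqxx.
have [p [q [r [s [det1 ey]]]]] := SLE yG.
have du : 1 * 1 - 1 * 0 = 1 :> F by ring.
have trp : p + s = 0.
  move: y2; rewrite ey (sl_sqr det1 (erefl _)) => /(congr1 (@gmx _ _)).
  rewrite !sl_val ?m1_det ?(sl_sqr_det det1 (erefl _)) // => /mx2_inj[e1 e2 e3 e4].
  apply/eqP; apply: contraTT c2 => t0; rewrite negbK.
  have q0 : q = 0 by apply/eqP; move/eqP: e2; rewrite mulf_eq0 (negPf t0).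
  have tp : (p + s) * p = 0 by apply: (addIr (-1)); rewrite e1 add0r.
  have p0 : p = 0 by apply/eqP; move/eqP: tp; rewrite mulf_eq0 (negPf t0).
  by move: det1; rewrite p0 q0 !mul0r subrr => /eqP; rewrite eq_sym oner_eq0.
have sE : s = - p by apply/eqP; rewrite -addr_eq0 addrC trp.
have := norm _ (sl_in gl du); rewrite !inE => /orP[]/eqP yu.
  have : (y * sl 1 1 0 1 = sl 1 1 0 1 * y)%g by rewrite conjgC yu.
  rewrite ey => /(congr1 (@gmx _ _)); rewrite !gmxM !sl_val // !mx2_mul => /mx2_inj[e1 e2 _ _].
  have r0 : r = 0 by apply: (addrI p); rewrite addr0; transitivity (1 * p + 1 * r); [ring | rewrite -e1; ring].
  have p0 : p = 0.
    have : 2%:R * p = (p * 1 + q * 1) - (1 * q + 1 * s) by rewrite sE; ring.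
    by rewrite e2 subrr => /eqP; rewrite mulf_eq0 (negPf c2) => /eqP.
  by move: det1; rewrite p0 r0 mul0r mulr0 subrr => /eqP; rewrite eq_sym oner_eq0.
have : (y * sl 1 1 0 1 = sl 1 1 0 1 * y^-1)%g by rewrite conjgC yu.
have detV : s * p - - q * - r = 1 by rewrite -det1; ring.
rewrite ey sl_inv // => /(congr1 (@gmx _ _)); rewrite !gmxM !sl_val // !mx2_mul => /mx2_inj[e1 _ e3 _].
have r0 : r = 0.
  have : 2%:R * r = (r * 1 + s * 0) - (0 * s + 1 * - r) by ring.
  by rewrite e3 subrr => /eqP; rewrite mulf_eq0 (negPf c2) => /eqP.
have p0 : p = 0.
  have : 2%:R * p = (p * 1 + q * 0) - (1 * s + 1 * - r) by rewrite sE r0; ring.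
  by rewrite e1 subrr => /eqP; rewrite mulf_eq0 (negPf c2) => /eqP.
by move: det1; rewrite p0 r0 mul0r mulr0 subrr => /eqP; rewrite eq_sym oner_eq0.
Qed.

End Obstructions.

Section NonExistence.

Variables (F : finFieldType) (gl : gl2 F).
Local Notation sl := (@sl F gl).
Local Notation m1 := (sl (-1) 0 0 (-1)).
Implicit Types (a b c d e f g h k s : F) (x y z : gl).

Definition gtr x : F := gmx x 0 0 + gmx x 1 1.

Lemma gtr_sl p q r s : p * s - q * r = 1 -> gtr (sl p q r s) = p + s.
Proof. by move=> det1; rewrite /gtr sl_val // !mxE. Qed.

Lemma m1_neq1 : 2%:R != 0 :> F -> m1 != 1%g.
Proof.
move=> c2; rewrite -sl1; apply/eqP => /sl_inj[]; [exact: m1_det | by ring |].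
by move=> e _ _ _; case/eqP: c2; rewrite -[2%:R]/(1 + 1) -{1}e addNr.
Qed.

Lemma order_dvd x n : (x ^+ n = 1)%g -> (#[x] %| n)%N.
Proof. by move=> xn; rewrite order_dvdn xn. Qed.

Lemma trace1_expg p q r s : p * s - q * r = 1 -> p + s = 1 -> (sl p q r s ^+ 6 = 1)%g.
Proof.
move=> det1 tr; have x3 : (sl p q r s ^+ 3 = m1 ^+ 3)%g.
  apply: opp_expg => //; apply: traceN1_expg (oppr_det det1) _.
  by rewrite -tr opprD.
by rewrite -[6%N]/(3 * 2)%N expgM x3 -expgM mulnC expgM m1_sqr expg1n.
Qed.

Lemma even_order_m1 x : 2%:R != 0 :> F -> x \in SL gl -> ~~ odd #[x] -> m1 \in <[x]>%g.
Proof.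
move=> c2 xG even_x; have ox : #[x]%g = #[x]./2.*2 by rewrite -[LHS]odd_double_half (negPf even_x).
have o0 := order_gt0 x.
have [] := involution_SL c2 (groupX (#[x]./2) xG).
- by rewrite -expgM muln2 -ox expg_order.
- move/order_dvd/dvdn_leq => le; have : (#[x]./2 < #[x])%N.
    by rewrite [X in (_ < X)%N]ox -addnn -addn1 leq_add2l -double_gt0 -ox.
  by rewrite ltnNge le // -double_gt0 -ox.
by move=> <-; rewrite groupX ?cycle_id.
Qed.

(** Otherwise -1 is a power of an entry of either triple. *)
Lemma odd_triple t1 t2 : 2%:R != 0 :> F ->
    {subset entries t1 <= SL gl} -> {subset entries t2 <= SL gl} ->
    no_conjugate_powers (SL_group gl) t1 t2 ->
  all (fun a : gl => odd #[a]) (entries t1) || all (fun b : gl => odd #[b]) (entries t2).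
Proof.
move=> c2 s1 s2 nc; apply/orP; have [//|/allPn[a aE even_a]] := boolP (all _ (entries t1)); first by left.
right; apply/allP=> b bE; apply/negPn/negP=> even_b.
have ma := even_order_m1 c2 (s1 a aE) even_a.
have mb := even_order_m1 c2 (s2 b bE) even_b.
by have /negP[] := nc a b aE bE _ _ ma mb (m1_neq1 c2); apply: class_refl.
Qed.

Lemma generating_entries x y z : generating_triple (SL_group gl) (x, y, z) ->
  {subset entries (x, y, z) <= SL gl}.
Proof.
rewrite /generating_triple /= => gen a aE; have genE : <<[set x; y; z]>>%g = SL gl := gen.
by rewrite -genE mem_gen //; move: aE; rewrite !inE -orbA.
Qed.

Lemma order_le3_q2 x : #|F| = 2 -> x \in SL gl -> (#[x] <= 3)%N.
Proof.
move=> q2 /SLE[p [q [r [s [det1 ->]]]]].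
have c2 : 2%:R = 0 :> F := pcharF (isT : prime 2) (q2 : #|F| = 2 ^ 1)%N.
have m11 : -1 = 1 :> F by apply/eqP; rewrite eq_sym -addr_eq0 -[1 + 1]/(2%:R) c2.
have /eqP : (p + s) ^+ 2 = p + s by have := expf_card (p + s); rewrite q2.
rewrite -subr_eq0; have -> : (p + s) ^+ 2 - (p + s) = (p + s) * (p + s - 1) by ring.
rewrite mulf_eq0 subr_eq0 => /orP[]/eqP tr.
  apply: (@leq_trans 2) => //; apply: dvdn_leq => //; apply: order_dvd.
  by rewrite (trace0_expg gl det1 tr) m11 sl1.
by apply: dvdn_leq => //; apply/order_dvd/traceN1_expg; rewrite // tr m11.
Qed.

Lemma odd_dvd_double n m : odd n -> (n %| 2 * m)%N -> (n %| m)%N.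
Proof. by move=> n_odd; rewrite Gauss_dvdr ?coprimen2. Qed.

Lemma order_le3_q3 x : #|F| = 3 -> x \in SL gl -> odd #[x] -> (#[x] <= 3)%N.
Proof.
move=> q3 /SLE[p [q [r [s [det1 ->]]]]] odd_x.
have : (p + s) * (p + s - 1) * (p + s + 1) == 0.
  have -> : (p + s) * (p + s - 1) * (p + s + 1) = (p + s) ^+ 3 - (p + s) by ring.
  by have := expf_card (p + s); rewrite q3 => ->; rewrite subrr.
rewrite !mulf_eq0 subr_eq0 (addr_eq0 _ 1) -orbA => /or3P[]/eqP tr; apply: dvdn_leq => //.
- have : (sl p q r s ^+ (2 * (2 * 1)) = 1)%g by rewrite expgM (trace0_expg gl det1 tr) muln1 m1_sqr.
  by move/order_dvd => /(odd_dvd_double odd_x) /(odd_dvd_double odd_x); rewrite dvdn1 => /eqP ->.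
- have : (sl p q r s ^+ (2 * 3) = 1)%g by apply: trace1_expg.
  by move/order_dvd/(odd_dvd_double odd_x).
by apply/order_dvd/traceN1_expg.
Qed.

(** The traces 0 and 1 give orders at most 3, and the other two are roots of
    t^2 + t = 1. *)
Lemma order_q4 x : #|F| = 4 -> x \in SL gl -> (3 < #[x])%N -> (5 %| #[x])%N.
Proof.
move=> q4 /SLE[p [q [r [s [det1 ->]]]]]; set t := p + s.
have c2 : 2%:R = 0 :> F := pcharF (isT : prime 2) (q4 : #|F| = 2 ^ 2)%N.
have m11 : -1 = 1 :> F by apply/eqP; rewrite eq_sym -addr_eq0 -[1 + 1]/(2%:R) c2.
have : t * (t - 1) * (t ^+ 2 + t + 1) == 0.
  have -> : t * (t - 1) * (t ^+ 2 + t + 1) = t ^+ 4 - t by ring.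
  by have := expf_card t; rewrite q4 => ->; rewrite subrr.
rewrite !mulf_eq0 subr_eq0 -orbA => /or3P[]/eqP tr lt3.
- have : (sl p q r s ^+ 2 = 1)%g by rewrite (trace0_expg gl det1 tr) m11 sl1.
  by move/order_dvd/dvdn_leq => /(_ isT) le2; move: lt3; rewrite ltnNge (leq_trans le2).
- have : (sl p q r s ^+ 3 = 1)%g by apply: traceN1_expg; rewrite // m11.
  by move/order_dvd/dvdn_leq => /(_ isT) le3; move: lt3; rewrite ltnNge le3.
have x5 : (sl p q r s ^+ 5 = 1)%g.
  apply: (trace_golden_expg gl det1 (erefl _)); rewrite -/t.
  by rewrite -[RHS]m11 -[RHS]add0r -tr addrK.
case/primeP: (isT : prime 5) => _ /(_ _ (order_dvd x5)) /orP[|] /eqP o5; last by rewrite o5.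
by rewrite o5 in lt3.
Qed.

(** The trace is one of 0, 1, -1, 2 and -2. *)
Lemma class_q5 x : #|F| = 5 -> x \in SL gl ->
  [\/ (x ^+ 2 = m1)%g, (x ^+ 6 = 1)%g, gtr x = 2%:R /\ (x ^+ 5 = 1)%g | (x ^+ 5 = m1)%g].
Proof.
move=> q5 /SLE[p [q [r [s [det1 ->]]]]]; rewrite gtr_sl //; set t := p + s.
have c5 : 5%:R = 0 :> F := pcharF (isT : prime 5) (q5 : #|F| = 5 ^ 1)%N.
have : t * (t - 1) * (t + 1) * ((t - 2%:R) * (t + 2%:R)) == 0.
  have -> : t * (t - 1) * (t + 1) * ((t - 2%:R) * (t + 2%:R)) = t ^+ 5 - t - 5%:R * (t ^+ 3 - t) by ring.
  by have := expf_card t; rewrite q5 c5 => ->; rewrite subrr mul0r subr0.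
rewrite !mulf_eq0 !subr_eq0 (addr_eq0 t 1) (addr_eq0 t 2%:R) => /orP[/orP[/orP[]|]|/orP[]] /eqP tr.
- by apply: Or41; apply: trace0_expg.
- by apply: Or42; apply: trace1_expg.
- by apply: Or42; rewrite -[6%N]/(3 * 2)%N expgM traceN1_expg // expg1n.
- by apply: Or43; split=> //; apply: trace2_expg.
apply: Or44; rewrite (@opp_expg _ _ _ _ _ _ 5 det1).
  by rewrite (expgD m1 4 1) -[4%N]/(2 * 2)%N expgM m1_sqr expg1n mul1g expg1.
by apply: trace2_expg (oppr_det det1) _ c5; rewrite -opprD -/t tr opprK.
Qed.

Lemma gtrV x : x \in SL gl -> gtr x^-1%g = gtr x.
Proof.
case/SLE=> [p [q [r [s [det1 ->]]]]]; rewrite sl_inv // !gtr_sl // 1?addrC //.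
by rewrite -det1; ring.
Qed.

Lemma gtr2_commute x y z : 2%:R != 0 :> F -> x \in SL gl -> y \in SL gl -> (x * y * z = 1)%g ->
  gtr x = 2%:R -> gtr y = 2%:R -> gtr z = 2%:R -> commute x y.
Proof.
move=> c2 xG yG xyz; have ze : z = (x * y)^-1%g by apply: (mulgI (x * y)%g); rewrite xyz mulgV.
rewrite ze gtrV ?groupM //.
case/SLE: xG => [a [b [c [d [d1 ->]]]]]; case/SLE: yG => [e [f [g [h [d2 ->]]]]].
rewrite !gtr_sl // /gtr gmxM !sl_val // mx2_mul !mxE /= => t1 t2 t3.
exact: trace2_commute.
Qed.

(** The odd triple has orders 3 and 5, with some 5, so that 5 divides no order
    of the other triple.  If 3 occurs as well, the other triple has order 4
    only, up to scalar entries; if not, the odd triple is unipotent. *)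
Lemma not_Beauville_q5 t1 t2 : #|F| = 5 ->
    (logn 3 #|SL_group gl| <= 1)%N -> (logn 5 #|SL_group gl| <= 1)%N ->
    all (fun a : gl => odd #[a]) (entries t1) ->
  ~ Beauville_structure (SL_group gl) t1 t2.
Proof.
case: t1 t2 => [[x y] z] [[x' y'] z'] q5 log3 log5 /allP odd1 [[gen1 gen2] [xyz1 xyz2] [hyp1 hyp2] nc].
have c5 : 5%:R = 0 :> F := pcharF (isT : prime 5) (q5 : #|F| = 5 ^ 1)%N.
have c2 : 2%:R != 0 :> F.
  apply/eqP=> c2; have /eqP := oner_neq0 F; apply.
  by have -> : (1 : F) = 5%:R - 2%:R * 2%:R by [ring]; rewrite c5 c2 mul0r subr0.
have s1 := generating_entries gen1; have s2 := generating_entries gen2.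
have n1 := hyperbolic_neq1 hyp1; have n2 := hyperbolic_neq1 hyp2.
have ne1 (a : gl) : a \in entries (x, y, z) -> a != 1%g by move=> aE; apply: contraNneq n1 => <-.
have ne2 (a : gl) : a \in entries (x', y', z') -> a != 1%g by move=> aE; apply: contraNneq n2 => <-.
have prime_order (a : gl) n : prime n -> a != 1%g -> (#[a] %| n)%N -> (n %| #[a])%N.
  by move=> n_pr a1 /(prime_nt_dvdP n_pr) ->; rewrite ?order_eq1.
have cls1 (a : gl) : a \in entries (x, y, z) -> (3 %| #[a])%N \/ gtr a = 2%:R /\ (5 %| #[a])%N.
  move=> aE; have a1 := ne1 a aE; have odd_a := odd1 a aE.
  have m1_even n : odd n -> (a ^+ n = m1)%g -> (#[a] %| n)%N.
    move=> n_odd an; apply: (odd_dvd_double odd_a).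
    by apply: order_dvd; rewrite mulnC expgM an m1_sqr.
  case: (class_q5 q5 (s1 a aE)) => [a2|a6|[tr a5]|a5].
  - have : (#[a] %| 2 * (2 * 1))%N by apply: order_dvd; rewrite expgM a2 muln1 m1_sqr.
    move/(odd_dvd_double odd_a)/(odd_dvd_double odd_a).
    by rewrite dvdn1 order_eq1 (negPf a1).
  - left; apply: prime_order => //; apply: (odd_dvd_double odd_a).
    by apply: order_dvd; rewrite a6.
  - by right; split=> //; apply: prime_order => //; apply: order_dvd.
  have /eqP := m1_neq1 c2; case; rewrite -a5; apply/eqP.
  by rewrite -order_dvdn m1_even.
have [a0 a0E a0_gt3] := hyperbolic_order_gt3 hyp1.
have n5 (b : gl) : b \in entries (x', y', z') -> ~~ (5 %| #[b])%N.
  move=> bE; apply/negP=> b5.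
  case: (cls1 a0 a0E) => [a3|[_ a5]]; last first.
    exact: (no_conjugate_powers_prime (isT : prime 5) log5 nc (s1 _ a0E) (s2 _ bE) a0E bE a5 b5).
  have a0G := s1 _ a0E; have odd_a := odd1 a0 a0E.
  case: (class_q5 q5 a0G) => [a2|a6|[_ a5]|a5].
  - move: a3; have : (#[a0] %| 2 * (2 * 1))%N by apply: order_dvd; rewrite expgM a2 muln1 m1_sqr.
    move/(odd_dvd_double odd_a)/(odd_dvd_double odd_a).
    by rewrite dvdn1 => /eqP ->.
  - have : (#[a0] %| 2 * 3)%N by apply: order_dvd; rewrite a6.
    move/(odd_dvd_double odd_a)/dvdn_leq => /(_ isT).
    by rewrite leqNgt a0_gt3.
  - by have := dvdn_trans a3 (order_dvd a5).
  have : (#[a0] %| 2 * 5)%N by apply: order_dvd; rewrite mulnC expgM a5 m1_sqr.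
  by move/(odd_dvd_double odd_a)/(dvdn_trans a3).
have [/hasP[a aE a3]|no3] := boolP (has (fun a : gl => 3 %| #[a])%N (entries (x, y, z))).
  have n3 (b : gl) : b \in entries (x', y', z') -> ~~ (3 %| #[b])%N.
    move=> bE; apply/negP=> b3.
    exact: (no_conjugate_powers_prime (isT : prime 3) log3 nc (s1 _ aE) (s2 _ bE) aE bE a3 b3).
  have cls2 (b : gl) : b \in entries (x', y', z') -> b = m1 \/ (b ^+ 2 = m1)%g.
    move=> bE; have b1 := ne2 b bE; have bG := s2 b bE.
    have inv_m1 : (b ^+ 2 = 1)%g -> b = m1.
      by move=> b2; case: (involution_SL c2 bG b2) => // b1'; rewrite b1' eqxx in b1.
    case: (class_q5 q5 bG) => [b2|b6|[_ b5]|b5]; [by right | left | left | left].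
    - apply: inv_m1; apply/eqP; rewrite -order_dvdn.
      have : (#[b] %| 3 * 2)%N by apply: order_dvd.
      by rewrite Gauss_dvdr // coprime_sym prime_coprime // n3.
    - by have := n5 b bE; rewrite prime_order // order_dvd.
    apply: inv_m1; apply/eqP; rewrite -order_dvdn.
    have : (#[b] %| 5 * 2)%N by apply: order_dvd; rewrite expgM b5 m1_sqr.
    by rewrite Gauss_dvdr // coprime_sym prime_coprime // n5.
  have mem (b : gl) : b \in entries (x', y', z') -> b \in SL gl := s2 b.
  have x'E : x' \in entries (x', y', z') by rewrite !inE eqxx.
  have y'E : y' \in entries (x', y', z') by rewrite !inE eqxx orbT.
  have z'E : z' \in entries (x', y', z') by rewrite !inE eqxx !orbT.
  have nab := generating_not_commute gen2 xyz2.
  case: (cls2 x' x'E) => [ex|x2]; first by apply: nab; rewrite ex; apply/m1_central/mem.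
  case: (cls2 y' y'E) => [ey|y2].
    by apply: nab; rewrite ey; apply/commute_sym/m1_central/mem.
  case: (cls2 z' z'E) => [ez|z2].
    apply: nab; have -> : y' = (x'^-1 * z'^-1)%g.
      by apply: (mulgI x'); rewrite mulKVg; apply: (mulIg z'); rewrite mulVg; exact: xyz2.
    rewrite ez; apply: commuteM; first by apply: commuteV.
    by apply: commuteV; apply/commute_sym/m1_central/mem.
  exact: (trace0_not_generating c2 (mem _ x'E) (mem _ y'E) x2 y2 z2 xyz2 gen2).
have tr2 (a : gl) : a \in entries (x, y, z) -> gtr a = 2%:R.
  move=> aE; case: (cls1 a aE) => [a3|[]//].
  by case/negP: no3; apply/hasP; exists a.
apply: (generating_not_commute gen1 xyz1).
by apply: (gtr2_commute c2 _ _ xyz1); rewrite ?s1 ?tr2 // !inE eqxx ?orbT.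
Qed.

Theorem not_admits_small : (#|F| <= 5)%N ->
    (#|SL_group gl| %| #|F| * #|F|.-1 ^ 2 * #|F|.+1)%N ->
  ~ admits_Beauville_structure (SL_group gl).
Proof.
move=> q5 dvdG [[[x y] z] [[[x' y'] z'] B]].
have [[gen1 gen2] [xyz1 xyz2] [hyp1 hyp2] nc] := B.
have s1 := generating_entries gen1; have s2 := generating_entries gen2.
have [a aE a_gt3] := hyperbolic_order_gt3 hyp1.
have [b bE b_gt3] := hyperbolic_order_gt3 hyp2.
have log_le n N : #|F| = N -> (0 < N * N.-1 ^ 2 * N.+1)%N ->
    (logn n (N * N.-1 ^ 2 * N.+1) <= 1)%N -> (logn n #|SL_group gl| <= 1)%N.
  by move=> qN N0; apply: leq_trans; apply: dvdn_leq_log; rewrite // -qN.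
have B' : Beauville_structure (SL_group gl) (x', y', z') (x, y, z).
  by split=> //; apply: no_conjugate_powers_sym.
have : (#|F| \in [:: 2; 3; 4; 5])%N.
  by move: q5 (finNzRing_gt1 F); case: #|F| => [|[|[|[|[|[|]]]]]].
rewrite !inE => /or4P[]/eqP q.
- by have := order_le3_q2 q (s1 a aE); rewrite leqNgt a_gt3.
- have c3 : 3%:R = 0 :> F := pcharF (isT : prime 3) (q : #|F| = 3 ^ 1)%N.
  have c2 : 2%:R != 0 :> F.
    apply/eqP=> c2; have /eqP := oner_neq0 F; apply.
    by have -> : (1 : F) = 3%:R - 2%:R by [ring]; rewrite c3 c2 subr0.
  case/orP: (odd_triple c2 s1 s2 nc) => /allP odd_t.
    by have := order_le3_q3 q (s1 a aE) (odd_t a aE); rewrite leqNgt a_gt3.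
  by have := order_le3_q3 q (s2 b bE) (odd_t b bE); rewrite leqNgt b_gt3.
- have log5 : (logn 5 #|SL_group gl| <= 1)%N by apply: (log_le _ _ q).
  apply: (no_conjugate_powers_prime (isT : prime 5) log5 nc (s1 _ aE) (s2 _ bE) aE bE).
    exact: order_q4 q (s1 a aE) a_gt3.
  exact: order_q4 q (s2 b bE) b_gt3.
have c5 : 5%:R = 0 :> F := pcharF (isT : prime 5) (q : #|F| = 5 ^ 1)%N.
have c2 : 2%:R != 0 :> F.
  apply/eqP=> c2; have /eqP := oner_neq0 F; apply.
  by have -> : (1 : F) = 5%:R - 2%:R * 2%:R by [ring]; rewrite c5 c2 mul0r subr0.
have log3 : (logn 3 #|SL_group gl| <= 1)%N by apply: (log_le _ _ q).
have log5 : (logn 5 #|SL_group gl| <= 1)%N by apply: (log_le _ _ q).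
case/orP: (odd_triple c2 s1 s2 nc) => odd_t.
  exact: (not_Beauville_q5 q log3 log5 odd_t B).
exact: (not_Beauville_q5 q log3 log5 odd_t B').
Qed.

End NonExistence.

(** * The theorem *)

Section Model.

Variable F : finFieldType.

Lemma GLval_onto (M : 'M[F]_2) : \det M != 0 -> {x : {'GL_2[F]} | GLval x = M}.
Proof.
move=> detM; exists (insubd (1%g : {'GL_2[F]}) M).
by rewrite -[LHS]/(val _) insubdK // -topredE /= unitmxE unitfE.
Qed.

Lemma GLval_inj : injective (@GLval 2 F).
Proof. by move=> x y eq_xy; apply: val_inj. Qed.

Definition GL_gl2 : gl2 F := Gl2 (@GL_MxE 2 F) GLval_inj GLval_onto.

Lemma SL2_card_dvd : (#|SL2_group F| %| #|F| * #|F|.-1 ^ 2 * #|F|.+1)%N.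
Proof. by rewrite -card_GL_2; apply: cardSg (subsetT _). Qed.

Lemma SL2_groupE : SL2_group F = SL_group GL_gl2.
Proof. by apply: group_inj; apply/setP=> x; rewrite !inE. Qed.

End Model.

Theorem admits_large (F : finFieldType) (gl : gl2 F) (p e : nat) : prime p -> (0 < e)%N ->
  #|F| = (p ^ e)%N -> (5 < #|F|)%N -> admits_strongly_real_Beauville_structure (SL_group gl).
Proof.
move=> p_pr e0 qE q5; have [p2|p_odd] := even_prime p_pr.
  by apply: (admits_even gl e0) => //; rewrite -p2.
have c2 : 2%:R != 0 :> F.
  have pF := card_finPcharP qE p_pr; rewrite -(dvdn_pcharf pF) dvdn_prime2 //.
  by apply: contraTneq p_odd => ->.
have [q7|n7] := eqVneq #|F| 7; first exact: admits_7.
have [q9|n9] := eqVneq #|F| 9; first exact: admits_9.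
have q_odd : odd #|F| by rewrite qE oddX p_odd orbT.
have q9 : (9 < #|F|)%N.
  by move: q5 n7 n9 q_odd; case: #|F| => [|[|[|[|[|[|[|[|[|[|]]]]]]]]]].
apply: (admits_large_odd gl p_pr e0 qE c2 q9).
rewrite qE in q9 *; clear qE; case: e e0 q9 => [|[|e]] // _ q9; first by left; rewrite expn1.
right; have p3 : (3 <= p)%N by rewrite odd_prime_gt2.
have [p5|p5] := leqP 5 p.
  rewrite !expnS mulnA; apply: leq_trans (leq_mul p5 p5) _.
  by rewrite leq_pmulr // expn_gt0 prime_gt0.
have p_3 : p = 3 by move: p3 p5 p_odd; case: (p) => [|[|[|[|[|]]]]].
move: q9; rewrite p_3; case: e => [|e] // _.
by rewrite !expnS !mulnA (@leq_trans (3 * 3 * 3)) // leq_pmulr // expn_gt0.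
Qed.

Local Close Scope ring_scope.

Theorem theorem5p1 (q : nat) (hq : prime_power q)
    (F : finFieldType) (cardF : #|F| = q) :
  (admits_Beauville_structure (SL2_group F) <-> 5 < q) /\
  (5 < q -> admits_strongly_real_Beauville_structure (SL2_group F)).
Proof.
have [p [e [p_pr e0 qE]]] := hq; rewrite -cardF in qE *.
rewrite SL2_groupE.
have large : 5 < #|F| -> admits_strongly_real_Beauville_structure (SL_group (GL_gl2 F)).
  exact: admits_large p_pr e0 qE.
split=> //; split=> [B|/large[t1 [t2 [B _]]]]; last by exists t1, t2.
rewrite ltnNge; apply/negP=> q5; apply: (@not_admits_small F (GL_gl2 F) q5 _ B).
by rewrite -SL2_groupE; apply: SL2_card_dvd.
Qed.
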